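(* Let $X_i$, $1\le i\le n$, be a sequence of independent random variables with $EX_i=0$. Put $S_n=\sum_{i=1}^nX_i$ and $B_n^2=\sum_{i=1}^nEX_i^2$. Assume that there exist positive constants $c_1,c_2$ and $t_0$ such that $$B_n^2\ge c_1^2n,\qquad Ee^{t_0\sqrt{|X_i|}}\le c_2\quad\text{for }1\le i\le n.$$ Then $$\frac{P(S_n/B_n\ge x)}{1-\Phi(x)}=1+O(1)(1+x^3)/\sqrt n$$ for $0\le x\le(c_1t_0^2)^{1/3}n^{1/6}$, where $O(1)$ is bounded by a constant depending on $c_2$ and $c_1t_0^2$. In particular, $$\frac{P(S_n/B_n\ge x)}{1-\Phi(x)}\to1$$ uniformly in $0\le x\le o(n^{1/6})$, i.e. (with $c_1,c_2,t_0$ fixed as $n\to\infty$) for every sequence $a_n\geq 0$ with $a_n=o(n^{1/6})$, $\sup_{0\le x\le a_n}\bigl|\frac{P(S_n/B_n\ge x)}{1-\Phi(x)}-1\bigr|\to0$ as $n\to\infty$.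
   Context: $\Phi$ is the standard normal distribution function. $B_n>0$ denotes the positive square root of $B_n^2$. The constant bounding $O(1)$ depends only on $c_2$ and $c_1t_0^2$. *)

(* Defs.v *)
From HB Require Import structures.
From mathcomp Require Import all_boot all_order all_algebra.
From mathcomp Require Import all_classical all_reals all_analysis.

Set Implicit Arguments.
Unset Strict Implicit.
Unset Printing Implicit Defensive.

Import Order.TTheory GRing.Theory Num.Theory.
Import numFieldNormedType.Exports.

Local Open Scope classical_set_scope.
Local Open Scope ring_scope.

Definition mutually_independent (R : realType) (d : measure_display)
    (T : measurableType d) (P : probability T R) (I : finType)
    (X : I -> {RV P >-> R}) : Prop :=
  forall (J : {set I}) (A : I -> set R),
    (forall i, i \in J -> measurable (A i)) ->
    P (\bigcap_(i in [set` J]) X i @^-1` A i) =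
    (\prod_(i in J) P (X i @^-1` A i))%E.

Definition Phi (R : realType) (x : R) : R :=
  fine (normal_prob (0 : R) (1 : R) `]-oo, x]).

Section sums.
Context (R : realType) (d : measure_display) (T : measurableType d)
  (P : probability T R) (n : nat) (X : 'I_n -> {RV P >-> R}).

Definition partial_sum (w : T) : R := \sum_(i < n) X i w.

Definition sum_sq_moments : \bar R :=
  (\sum_(i < n) 'E_P[fun w => (X i w ^+ 2)%R])%E.

(* [fine] is harmless under [moderate_deviation_hyp]: the exponential moment
   bound makes all second moments finite. *)
Definition B_norm : R := Num.sqrt (fine sum_sq_moments).

Definition tail_ratio (x : R) : R :=
  fine (P [set w | x <= partial_sum w / B_norm]) / (1 - Phi x).

(* The exponential moment bound also makes every [X i] integrable, so that
   the expectation in the centering condition is a genuine mean. *)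
Definition moderate_deviation_hyp (c1 c2 t0 : R) : Prop :=
  [/\ mutually_independent X,
      forall i, ('E_P[X i] = 0)%E,
      ((c1 ^+ 2 * n%:R)%:E <= sum_sq_moments)%E &
      forall i, ('E_P[fun w => expR (t0 * Num.sqrt `|X i w|)%R] <= c2%:E)%E].

End sums.

(* Main.v *)
Require Import Defs.
From HB Require Import structures.
From mathcomp Require Import all_boot all_order all_algebra.
From mathcomp Require Import all_classical all_reals all_analysis.
From mathcomp Require Import measurable_realfun.
From mathcomp Require Import ring lra.

Set Implicit Arguments.
Unset Strict Implicit.
Unset Printing Implicit Defensive.

Import Order.TTheory GRing.Theory Num.Theory.
Import numFieldNormedType.Exports.

Local Open Scope classical_set_scope.
Local Open Scope ring_scope.

(** Both assertions come from a single bound, uniform in [n]: with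
K = c1 t0^2, the relative error of the normal approximation is at most
C (1 + x^3) / sqrt n, where C depends on [c2] and K only.  The limit
statement follows, since 1 / sqrt n and (a_n)^3 / sqrt n tend to 0.

The bound rests on Cramer's change of measure.  Put e = 1 / sqrt n and
W = S_n / B_n, and suppose first that every summand y_i of W takes finitely
many values.  Give y_i the density exp(x y_i), normalised by its moment
generating function at x, and let M be the product of these normalisers.  Then
   P(W >= x) = M E[exp(- x W) 1(W >= x)],
the expectation being under the tilted law.  There the sum has a mean
m = x + O((1 + x)^2 e) and a variance s^2 = 1 + O((1 + x) e), so that W >= x is
no longer a rare event and an absolute error O(e) in the central limit theorem
([berry_esseen]) is good enough.  Summation by parts ([abel_compare]) turns it
into an error O(e exp(- x^2)) for the expectation above ([tilted_tail]); after
multiplication by M, which is about exp(x^2 / 2), Mills' inequality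
([gtail_ge_expR]) makes it O((1 + x) e) relative to 1 - Phi x.  The Gaussian
counterpart of the right-hand side is explicit,
   M exp(- x m + x^2 s^2 / 2) (1 - Phi ((x - m) / s + x s)),
and equals 1 - Phi x up to a factor exp(O((1 + x^3) e))
([gauss_tilt_close]).  All this is [tilted_estimate].

The variables X_i have no moment generating function: only
exp(t0 sqrt |X_i|) is integrable.  Scale them to f_i = t0^2 X_i and truncate at
|f_i| <= a = s^2, where now s = (3 / 4) kappa^2 n^(1/3) and kappa^3 = K.  For
x <= kappa n^(1/6) this level is low enough for tilting, because
x |f_i| / B <= (3 / 4) sqrt |f_i| below it ([lam_bound]), so that the remaining
exp(sqrt |f_i| / 4) pays for polynomial factors; and it is high enough for the
probability n c2 exp(- s) of truncating anything to be negligible with respect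
to 1 - Phi x, which is of order exp(- x^2 / 2) up to a factor 1 + x, because
x^2 / 2 <= (2 / 3) s ([bad_small]).  These two requirements are what limits x
to the order n^(1/6).

The truncated variables are rounded to multiples of 1 / n, which moves their
sum by at most 1 and W by O(e).  They then take finitely many values, so that
tilting, Berry-Esseen and all the expansions are finite sums over a finite
product space, and measure theory is confined to the moments of a single
variable and to [code_law_Ex], which says that independence makes the joint law
of the rounded variables a product.  On the finite product space,
Berry-Esseen is proved by Stein's method: a concentration inequality
([concentration]) controls the jump of the derivative of the solution of
Stein's equation.

If (1 + x) e is not small compared with the constants, then [n] is bounded in
terms of [c2] and K, and a crude bound suffices
([moderate_deviation_bound]). *)

(** * The standard normal tail *)

Section gauss.
Context {R : realType}.
Implicit Types x y z w u : R.

Lemma ge0_is_derive_le (f df : R -> R) (a b : R) : a <= b ->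
  (forall x, a <= x <= b -> is_derive x 1 f (df x)) ->
  (forall x, a <= x <= b -> 0 <= df x) -> f a <= f b.
Proof.
move=> ab fD df0; have [||c cab fE] := @MVT_segment R f df a b ab.
- by move=> x; rewrite in_itv/= => /andP[ax xb]; apply: fD; rewrite !ltW.
- apply: derivable_within_continuous => x; rewrite in_itv/= => xab.
  by have [] := fD _ xab.
- by rewrite -subr_ge0 fE mulr_ge0 ?subr_ge0// df0// -in_itv.
Qed.

Definition gpdf x : R := normal_pdf 0 1 x.
Definition gpeak : R := normal_peak 1.
Definition gtail x : R := 1 - Phi x.

Lemma gpeak_bounds : 3^-1 <= gpeak <= 2^-1.
Proof.
rewrite /gpeak /normal_peak expr1n mul1r.
have p2 := pi_ge2 R; have := pihalf_lt2 R; rewrite ltr_pdivrMr// => p4.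
have s2 : 2 <= Num.sqrt (pi *+ 2 : R).
  rewrite -(ler_pXn2r (n := 2))// ?nnegrE ?sqrtr_ge0// sqr_sqrtr; lra.
have s3 : Num.sqrt (pi *+ 2 : R) <= 3.
  rewrite -(ler_pXn2r (n := 2))// ?nnegrE ?sqrtr_ge0// sqr_sqrtr; lra.
by rewrite !lef_pV2 ?posrE; [rewrite s3 s2 | lra | lra | lra | lra].
Qed.

Lemma gpeak_gt0 : 0 < gpeak.
Proof. have := gpeak_bounds; lra. Qed.

Lemma gpdfE x : gpdf x = gpeak * expR (- (x ^+ 2 / 2)).
Proof.
rewrite /gpdf normal_pdfE ?oner_neq0// /normal_fun subr0 expr1n.
by rewrite mulNr.
Qed.

Lemma gpdf_gt0 x : 0 < gpdf x.
Proof. by rewrite gpdfE mulr_gt0 ?gpeak_gt0 ?expR_gt0. Qed.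

Lemma gpdfN x : gpdf (- x) = gpdf x.
Proof. by rewrite !gpdfE sqrrN. Qed.

Lemma is_derive_gpdf x : is_derive x 1 gpdf (- x * gpdf x).
Proof.
rewrite (_ : gpdf = (fun y => gpeak * expR (- (y ^+ 2 / 2)))); last first.
  by apply/funext => y; rewrite gpdfE.
apply: is_derive_eq.
rewrite /= !scaler0 /GRing.scale /=.
by field.
Qed.

Lemma is_derive_Phi x : is_derive x 1 (@Phi R) (gpdf x).
Proof.
have cpdf : {for x, continuous gpdf}.
  exact: (@continuous_normal_pdf _ 0 1 (oner_neq0 _) x).
have intg : lebesgue_measure.-integrable
    [set` Interval -oo%O (BRight (x + 1))] (EFin \o gpdf).
  by apply: (integrableS _ _ (subsetT _)) => //; exact: integrable_normal_pdf.
have xx1 : x < x + 1 by rewrite ltrDl.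
have [d e] := continuous_FTC1 xx1 intg (ltNyr _) cpdf.
rewrite -e derive1E.
exact: derivableP d.
Qed.

Lemma is_derive_gtail x : is_derive x 1 gtail (- gpdf x).
Proof.
have dPhi := is_derive_Phi x.
rewrite (_ : gtail = (fun y => 1 - Phi y))//.
by apply: is_derive_eq; rewrite add0r mul1r.
Qed.

Lemma gtail_bounds x : 0 <= gtail x <= 1.
Proof.
rewrite /gtail /Phi.
have P1 : (normal_prob (0 : R) 1 `]-oo, x] <= 1)%E by exact: probability_le1.
have P0 : (0 <= normal_prob (0 : R) 1 `]-oo, x])%E by exact: measure_ge0.
have Pf : normal_prob (0 : R) 1 `]-oo, x] \is a fin_num.
  by rewrite ge0_fin_numE// (le_lt_trans P1) ?ltry.
rewrite -(fineK Pf) !lee_fin in P0 P1.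
lra.
Qed.

Lemma gtail_nonincr x y : x <= y -> gtail y <= gtail x.
Proof.
move=> xy; rewrite -lerN2.
apply: (@ge0_is_derive_le (\- gtail) gpdf x y xy).
- move=> u _; have := is_derive_gtail u => dT.
  by apply: is_derive_eq; rewrite opprK.
- by move=> u _; rewrite ltW// gpdf_gt0.
Qed.

(** The identity as a random variable: it gives access to the limits at
infinity of a distribution function. *)
Definition real_id : measurableTypeR R -> R := idfun.

HB.instance Definition _ :=
  @isMeasurableFun.Build _ _ _ _ real_id (@measurable_id _ _ setT).

Lemma gtail_small x (e : R) : 0 < e -> exists2 y, x <= y & gtail y < e.
Proof.
move=> e0.
pose X : {RV (normal_prob (0 : R) 1) >-> R} := real_id.
have : fine (cdf X r) @[r --> +oo] --> fine (1%E : \bar R).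
  by apply: fine_cvg; rewrite fineK//; exact: cvg_cdfy1.
move=> /cvgrPdist_lt /(_ e e0) [N [Nreal NP]].
exists (Num.max x (N + 1)); first by rewrite le_max lexx.
have Nx : N < Num.max x (N + 1) by rewrite lt_max ltrDl ltr01 orbT.
exact: le_lt_trans (ler_norm _) (NP _ Nx).
Qed.

Lemma gtail_large x (e : R) : 0 < e -> exists2 y, y <= x & 1 - e < gtail y.
Proof.
move=> e0.
pose X : {RV (normal_prob (0 : R) 1) >-> R} := real_id.
have : fine (cdf X r) @[r --> -oo] --> fine (0%E : \bar R).
  by apply: fine_cvg; rewrite fineK//; exact: cvg_cdfNy0.
move=> /cvgrPdist_lt /(_ e e0) [N [Nreal NP]].
exists (Num.min x (N - 1)); first by rewrite ge_min lexx.
have Nx : Num.min x (N - 1) < N by rewrite gt_min gtrDl ltrN10 orbT.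
have := NP _ Nx; rewrite /= sub0r normrN => /(le_lt_trans (ler_norm _)).
by rewrite /gtail ltrD2l ltrN2.
Qed.

(** The normal density being even, [gtail y + gtail (- y)] has derivative 0;
its value is read off at infinity. *)
Lemma gtailN x : gtail (- x) = 1 - gtail x.
Proof.
pose h y : R := gtail y + gtail (- y).
have dh y : is_derive y 1 h 0.
  have d1 := is_derive_gtail y; have d2 := is_derive_gtail (- y).
  have d3 : is_derive y 1 (gtail \o -%R) _ := @is_derive1_comp _ gtail -%R y _ _ d2 _.
  rewrite (_ : h = gtail \+ (gtail \o -%R))//.
  apply: is_derive_eq.
  by rewrite gpdfN mulrN1 opprK addNr.
have hc y z : h y = h z.
  wlog yz : y z / y <= z => [hw|].
    by case: (leP y z) => [|/ltW] /hw.
  by apply/eqP; rewrite eq_le; apply/andP; split;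
    [have := @ge0_is_derive_le h (fun=> 0) y z yz; apply
    |rewrite -lerN2; have := @ge0_is_derive_le (\- h) (fun=> 0) y z yz; apply => // u _;
     have := dh u => dhu; apply: is_derive_eq; rewrite oppr0].
have h1 : h x = 1.
  apply/eqP; rewrite -subr_eq0 -normr_eq0 eq_le normr_ge0 andbT.
  apply/ler_addgt0Pl => e e0; rewrite addr0.
  have [y y0 ye] := gtail_small 0 e0.
  have [z zy ze] := gtail_large (- y) e0.
  have := @gtail_nonincr y (- z); rewrite lerNr => /(_ zy) yz.
  have := gtail_bounds z; have := gtail_bounds (- z).
  rewrite (hc x z) /h.
  move: (gtail z) (gtail (- z)) (gtail y) ze yz ye => a b c *.
  by rewrite ler_norml; apply/andP; split; lra.
by rewrite -h1 /h addrC addKr.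
Qed.
End gauss.

(** * Mills' inequalities and the hazard rate *)

Section gauss2.
Context {R : realType}.
Implicit Types x y z w u : R.

Lemma gpdf_le_half x : gpdf x <= 2^-1.
Proof.
have /andP[p3 p2] := @gpeak_bounds R.
apply: le_trans p2; rewrite gpdfE ler_piMr ?(ltW gpeak_gt0)//.
by rewrite expR_le1 oppr_le0 divr_ge0 ?sqr_ge0.
Qed.

(** [u |-> x * gtail u - gpdf u] has derivative [(u - x) * gpdf u], hence is
nondecreasing beyond [x], and it tends to 0 at infinity. *)
Lemma gtail_mills_ub x : 0 <= x -> x * gtail x <= gpdf x.
Proof.
move=> x0; apply/ler_addgt0Pl => e e0.
have ex : 0 < e / (1 + x) by rewrite divr_gt0// ltr_pwDl.
have [y xy ye] := gtail_small x ex.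
have := @ge0_is_derive_le _ (fun u => x * gtail u - gpdf u) (fun u => (u - x) * gpdf u) x y xy.
have H0 : (forall u, x <= u <= y -> 0 <= (u - x) * gpdf u).
  by move=> u /andP[xu _]; rewrite mulr_ge0 ?subr_ge0// ltW ?gpdf_gt0.
have dd u : x <= u <= y -> is_derive u 1 (fun u => x * gtail u - gpdf u) ((u - x) * gpdf u).
  move=> _; have d1 := is_derive_gtail u; have d2 := is_derive_gpdf u.
  by apply: is_derive_eq; rewrite /GRing.scale /=; ring.
move=> /(_ dd H0) H.
have yb := gpdf_gt0 y.
have : x * gtail y <= e.
  have xe : x * gtail y <= (1 + x) * gtail y.
    by rewrite ler_wpM2r//; [have /andP[] := gtail_bounds y | lra].
  apply: le_trans xe _; rewrite ltr_pdivlMr in ye; last by lra.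
  by rewrite mulrC ltW.
lra.
Qed.

(** [u |-> gpdf u / (1 + u) - gtail u] is nondecreasing on the positive
half-line and tends to 0 at infinity. *)
Lemma gtail_mills_lb x : 0 <= x -> gpdf x <= (1 + x) * gtail x.
Proof.
move=> x0; rewrite mulrC -ler_pdivrMr; last by lra.
apply/ler_addgt0Pl => e e0.
pose y := Num.max x e^-1.
have xy : x <= y by rewrite le_max lexx.
pose f u := gpdf u / (1 + u) - gtail u.
have := @ge0_is_derive_le _ f (fun u => gpdf u * u / (1 + u) ^+ 2) x y xy.
have dd u : x <= u <= y -> is_derive u 1 f (gpdf u * u / (1 + u) ^+ 2).
  move=> /andP[xu _]; have d1 := is_derive_gtail u; have d2 := is_derive_gpdf u.
  have u1 : 1 + u != 0 by rewrite gt_eqF//; lra.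
  have d3 : is_derive u 1 (fun u => 1 + u) 1.
    by apply: is_derive_eq; rewrite add0r mulr1.
  have d4 := @is_deriveV R (fun u => 1 + u) u _ _ u1 d3.
  apply: is_derive_eq; rewrite /GRing.scale /=.
  field.
  by [].
move=> /(_ dd) H.
have {H} : f x <= f y.
  apply: H => u /andP[xu _]; rewrite divr_ge0 ?sqr_ge0// mulr_ge0 ?(ltW (gpdf_gt0 _))//; lra.
rewrite /f => H.
have /andP[T0 _] := gtail_bounds y.
have : gpdf y / (1 + y) <= e.
  rewrite ler_pdivrMr; last by lra.
  have ey : 1 <= e * y.
    rewrite -(mulfV (x := e)) ?gt_eqF// ler_pM2l// le_max lexx orbT//.
  have := gpdf_le_half y; lra.
lra.
Qed.

Lemma gtail0 : gtail 0 = 2^-1 :> R.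
Proof. have := gtailN (0 : R); rewrite oppr0; lra. Qed.

(** The hazard rate [gpdf / gtail] grows at most linearly; for negative [x]
both [gpdf] and [1 - gtail] are at most 1/2. *)
Lemma gpdf_le_gtail x : gpdf x <= (1 + `|x|) * gtail x.
Proof.
have [x0|x0] := leP 0 x; first by rewrite ger0_norm// gtail_mills_lb.
have := gpdf_le_half x; have := gtail_nonincr (ltW x0); rewrite gtail0 => t h.
have := normr_ge0 x => n0.
have : 0 <= `|x| * gtail x by rewrite mulr_ge0//; lra.
lra.
Qed.

Lemma gtail_gt0 x : 0 < gtail x.
Proof.
have := gpdf_le_gtail x; have := gpdf_gt0 x => p0 pt.
have := lt_le_trans p0 pt; rewrite pmulr_rgt0// ltr_pwDl//.
Qed.

Lemma gtail_le_expR x : 0 <= x -> gtail x <= 2 * expR (- (x ^+ 2 / 2)).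
Proof.
move=> x0; have /andP[T0 T1] := gtail_bounds x.
have /andP[p3 p2] := @gpeak_bounds R.
have [x1|x1] := leP 1 x.
  have := gtail_mills_ub x0; rewrite gpdfE.
  have := expR_gt0 (- (x ^+ 2 / 2)); set E := expR _ => E0 h.
  have : gtail x <= x * gtail x by rewrite ler_peMl.
  have : gpeak * E <= 2^-1 * E by rewrite ler_pM2r.
  lra.
have : 1 + - (x ^+ 2 / 2) <= expR (- (x ^+ 2 / 2)) by exact: expR_ge1Dx.
have : x ^+ 2 <= 1 by rewrite expr_le1// ltW.
lra.
Qed.

Lemma gtail_ge_expR x : 0 <= x -> expR (- (x ^+ 2 / 2)) <= 3 * ((1 + x) * gtail x).
Proof.
move=> x0; have := gtail_mills_lb x0; rewrite gpdfE.
have /andP[p3 p2] := @gpeak_bounds R.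
have := expR_gt0 (- (x ^+ 2 / 2)); set E := expR _ => E0 h.
have : 3^-1 * E <= gpeak * E by rewrite ler_pM2r.
lra.
Qed.

(** On [[a, b]] the hazard rate is at most [1 + |u| <= L], so that
[gtail u * expR (L * u)] is nondecreasing there. *)
Lemma gtail_ratio (a b L : R) : a <= b -> 1 - L <= a -> b <= L - 1 ->
  gtail a <= gtail b * expR (L * (b - a)).
Proof.
move=> ab La bL.
have := @ge0_is_derive_le _ (fun u => gtail u * expR (L * u))
  (fun u => (L * gtail u - gpdf u) * expR (L * u)) a b ab.
have dd u : a <= u <= b -> is_derive u 1 (fun u => gtail u * expR (L * u))
    ((L * gtail u - gpdf u) * expR (L * u)).
  move=> _; have d1 := is_derive_gtail u.
  by apply: is_derive_eq; rewrite /GRing.scale /=; ring.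
move=> /(_ dd) H.
have {H} : gtail a * expR (L * a) <= gtail b * expR (L * b).
  apply: H => u /andP[au ub]; rewrite mulr_ge0 ?expR_ge0// subr_ge0.
  apply: le_trans (gpdf_le_gtail u) _; rewrite ler_pM2r ?gtail_gt0//.
  have : `|u| <= L - 1 by rewrite ler_norml; lra.
  lra.
rewrite -(ler_pM2r (expR_gt0 (- (L * a)))) -!mulrA -!expRD subrr expR0 mulr1.
by rewrite mulrBr.
Qed.


(** ** Stein's equation for a half-line *)

(** The reciprocal of the density is the integrating factor of Stein's
equation f' - w f = 1(w < z) - Phi z. *)
Definition gipdf w : R := gpeak^-1 * expR (w ^+ 2 / 2).

Lemma gpdfK w : gpdf w * gipdf w = 1.
Proof.
rewrite gpdfE /gipdf mulrACA mulfV ?gt_eqF ?gpeak_gt0// mul1r -expRD addNr.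
exact: expR0.
Qed.

Lemma gipdf_gt0 w : 0 < gipdf w.
Proof. by rewrite /gipdf mulr_gt0 ?expR_gt0// invr_gt0 gpeak_gt0. Qed.

Lemma gtail_gipdf w : 0 <= w -> gtail w * gipdf w <= 6.
Proof.
move=> w0; have /andP[p3 p2] := @gpeak_bounds R; have p0 := @gpeak_gt0 R.
have h : gtail w * gipdf w <= 2 * expR (- (w ^+ 2 / 2)) * gipdf w.
  by rewrite ler_pM2r ?gipdf_gt0// gtail_le_expR.
apply: le_trans h _; rewrite /gipdf mulrACA -expRD addNr expR0 mulr1.
rewrite ler_pdivrMr//.
lra.
Qed.

Lemma gtail_gipdf_mills w : 0 <= w -> w * gtail w * gipdf w <= 1.
Proof.
move=> w0; rewrite -(gpdfK w) ler_pM2r ?gipdf_gt0//; exact: gtail_mills_ub.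
Qed.

(** On [w <= z] this is the bounded solution of Stein's equation; on [z <= w] the
solution is obtained from it by the symmetry (z, w) |-> (- z, - w). *)
Definition stein_left z w : R := gtail z * (Phi w * gipdf w).

Lemma PhiE w : Phi w = gtail (- w) :> R.
Proof. by rewrite gtailN /gtail; lra. Qed.

Lemma is_derive_stein_left z w :
  is_derive w 1 (stein_left z) (gtail z + w * stein_left z w).
Proof.
have d1 := is_derive_Phi w.
have p0 := @gpeak_gt0 R.
have p1 : gpeak != 0 :> R by rewrite gt_eqF.
rewrite (_ : stein_left z = fun w => gtail z * (Phi w * (gpeak^-1 * expR (w ^+ 2 / 2))))//.
apply: is_derive_eq; rewrite !scaler0 /GRing.scale /= /stein_left.
have := gpdfK w; rewrite /gipdf.
set E := expR _ => h.
have -> : gtail z + w * (gtail z * (Phi w * (gpeak^-1 * E))) =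
  gtail z * (gpdf w * (gpeak^-1 * E)) + w * (gtail z * (Phi w * (gpeak^-1 * E))).
  by rewrite h mulr1.
by rewrite /GRing.scale /=; field.
Qed.

Lemma stein_left_bound z w : w <= z -> 0 <= stein_left z w <= 6.
Proof.
move=> wz; have /andP[z0 z1] := gtail_bounds z.
have /andP[w0 w1] := gtail_bounds (- w); have i0 := gipdf_gt0 w.
rewrite /stein_left PhiE; apply/andP; split.
  by rewrite mulr_ge0// mulr_ge0// ltW.
have [w0'|/ltW w0'] := leP w 0.
  have := @gtail_gipdf (- w); rewrite oppr_ge0 /gipdf sqrrN => /(_ w0') => h.
  by apply: le_trans h; rewrite ler_piMl// mulr_ge0// ltW.
have h := gtail_gipdf w0'; have t := gtail_nonincr wz.
apply: le_trans h; apply: ler_pM => //; first by rewrite mulr_ge0// ltW.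
by rewrite ler_piMl// ltW.
Qed.

(** By [is_derive_stein_left] the quantity bounded is the derivative of
[stein_left z]; Mills' upper bound controls its second term. *)
Lemma stein_left_deriv_bound z w : w <= z -> `|gtail z + w * stein_left z w| <= 2.
Proof.
move=> wz; have /andP[z0 z1] := gtail_bounds z.
have /andP[w0 w1] := gtail_bounds (- w); have i0 := gipdf_gt0 w.
have [w0'|/ltW w0'] := leP w 0.
  have := @gtail_gipdf_mills (- w); rewrite oppr_ge0 /gipdf sqrrN => /(_ w0') => h.
  rewrite /stein_left PhiE mulrCA -{1}(mulr1 (gtail z)) -mulrDr mulrA.
  have h2 : 0 <= - w * gtail (- w) * gipdf w by apply: mulr_ge0 (ltW i0); rewrite mulr_ge0 ?oppr_ge0.
  rewrite /gipdf in h2 *.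
  set m := w * _ * _; have e : - w * gtail (- w) * (gpeak^-1 * expR (w ^+ 2 / 2)) = - m.
    by rewrite /m; ring.
  rewrite e in h h2; rewrite normrM (ger0_norm z0) ger0_norm; last by lra.
  have : gtail z * (1 + m) <= 1 * 1 by apply: ler_pM => //; lra.
  lra.
have t := gtail_nonincr wz; have h := gtail_gipdf_mills w0'.
rewrite ger0_norm; last by rewrite addr_ge0// mulr_ge0//; have /andP[] := stein_left_bound wz.
have : w * stein_left z w <= w * gtail w * gipdf w.
  rewrite -mulrA ler_wpM2l// /stein_left; apply: ler_pM => //.
    by rewrite PhiE mulr_ge0// ltW.
  by rewrite PhiE ler_piMl// ltW.
lra.
Qed.

Definition stein_f z w : R := if w < z then stein_left z w else stein_left (- z) (- w).

(** Off [z] this is the derivative of [stein_f z]; Stein's equation gives it a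
value at [z] too, where the derivative jumps. *)
Definition stein_g z w : R := w * stein_f z w + (w < z)%R%:R - Phi z.


Lemma stein_f_le z w : w <= z -> stein_f z w = stein_left z w.
Proof.
rewrite /stein_f le_eqVlt => /predU1P[->|->]//.
rewrite ltxx/= /stein_left /gipdf sqrrN !PhiE opprK.
by rewrite mulrCA.
Qed.

Lemma stein_f_ge z w : z <= w -> stein_f z w = stein_left (- z) (- w).
Proof. by move=> zw; rewrite /stein_f ltNge zw. Qed.

Lemma stein_g_lt z w : w < z -> stein_g z w = gtail z + w * stein_left z w.
Proof. by move=> wz; rewrite /stein_g /stein_f wz/= /gtail; ring. Qed.

Lemma stein_g_ge z w : z <= w ->
  stein_g z w = - (gtail (- z) + (- w) * stein_left (- z) (- w)).
Proof.
move=> zw; rewrite /stein_g /stein_f ltNge zw/= PhiE.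
by ring.
Qed.

Lemma stein_f_bound z w : `|stein_f z w| <= 6.
Proof.
have [wz|/ltW wz] := leP w z.
  by rewrite stein_f_le// ger0_norm; have /andP[] := stein_left_bound wz.
rewrite stein_f_ge//; rewrite -lerN2 in wz.
by rewrite ger0_norm; have /andP[] := stein_left_bound wz.
Qed.

Lemma stein_g_bound z w : `|stein_g z w| <= 2.
Proof.
have [wz|zw] := ltP w z.
  by rewrite stein_g_lt// stein_left_deriv_bound// ltW.
by rewrite stein_g_ge// normrN stein_left_deriv_bound// lerN2.
Qed.

Lemma stein_left_mvt z a b : a <= b -> b <= z ->
  exists2 c, a <= c <= b &
    stein_left z b - stein_left z a = (gtail z + c * stein_left z c) * (b - a).
Proof.
move=> ab bz.
have [||c cab fE] := @MVT_segment R (stein_left z)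
  (fun w => gtail z + w * stein_left z w) a b ab.
- by move=> x _; exact: is_derive_stein_left.
- apply: derivable_within_continuous => x _.
  by have [] := is_derive_stein_left z x.
- by exists c.
Qed.

Lemma stein_left_lip z a b : a <= z -> b <= z ->
  `|stein_left z b - stein_left z a| <= 2 * `|b - a|.
Proof.
wlog ab : a b / a <= b => [hw az bz|].
  have [ab|/ltW ab] := leP a b; first exact: hw.
  by rewrite distrC (distrC b) hw.
move=> az bz; have [c /andP[ac cb] ->] := stein_left_mvt ab bz.
by rewrite normrM ler_wpM2r// stein_left_deriv_bound// (le_trans cb).
Qed.

Lemma stein_left_deriv_lip z a b : a <= z -> b <= z ->
  `|(gtail z + b * stein_left z b) - (gtail z + a * stein_left z a)|
    <= (2 * `|a| + 6) * `|b - a|.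
Proof.
move=> az bz.
have -> : (gtail z + b * stein_left z b) - (gtail z + a * stein_left z a)
  = a * (stein_left z b - stein_left z a) + (b - a) * stein_left z b by ring.
apply: le_trans (ler_normD _ _) _.
rewrite [leRHS]mulrDl (normrM a) (normrM (b - a)); apply: lerD.
  by rewrite (mulrC 2) -mulrA ler_wpM2l// stein_left_lip.
rewrite (mulrC 6) ler_wpM2l//.
by rewrite ger0_norm; have /andP[] := stein_left_bound bz.
Qed.

Lemma stein_left_taylor z a b : a <= z -> b <= z ->
  `|stein_left z b - stein_left z a - (b - a) * (gtail z + a * stein_left z a)|
    <= (2 * `|a| + 6) * `|b - a| ^+ 2.
Proof.
move=> az bz.
have [c cab ->] : exists2 c, `|c - a| <= `|b - a| /\ c <= z &
    stein_left z b - stein_left z a = (gtail z + c * stein_left z c) * (b - a).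
  have [ab|/ltW ab] := leP a b.
    have [c /andP[ac cb] h] := stein_left_mvt ab bz; exists c => //.
    by rewrite !ger0_norm ?subr_ge0// lerD2r cb (le_trans cb).
  have [c /andP[ac cb] h] := stein_left_mvt ab az; exists c.
    by rewrite !ler0_norm ?subr_le0// lerN2 lerD2r ac (le_trans cb).
  by rewrite -opprB h; ring.
rewrite (mulrC _ (b - a)) -mulrBr normrM expr2 mulrA mulrC ler_wpM2r//.
apply: le_trans (stein_left_deriv_lip az cab.2) _.
by rewrite ler_wpM2l ?cab.1// addr_ge0// mulr_ge0.
Qed.

Lemma stein_f_lip z a b : `|stein_f z b - stein_f z a| <= 2 * `|b - a|.
Proof.
wlog ab : a b / a <= b => [hw|].
  have [ab|/ltW ab] := leP a b; first exact: hw.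
  by rewrite distrC (distrC b) hw.
have [bz|/ltW zb] := leP b z.
  by rewrite !stein_f_le ?(le_trans ab)// stein_left_lip ?(le_trans ab).
have [za|/ltW az] := leP z a.
  rewrite !stein_f_ge ?(le_trans za)//.
  apply: le_trans (stein_left_lip _ _) _; rewrite ?lerN2 ?(le_trans za)//.
  by rewrite -opprD normrN.
have -> : stein_f z b - stein_f z a =
    (stein_f z b - stein_f z z) + (stein_f z z - stein_f z a) by ring.
apply: le_trans (ler_normD _ _) _.
have h1 : `|stein_f z b - stein_f z z| <= 2 * `|b - z|.
  rewrite !stein_f_ge//; apply: le_trans (stein_left_lip _ _) _; rewrite ?lerN2//.
  by rewrite -opprD normrN.
have h2 : `|stein_f z z - stein_f z a| <= 2 * `|z - a|.
  by rewrite !stein_f_le// stein_left_lip.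
have e1 : `|b - z| = b - z by rewrite ger0_norm// subr_ge0.
have e2 : `|z - a| = z - a by rewrite ger0_norm// subr_ge0.
have e3 : `|b - a| = b - a by rewrite ger0_norm// subr_ge0.
move: h1 h2; rewrite e1 e2 e3; lra.
Qed.

(** As the derivative of the solution jumps at [z], the remainder of Taylor's
formula is quadratic only for steps that do not cross [z].  A step [s] that
does cross it forces [|w - z| <= |s|] and is controlled by the Lipschitz bounds;
the indicator records that case. *)
Lemma stein_taylor z w s : `|stein_f z (w + s) - stein_f z w - s * stein_g z w|
  <= `|s| * ((2 * `|w| + 6) * `|s| + 4 * (`|w - z| <= `|s|)%R%:R).
Proof.
have pos : 0 <= `|s| * ((2 * `|w| + 6) * `|s|).
  by rewrite !mulr_ge0// addr_ge0// mulr_ge0.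
case: (boolP (`|w - z| <= `|s|)) => [ws|/= ws]; rewrite ?mulr1 ?mulr0 ?addr0.
  have := stein_f_lip z w (w + s); have := stein_g_bound z w.
  have -> : w + s - w = s by ring.
  move=> g2 l2; apply: le_trans (ler_normB _ _) _; rewrite normrM.
  have : `|s| * `|stein_g z w| <= `|s| * 2 by rewrite ler_wpM2l.
  rewrite mulrDr; lra.
rewrite mulrCA -expr2.
have [wz|zw] := ltP w z.
  have wsz : w + s <= z.
    have := ler_norm s; have := ler_norm (z - w); rewrite distrC.
    rewrite ltr0_norm ?subr_lt0// in ws *.
    lra.
  rewrite stein_g_lt// !stein_f_le ?(ltW wz)//.
  by have := stein_left_taylor (ltW wz) wsz; rewrite (_ : w + s - w = s)//; ring.
have wsz : z <= w + s.
  have := ler_norm (- s); rewrite normrN.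
  rewrite ger0_norm ?subr_ge0// in ws *.
  lra.
rewrite stein_g_ge// !stein_f_ge//; rewrite -lerN2 in zw; rewrite -lerN2 in wsz.
have := stein_left_taylor zw wsz.
rewrite (_ : - (w + s) - - w = - s); last by ring.
by rewrite !normrN mulNr mulrN.
Qed.

Lemma stein_g_diff z w s : `|stein_g z (w + s) - stein_g z w|
  <= (2 * `|w| + 6) * `|s| + (`|w - z| <= `|s|)%R%:R.
Proof.
have -> : stein_g z (w + s) - stein_g z w =
   w * (stein_f z (w + s) - stein_f z w) + s * stein_f z (w + s) +
   ((w + s < z)%R%:R - (w < z)%R%:R) by rewrite /stein_g; ring.
apply: le_trans (ler_normD _ _) _; apply: lerD.
  apply: le_trans (ler_normD _ _) _.
  rewrite [leRHS]mulrDl (normrM w) (normrM s); apply: lerD.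
    rewrite (mulrC 2) -mulrA ler_wpM2l//.
    by apply: le_trans (stein_f_lip _ _ _) _; rewrite addrC addKr.
  by rewrite (mulrC 6) ler_wpM2l// stein_f_bound.
case: (boolP (`|w - z| <= `|s|)) => [_|].
  by case: (_ < _); case: (_ < _); rewrite ?subrr ?sub0r ?subr0 ?normrN ?normr0 ?normr1.
rewrite -ltNge => ws.
suff -> : (w + s < z) = (w < z) by rewrite subrr normr0.
have s1 := ler_norm s; have s2 := ler_norm (- s); rewrite normrN in s2.
have [wz|zw] := ltP w z.
  have e : `|w - z| = z - w by rewrite ltr0_norm ?subr_lt0// opprB.
  have h : w + s < z by move: ws; rewrite e; lra.
  by rewrite h.
have e : `|w - z| = w - z by rewrite ger0_norm ?subr_ge0.
have h : z <= w + s by move: ws; rewrite e; lra.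
by rewrite ltNge h.
Qed.

End gauss2.

(** * Finite product spaces *)

Section finprob.
Context {R : realType} {I V : finType}.
Implicit Types (p : I -> V -> R) (w : {ffun I -> V}) (F G : {ffun I -> V} -> R).

Definition is_prob p := (forall i v, 0 <= p i v) /\ (forall i, \sum_v p i v = 1).

Definition wgt p w : R := \prod_i p i (w i).
Definition Ex p F : R := \sum_w wgt p w * F w.
Definition E1 p i (g : V -> R) : R := \sum_v p i v * g v.
Definition upd w i v : {ffun I -> V} := [ffun j => if j == i then v else w j].
Definition sumv (x : I -> V -> R) w : R := \sum_i x i (w i).

Lemma wgt_ge0 p w : is_prob p -> 0 <= wgt p w.
Proof. by move=> [p0 _]; apply: prodr_ge0. Qed.

Lemma Ex_cst p c : is_prob p -> Ex p (fun=> c) = c.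
Proof.
move=> [_ p1]; rewrite /Ex -big_distrl/= -bigA_distr_bigA/=.
by rewrite big1 ?mul1r.
Qed.

Lemma ExD p F G : Ex p (fun w => F w + G w) = Ex p F + Ex p G.
Proof. by rewrite /Ex -big_split/=; apply: eq_bigr => w _; rewrite mulrDr. Qed.

Lemma ExZ p c F : Ex p (fun w => c * F w) = c * Ex p F.
Proof. by rewrite /Ex big_distrr/=; apply: eq_bigr => w _; rewrite mulrCA. Qed.

Lemma ExN p F : Ex p (fun w => - F w) = - Ex p F.
Proof. by rewrite /Ex -sumrN; apply: eq_bigr => w _; rewrite mulrN. Qed.

Lemma ExB p F G : Ex p (fun w => F w - G w) = Ex p F - Ex p G.
Proof. by rewrite -ExN -ExD. Qed.

Lemma Ex_sum p (J : finType) (F : J -> {ffun I -> V} -> R) :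
  Ex p (fun w => \sum_j F j w) = \sum_j Ex p (F j).
Proof.
rewrite /Ex exchange_big/=; apply: eq_bigr => w _.
by rewrite big_distrr.
Qed.

Lemma eq_Ex p F G : F =1 G -> Ex p F = Ex p G.
Proof. by move=> e; apply: eq_bigr => w _; rewrite e. Qed.

Lemma Ex_le p F G : is_prob p -> (forall w, F w <= G w) -> Ex p F <= Ex p G.
Proof. by move=> pp h; apply: ler_sum => w _; rewrite ler_wpM2l ?wgt_ge0. Qed.

Lemma Ex_ge0 p F : is_prob p -> (forall w, 0 <= F w) -> 0 <= Ex p F.
Proof. by move=> pp h; rewrite -(Ex_cst 0 pp) Ex_le. Qed.

Lemma Ex_norm p F : is_prob p -> `|Ex p F| <= Ex p (fun w => `|F w|).
Proof.
move=> pp; apply: le_trans (ler_norm_sum _ _ _) _; apply: ler_sum => w _.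
by rewrite normrM (ger0_norm (wgt_ge0 _ pp)).
Qed.

Lemma E1_cst p i c : is_prob p -> E1 p i (fun=> c) = c.
Proof. by move=> [_ p1]; rewrite /E1 -big_distrl/= p1 mul1r. Qed.

Lemma E1D p i f g : E1 p i (fun v => f v + g v) = E1 p i f + E1 p i g.
Proof. by rewrite /E1 -big_split/=; apply: eq_bigr => v _; rewrite mulrDr. Qed.

Lemma E1Z p i c f : E1 p i (fun v => c * f v) = c * E1 p i f.
Proof. by rewrite /E1 big_distrr/=; apply: eq_bigr => v _; rewrite mulrCA. Qed.

Lemma E1N p i f : E1 p i (fun v => - f v) = - E1 p i f.
Proof. by rewrite /E1 -sumrN; apply: eq_bigr => v _; rewrite mulrN. Qed.

Lemma E1B p i f g : E1 p i (fun v => f v - g v) = E1 p i f - E1 p i g.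
Proof. by rewrite -E1N -E1D. Qed.

Lemma eq_E1 p i f g : f =1 g -> E1 p i f = E1 p i g.
Proof. by move=> e; apply: eq_bigr => w _; rewrite e. Qed.

Lemma E1_le p i f g : is_prob p -> (forall v, f v <= g v) -> E1 p i f <= E1 p i g.
Proof. by move=> [p0 _] h; apply: ler_sum => w _; rewrite ler_wpM2l. Qed.

Lemma E1_ge0 p i f : is_prob p -> (forall v, 0 <= f v) -> 0 <= E1 p i f.
Proof. by move=> pp h; rewrite -(E1_cst i 0 pp) E1_le. Qed.

Lemma E1_norm p i f : is_prob p -> `|E1 p i f| <= E1 p i (fun v => `|f v|).
Proof.
move=> [p0 _]; apply: le_trans (ler_norm_sum _ _ _) _; apply: ler_sum => v _.
by rewrite normrM (ger0_norm (p0 _ _)).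
Qed.

Lemma updK w i v : upd (upd w i v) i (w i) = w.
Proof. by apply/ffunP => j; rewrite !ffunE; case: eqVneq => [->|]. Qed.

Lemma upd_same w i v : upd w i v i = v.
Proof. by rewrite ffunE eqxx. Qed.

Lemma wgt_upd p w i v : p i v * wgt p w = p i (w i) * wgt p (upd w i v).
Proof.
rewrite /wgt !(bigD1 i (P := predT))//= upd_same mulrCA; congr (_ * (_ * _)).
by apply: eq_bigr => j ji; rewrite ffunE (negbTE ji).
Qed.

(** Redrawing the coordinate [i] leaves a product law unchanged: the exchange
[(w, v) |-> (upd w i v, w i)] is a weight-preserving involution.  It
plays the role of conditioning on the other coordinates. *)
Lemma resample p i F : is_prob p ->
  Ex p F = Ex p (fun w => E1 p i (fun v => F (upd w i v))).
Proof.
move=> [p0 p1]; rewrite /Ex /E1.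
under [RHS]eq_bigr do rewrite big_distrr/=.
rewrite pair_big/=.
pose h (wv : {ffun I -> V} * V) := (upd wv.1 i wv.2, wv.1 i).
have hK : involutive h.
  by move=> [w v]; rewrite /h/= updK upd_same.
rewrite (reindex_inj (inv_inj hK))/= /h/=.
rewrite [RHS](eq_bigr (fun j => wgt p j.1 * (p i j.2 * F j.1))); last first.
  move=> [w v] _ /=.
  by rewrite updK mulrA (mulrC (wgt _ _)) -wgt_upd (mulrC (p i _)) -mulrA.
rewrite -(pair_big xpredT xpredT (fun w v => wgt p w * (p i v * F w)))/=.
apply: eq_bigr => w _; rewrite -big_distrr/= -big_distrl/= p1 mul1r//.
Qed.

Lemma Ex_resample p i (H : {ffun I -> V} -> V -> R) : is_prob p ->
  (forall w v, H (upd w i v) =1 H w) ->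
  Ex p (fun w => H w (w i)) = Ex p (fun w => E1 p i (H w)).
Proof.
move=> pp hH; rewrite (resample i _ pp); apply: eq_Ex => w; apply: eq_E1 => v.
by rewrite hH upd_same.
Qed.

Lemma Ex_coord p i g : is_prob p -> Ex p (fun w => g (w i)) = E1 p i g.
Proof.
by move=> pp; rewrite (Ex_resample (H := fun _ => g))// Ex_cst.
Qed.

Lemma sumv_upd x w i v : sumv x (upd w i v) - x i v = sumv x w - x i (w i).
Proof.
rewrite /sumv !(bigD1 i (P := predT))//= upd_same.
rewrite [x i v + _]addrC [x i (w i) + _]addrC !addrK.
by apply: eq_bigr => j ji; rewrite ffunE (negbTE ji).
Qed.

(** A coordinate is independent of the sum of the others. *)
Lemma Ex_loo p i x (H : R -> V -> R) : is_prob p ->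
  Ex p (fun w => H (sumv x w - x i (w i)) (w i)) =
  Ex p (fun w => E1 p i (H (sumv x w - x i (w i)))).
Proof.
move=> pp; rewrite (Ex_resample (H := fun w => H (sumv x w - x i (w i))))//.
by move=> w v u; rewrite upd_same sumv_upd.
Qed.

Lemma Ex_loo_mul p i x (h : V -> R) (F : R -> R) : is_prob p ->
  Ex p (fun w => h (w i) * F (sumv x w - x i (w i))) =
  E1 p i h * Ex p (fun w => F (sumv x w - x i (w i))).
Proof.
move=> pp; rewrite (Ex_loo _ _ (fun s v => h v * F s))// -ExZ.
apply: eq_Ex => w; rewrite mulrC -E1Z.
by apply: eq_E1 => v; rewrite mulrC.
Qed.

Lemma Ex_sumv_sqr p x : is_prob p -> (forall i, E1 p i (x i) = 0) ->
  Ex p (fun w => sumv x w ^+ 2) = \sum_i E1 p i (fun v => x i v ^+ 2).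
Proof.
move=> pp x0.
have -> : Ex p (fun w => sumv x w ^+ 2) =
    Ex p (fun w => \sum_i (x i (w i) ^+ 2 + x i (w i) * (sumv x w - x i (w i)))).
  apply: eq_Ex => w; rewrite expr2 {1}/sumv big_distrl/=.
  by apply: eq_bigr => i _; ring.
rewrite Ex_sum; apply: eq_bigr => i _.
rewrite ExD (Ex_loo_mul i x (x i) id)// x0 mul0r addr0.
exact: (Ex_coord i (fun v => x i v ^+ 2)).
Qed.

(** [|s| <= (s^2 + 1) / 2] and the second moment of the sum is at most 1. *)
Lemma Ex_sumv_norm p x : is_prob p -> (forall i, E1 p i (x i) = 0) ->
  \sum_i E1 p i (fun v => x i v ^+ 2) <= 1 -> Ex p (fun w => `|sumv x w|) <= 1.
Proof.
move=> pp x0 x2.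
have h : Ex p (fun w => `|sumv x w|) <= Ex p (fun w => 2^-1 * (sumv x w ^+ 2) + 2^-1).
  apply: Ex_le => // w; rewrite -real_normK ?num_real//.
  by have := sqr_ge0 (`|sumv x w| - 1); rewrite sqrrB1; lra.
apply: le_trans h _; rewrite ExD ExZ Ex_cst// Ex_sumv_sqr//; lra.
Qed.

(** Centering and rescaling by [d] reduce this to [Ex_sumv_norm]. *)
Lemma Ex_sumv_dev p x (d : R) : is_prob p -> 0 < d ->
  \sum_i E1 p i (fun v => x i v ^+ 2) <= d ^+ 2 ->
  Ex p (fun w => `|sumv x w - \sum_i E1 p i (x i)|) <= d.
Proof.
move=> pp d0 x2.
pose y i v := d^-1 * (x i v - E1 p i (x i)).
have ys w : sumv x w - \sum_i E1 p i (x i) = d * sumv y w.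
  rewrite /sumv /y -big_distrr/= mulrA mulfV ?gt_eqF// mul1r.
  by rewrite sumrB.
have y0 i : E1 p i (y i) = 0 by rewrite E1Z E1B E1_cst// subrr mulr0.
have y2 : \sum_i E1 p i (fun v => y i v ^+ 2) <= 1.
  have h : \sum_i E1 p i (fun v => y i v ^+ 2) <= (d ^+ 2)^-1 * \sum_i E1 p i (fun v => x i v ^+ 2).
    rewrite big_distrr/=; apply: ler_sum => i _.
    set m := E1 p i (x i).
    have -> : E1 p i (fun v => y i v ^+ 2) =
      E1 p i (fun v => (d ^+ 2)^-1 * (x i v ^+ 2 + ((- (2 * m)) * x i v + m ^+ 2))).
      by apply: eq_E1 => v; rewrite /y -/m exprMn exprVn; ring.
    rewrite E1Z ler_pM2l ?invr_gt0 ?exprn_gt0// !E1D E1Z E1_cst// -/m.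
    by have := sqr_ge0 m; lra.
  apply: le_trans h _; rewrite mulrC ler_pdivrMr ?exprn_gt0// mul1r//.
have -> : Ex p (fun w => `|sumv x w - \sum_i E1 p i (x i)|) =
    Ex p (fun w => d * `|sumv y w|).
  by apply: eq_Ex => w; rewrite ys normrM gtr0_norm.
by rewrite ExZ ger_pMr// Ex_sumv_norm.
Qed.

End finprob.

(** * Concentration and the Berry-Esseen bound *)

Section ramp.
Context {R : realType}.
Implicit Types (a b d u t : R).

(** The test function of the concentration inequality: it has slope 1 on an
interval of length [2 * L] around [c] and is bounded by [L]. *)
Definition ramp L c u : R := Num.max (- L) (Num.min L (u - c)).

Lemma ramp_bound (L c u : R) : 0 <= L -> `|ramp L c u| <= L.
Proof.
move=> L0; rewrite ler_norml /ramp.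
by case: (ltP L (u - c)) => h1; case: (ltP (- L) _) => h2; apply/andP; split; lra.
Qed.

Lemma ramp_nondecr (L c u t : R) : u <= t -> ramp L c u <= ramp L c t.
Proof.
move=> ut; rewrite /ramp.
have h : Num.min L (u - c) <= Num.min L (t - c).
  by case: (ltP L (u - c)) => h1; case: (ltP L (t - c)) => h2; lra.
by rewrite ge_max !le_max lexx h orbT.
Qed.

Lemma ramp_incr a b d u t : 0 < d -> a <= u <= b -> 0 <= t ->
  let r := ramp ((b - a) / 2 + d) ((a + b) / 2) in
  Num.min t d <= r u - r (u - t) /\ Num.min t d <= r (u + t) - r u.
Proof.
move=> d0 /andP[au ub] t0 /=; rewrite /ramp.
set L := (b - a) / 2 + d; set c := (a + b) / 2.
have e : Num.max (- L) (Num.min L (u - c)) = u - c.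
  by rewrite min_r ?max_r// /L /c; lra.
rewrite e {e}; have Le : L = (b - a) / 2 + d by [].
have ce : c = (a + b) / 2 by [].
split; case: (ltP t d) => td.
- by case: (ltP L _) => h; case: (ltP (- L) _) => h'; lra.
- by case: (ltP L _) => h; case: (ltP (- L) _) => h'; lra.
- by case: (ltP L _) => h; case: (ltP (- L) _) => h'; lra.
- by case: (ltP L _) => h; case: (ltP (- L) _) => h'; lra.
Qed.

(** The ramp has slope 1 up to a distance [d] outside of [[a, b]], so a step [t]
from a point of [[a, b]] changes it by at least [min |t| d]; from any other point
the change still has the sign of [t], by monotonicity. *)
Lemma ramp_incr_mul a b d u t : 0 < d ->
  let r := ramp ((b - a) / 2 + d) ((a + b) / 2) in
  (a <= u <= b)%R%:R * (`|t| * Num.min `|t| d) <= t * (r u - r (u - t)).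
Proof.
move=> d0; move: (@ramp_nondecr ((b - a) / 2 + d) ((a + b) / 2)).
move: (fun t => @ramp_incr a b d u t d0); cbv zeta.
set r := ramp _ _ => ramp_incr ramp_nondecr.
have [t0|/ltW t0] := leP 0 t.
  have rm : 0 <= r u - r (u - t) by rewrite subr_ge0 ramp_nondecr//; lra.
  case: (boolP (a <= u <= b)) => [uab|_]; last by rewrite mul0r mulr_ge0.
  by rewrite mul1r ger0_norm// ler_wpM2l//; have [] := ramp_incr _ uab t0.
have rm : 0 <= r (u - t) - r u by rewrite subr_ge0 ramp_nondecr//; lra.
rewrite -[leRHS]mulrNN opprB.
case: (boolP (a <= u <= b)) => [uab|_]; last by rewrite mul0r mulr_ge0// oppr_ge0.
rewrite mul1r ler0_norm// ler_wpM2l ?oppr_ge0//.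
have := ramp_incr (- t) uab; rewrite oppr_ge0 => /(_ t0) [_].
by [].
Qed.

End ramp.

Section BE.
Context {R : realType} {I V : finType}.
Implicit Types (p : I -> V -> R) (x : I -> V -> R) (w : {ffun I -> V}).

Lemma mul_min_ge (t d : R) : 0 < d -> 0 <= t -> t ^+ 2 - t ^+ 3 / (4 * d) <= t * Num.min t d.
Proof.
move=> d0 t0; have d4 : 0 < 4 * d by lra.
have [td|td] := ltP t d.
  by rewrite -expr2 gerBl divr_ge0 ?exprn_ge0//; lra.
rewrite lerBlDr -(ler_pM2l d4).
have -> : 4 * d * (t * d + t ^+ 3 / (4 * d)) = 4 * d * (t * d) + t ^+ 3.
  by field; rewrite gt_eqF.
rewrite -subr_ge0 (_ : _ - _ = t * (t - 2 * d) ^+ 2); last by ring.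
by rewrite mulr_ge0 ?sqr_ge0.
Qed.

(** Let W be the sum and r the ramp with [L = (b - a) / 2 + d].  As E|W| <= 1,
E[W r(W)] <= L.  Since x_i is centered and independent of W - x_i,
E[W r(W)] is the sum of the E[x_i (r(W) - r(W - x_i))], which dominates the
expectation of 1(a <= W <= b) * sum_i |x_i| min(|x_i|, d).  The random factor
has a mean [mu >= 1/2] and a mean deviation at most [d], whence
P(a <= W <= b) / 2 <= L + d. *)
Lemma concentration p x (d a b : R) : is_prob p ->
  (forall i, E1 p i (x i) = 0) ->
  3 / 4 <= \sum_i E1 p i (fun v => x i v ^+ 2) <= 1 ->
  0 < d -> \sum_i E1 p i (fun v => `|x i v| ^+ 3) <= d -> a <= b ->
  Ex p (fun w => (a <= sumv x w <= b)%R%:R) <= (b - a) + 4 * d.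
Proof.
move=> pp x0 /andP[x2l x2u] d0 x3 ab.
set L := (b - a) / 2 + d; set c := (a + b) / 2.
pose h i v := `|x i v| * Num.min `|x i v| d.
pose mu := \sum_i E1 p i (h i).
have mu2 : 2^-1 <= mu.
  have e : \sum_i E1 p i (fun v => x i v ^+ 2) -
     (4 * d)^-1 * \sum_i E1 p i (fun v => `|x i v| ^+ 3) <= mu.
    rewrite big_distrr/= -sumrB; apply: ler_sum => i _.
    rewrite -E1Z -E1B; apply: E1_le => // v.
    have := mul_min_ge d0 (normr_ge0 (x i v)).
    by rewrite real_normK ?num_real// mulrC.
  have : (4 * d)^-1 * \sum_i E1 p i (fun v => `|x i v| ^+ 3) <= 4^-1.
    rewrite mulrC ler_pdivrMr; last by lra.
    by rewrite mulrA mulVf// mul1r.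
  lra.
have dev : Ex p (fun w => `|sumv h w - mu|) <= d.
  apply: Ex_sumv_dev => //.
  have : \sum_i E1 p i (fun v => h i v ^+ 2) <= d ^+ 2 * \sum_i E1 p i (fun v => x i v ^+ 2).
    rewrite big_distrr/=; apply: ler_sum => i _; rewrite -E1Z; apply: E1_le => // v.
    rewrite /h exprMn real_normK ?num_real// mulrC ler_wpM2r ?sqr_ge0//.
    rewrite ler_pXn2r// ?nnegrE ?(ltW d0)//; first by rewrite ge_min lexx orbT.
    by rewrite le_min normr_ge0 ltW.
  by move=> hh; apply: le_trans hh _; rewrite ger_pMr// exprn_gt0.
have lb : Ex p (fun w => (a <= sumv x w <= b)%R%:R * sumv h w) <= L.
  have s1 : Ex p (fun w => (a <= sumv x w <= b)%R%:R * sumv h w) <=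
     Ex p (fun w => sumv x w * ramp L c (sumv x w)).
    have -> : Ex p (fun w => sumv x w * ramp L c (sumv x w)) =
       \sum_i Ex p (fun w => x i (w i) * (ramp L c (sumv x w) - ramp L c (sumv x w - x i (w i)))).
      transitivity (Ex p (fun w => \sum_i x i (w i) * ramp L c (sumv x w))).
        by apply: eq_Ex => w; rewrite -big_distrl.
      rewrite Ex_sum; apply: eq_bigr => i _.
      under [RHS]eq_Ex do rewrite mulrBr.
      by rewrite ExB (Ex_loo_mul i x (x i))// x0 mul0r subr0.
    rewrite -Ex_sum; apply: Ex_le => // w.
    rewrite {1}/sumv big_distrr/=; apply: ler_sum => i _.
    exact: ramp_incr_mul.
  apply: le_trans s1 _.
  have L0 : 0 <= L by rewrite /L; lra.
  have s2 : Ex p (fun w => sumv x w * ramp L c (sumv x w)) <= Ex p (fun w => L * `|sumv x w|).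
    apply: Ex_le => // w; apply: le_trans (ler_norm _) _.
    by rewrite normrM mulrC ler_wpM2r// ramp_bound.
  apply: le_trans s2 _; rewrite ExZ.
  by rewrite ler_piMr// Ex_sumv_norm.
have : 2^-1 * Ex p (fun w => (a <= sumv x w <= b)%R%:R) <= L + d.
  apply: le_trans (lerD lb dev); rewrite -ExZ -ExD; apply: Ex_le => // w.
  case: (a <= _ <= b); rewrite ?mulr0 ?mul0r ?add0r// mulr1 mul1r.
  have := ler_norm (mu - sumv h w); rewrite distrC; lra.
rewrite /L; lra.
Qed.


(** A third absolute moment at most 3/64 forces each variance to be at most 1/4, so that
the sum without its [i]-th term still has a variance at least 3/4 and
[concentration] applies to it. *)
Lemma loo_moments p x i (d : R) : is_prob p ->
  (forall i, E1 p i (x i) = 0) ->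
  \sum_i E1 p i (fun v => x i v ^+ 2) = 1 ->
  0 < d <= 3 / 64 -> \sum_i E1 p i (fun v => `|x i v| ^+ 3) <= d ->
  Ex p (fun w => `|sumv x w - x i (w i)|) <= 1 /\
  forall z t, 0 <= t ->
    Ex p (fun w => (`|sumv x w - x i (w i) - z| <= t)%R%:R) <= 2 * t + 4 * d.
Proof.
move=> pp x0 x2 /andP[d0 d1] x3.
(* Replacing the i-th term by 0 keeps the index set of the sum. *)
pose y j v := if j == i then 0 else x j v.
have ys w : sumv x w - x i (w i) = sumv y w.
  rewrite /sumv !(bigD1 i (P := predT))//= /y eqxx add0r [x i _ + _]addrC addrK.
  by apply: eq_bigr => j ji; rewrite (negbTE ji).
have y0 j : E1 p j (y j) = 0.
  rewrite /y; case: eqP => _; last exact: x0.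
  exact: E1_cst.
have s0 j : 0 <= E1 p j (fun v => x j v ^+ 2) by apply: E1_ge0 => // v; exact: sqr_ge0.
have b0 j : 0 <= E1 p j (fun v => `|x j v| ^+ 3) by apply: E1_ge0 => // v; exact: exprn_ge0.
have y2 : \sum_j E1 p j (fun v => y j v ^+ 2) = 1 - E1 p i (fun v => x i v ^+ 2).
  rewrite -x2 !(bigD1 i (P := predT))//= /y eqxx expr0n/= E1_cst// add0r [X in _ = X - _]addrC addrK.
  by apply: eq_bigr => j ji; apply: eq_E1 => v; rewrite (negbTE ji).
have y3 : \sum_j E1 p j (fun v => `|y j v| ^+ 3) <= d.
  apply: le_trans x3; apply: ler_sum => j _; apply: E1_le => // v.
  by rewrite /y; case: eqP => _//; rewrite normr0 expr0n/= exprn_ge0.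
have bi : E1 p i (fun v => `|x i v| ^+ 3) <= d.
  apply: le_trans x3; rewrite (bigD1 i)//= lerDl.
  by apply: sumr_ge0 => j _; exact: b0.
have si : E1 p i (fun v => x i v ^+ 2) <= 4^-1.
  have h : E1 p i (fun v => x i v ^+ 2) <= E1 p i (fun v => 16^-1 + 4 * `|x i v| ^+ 3).
    apply: E1_le => // v; rewrite -real_normK ?num_real//.
    have := normr_ge0 (x i v); set t := `|_| => t0.
    have [t4|/ltW t4] := leP t 4^-1.
      have : t ^+ 2 <= 4^-1 ^+ 2 by rewrite ler_pXn2r// nnegrE; lra.
      by have := exprn_ge0 3 t0; rewrite expr2 => ? ?; lra.
    have : 0 <= t ^+ 2 * (4 * t - 1) by rewrite mulr_ge0 ?sqr_ge0//; lra.
    by rewrite (exprS t 2); lra.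
  by apply: le_trans h _; rewrite E1D E1Z E1_cst//; lra.
split.
  have -> : Ex p (fun w => `|sumv x w - x i (w i)|) = Ex p (fun w => `|sumv y w|).
    by apply: eq_Ex => w; rewrite ys.
  apply: Ex_sumv_norm => //; rewrite y2; have := s0 i; lra.
move=> z t t0.
have -> : Ex p (fun w => (`|sumv x w - x i (w i) - z| <= t)%R%:R) =
   Ex p (fun w => (z - t <= sumv y w <= z + t)%R%:R).
  by apply: eq_Ex => w; rewrite ys ler_distl.
have := @concentration p y d (z - t) (z + t) pp y0; rewrite y2.
have -> : 3 / 4 <= 1 - E1 p i (fun v => x i v ^+ 2) <= 1.
  by have := s0 i; move=> ?; apply/andP; split; lra.
move=> /(_ isT d0 y3); rewrite (_ : z - t <= z + t); last by lra.
move=> /(_ isT); lra.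
Qed.

(** For two independent copies a, b of |g|, a^2 b + a b^2 <= a^3 + b^3. *)
Lemma E1_sqr_norm_le p i (g : V -> R) : is_prob p ->
  E1 p i (fun v => g v ^+ 2) * E1 p i (fun v => `|g v|) <=
  E1 p i (fun v => `|g v| ^+ 3).
Proof.
move=> pp.
set s2 := E1 p i (fun v => g v ^+ 2); set a1 := E1 p i (fun v => `|g v|).
set b3 := E1 p i (fun v => `|g v| ^+ 3).
have : E1 p i (fun u => E1 p i (fun v => g u ^+ 2 * `|g v| + `|g u| * g v ^+ 2)) <=
  E1 p i (fun u => E1 p i (fun v => `|g u| ^+ 3 + `|g v| ^+ 3)).
  apply: E1_le => // u; apply: E1_le => // v.
  rewrite -(real_normK (num_real (g u))) -(real_normK (num_real (g v))).
  have := normr_ge0 (g u); have := normr_ge0 (g v).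
  move: `|g u| `|g v| => a b b0 a0.
  rewrite -subr_ge0 (_ : _ - _ = (a + b) * (a - b) ^+ 2); last by ring.
  by rewrite mulr_ge0 ?sqr_ge0// addr_ge0.
have -> : E1 p i (fun u => E1 p i (fun v => g u ^+ 2 * `|g v| + `|g u| * g v ^+ 2)) =
   s2 * a1 + a1 * s2.
  transitivity (E1 p i (fun u => a1 * g u ^+ 2 + s2 * `|g u|)).
    by apply: eq_E1 => u; rewrite E1D !E1Z mulrC (mulrC `|g u|).
  by rewrite E1D !E1Z -/s2 -/a1; ring.
have -> : E1 p i (fun u => E1 p i (fun v => `|g u| ^+ 3 + `|g v| ^+ 3)) = b3 + b3.
  transitivity (E1 p i (fun u => `|g u| ^+ 3 + b3)).
    by apply: eq_E1 => u; rewrite E1D E1_cst.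
  by rewrite E1D E1_cst.
lra.
Qed.

(** Stein's method.  With f, g as in [stein_f], [stein_g], W the sum and
W_i = W - x_i, the quantity to bound is E[g(W) - W f(W)].  Independence and
E x_i = 0 turn E[x_i f(W)] into s2_i E[g(W_i)] plus the expectation of
x_i (f(W) - f(W_i) - x_i g(W_i)), where s2_i is the variance of x_i.  There remain
these Taylor remainders and the differences g(W) - g(W_i); both contain the
indicator of |W_i - z| <= |x_i|, whose conditional expectation given x_i is
bounded by [concentration] applied to W_i. *)
Theorem berry_esseen p x (d z : R) : is_prob p ->
  (forall i, E1 p i (x i) = 0) ->
  \sum_i E1 p i (fun v => x i v ^+ 2) = 1 ->
  0 < d -> \sum_i E1 p i (fun v => `|x i v| ^+ 3) <= d ->
  `|Ex p (fun w => (sumv x w < z)%R%:R) - Phi z| <= 46 * d.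
Proof.
move=> pp x0 x2 d0 x3.
(* For d > 3/64 the bound exceeds 1, since 46 * 3 > 64. *)
have [d1|d1] := leP d (3 / 64); last first.
  have h1 : Ex p (fun w => (sumv x w < z)%R%:R) <= 1.
    rewrite -[leRHS](Ex_cst 1 pp); apply: Ex_le => // w.
    by case: (_ < _).
  have h0 : 0 <= Ex p (fun w => (sumv x w < z)%R%:R).
    by apply: Ex_ge0 => // w; case: (_ < _).
  have /andP[] := gtail_bounds z; rewrite /gtail => p1 p0.
  by rewrite ler_norml; apply/andP; split; lra.
have d01 : 0 < d <= 3 / 64 by rewrite d0.
pose W := sumv x; pose Wi i w := sumv x w - x i (w i).
have [f [g [gE gdiff gtaylor]]] : exists f g : R -> R,
  [/\ (forall u, g u = u * f u + (u < z)%R%:R - Phi z),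
   (forall u s, `|g (u + s) - g u|
      <= (2 * `|u| + 6) * `|s| + (`|u - z| <= `|s|)%R%:R) &
   forall u s, `|f (u + s) - f u - s * g u|
      <= `|s| * ((2 * `|u| + 6) * `|s| + 4 * (`|u - z| <= `|s|)%R%:R)].
  exists (stein_f z), (stein_g z).
  by split=> // u s; [exact: stein_g_diff|exact: stein_taylor].
pose s2 i := E1 p i (fun v => x i v ^+ 2).
pose a1 i := E1 p i (fun v => `|x i v|).
pose b3 i := E1 p i (fun v => `|x i v| ^+ 3).
have s20 i : 0 <= s2 i by apply: E1_ge0 => // v; exact: sqr_ge0.
have weight i (h : V -> R) : (forall v, 0 <= h v) ->
    Ex p (fun w => h (w i) * (2 * `|Wi i w| + 6)) <= 8 * E1 p i h.
  move=> h0; rewrite (Ex_loo_mul i x h (fun s => 2 * `|s| + 6))// mulrC.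
  rewrite ler_wpM2r ?E1_ge0// ExD ExZ Ex_cst//.
  by have [+ _] := loo_moments i pp x0 x2 d01 x3; rewrite /Wi; lra.
have near i (h : V -> R) : (forall v, 0 <= h v) ->
    Ex p (fun w => h (w i) * (`|Wi i w - z| <= `|x i (w i)|)%R%:R) <=
    E1 p i (fun v => h v * (2 * `|x i v| + 4 * d)).
  move=> h0; rewrite (Ex_loo i x (fun s v => h v * (`|s - z| <= `|x i v|)%R%:R))//.
  rewrite (Ex_sum p (J := V)
    (fun v w => p i v * (h v * (`|sumv x w - x i (w i) - z| <= `|x i v|)%R%:R))).
  apply: ler_sum => v _; rewrite !ExZ.
  rewrite !ler_wpM2l//; first by case: pp.
  have [_ c] := loo_moments i pp x0 x2 d01 x3.
  exact: c.
have decomp : Ex p (fun w => (sumv x w < z)%R%:R) - Phi z =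
   \sum_i (s2 i * Ex p (fun w => g (W w) - g (Wi i w)) -
     Ex p (fun w => x i (w i) * (f (W w) - f (Wi i w) - x i (w i) * g (Wi i w)))).
  have e1 i : Ex p (fun w => x i (w i) * (f (W w) - f (Wi i w) - x i (w i) * g (Wi i w))) =
      Ex p (fun w => x i (w i) * f (W w)) - s2 i * Ex p (fun w => g (Wi i w)).
    transitivity (Ex p (fun w => (x i (w i) * f (W w) - x i (w i) * f (Wi i w))
         - x i (w i) ^+ 2 * g (Wi i w))).
      by apply: eq_Ex => w; ring.
    rewrite !ExB (Ex_loo_mul i x (x i))// x0 mul0r subr0.
    by rewrite (Ex_loo_mul i x (fun v => x i v ^+ 2)).
  under eq_bigr do rewrite e1 ExB.
  transitivity (\sum_i (s2 i * Ex p (fun w => g (W w)) - Ex p (fun w => x i (w i) * f (W w)))); last first.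
    by apply: eq_bigr => i _; ring.
  rewrite sumrB -big_distrl/= x2 mul1r -Ex_sum -ExB -[X in _ - X](Ex_cst _ pp) -ExB.
  apply: eq_Ex => w; rewrite -big_distrl/= gE -/(sumv x w) /W.
  ring.
rewrite decomp; apply: le_trans (ler_norm_sum _ _ _) _.
have tb i : `|s2 i * Ex p (fun w => g (W w) - g (Wi i w)) -
     Ex p (fun w => x i (w i) * (f (W w) - f (Wi i w) - x i (w i) * g (Wi i w)))|
     <= 26 * b3 i + 20 * d * s2 i.
  have WE w : W w = Wi i w + x i (w i) by rewrite /Wi subrK.
  have b1 : `|Ex p (fun w => g (W w) - g (Wi i w))| <= 10 * a1 i + 4 * d.
    apply: le_trans (Ex_norm _ pp) _.
    apply: (@le_trans _ _ (Ex p (fun w => `|x i (w i)| * (2 * `|Wi i w| + 6)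
        + 1 * (`|Wi i w - z| <= `|x i (w i)|)%R%:R))).
      by apply: Ex_le => // w; rewrite WE mulrC mul1r; exact: gdiff.
    rewrite ExD; have := weight i (fun v => `|x i v|) (fun v => normr_ge0 _).
    have := near i (fun=> 1) (fun=> ler01).
    have -> : E1 p i (fun v => 1 * (2 * `|x i v| + 4 * d)) = 2 * a1 i + 4 * d.
      transitivity (E1 p i (fun v => 2 * `|x i v| + 4 * d)).
        by apply: eq_E1 => v; rewrite mul1r.
      by rewrite E1D E1_cst// E1Z.
    by rewrite -/(a1 i); lra.
  have b2 : `|Ex p (fun w => x i (w i) * (f (W w) - f (Wi i w) - x i (w i) * g (Wi i w)))|
      <= 16 * b3 i + 16 * d * s2 i.
    apply: le_trans (Ex_norm _ pp) _.
    apply: (@le_trans _ _ (Ex p (fun w => `|x i (w i)| ^+ 3 * (2 * `|Wi i w| + 6)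
        + 4 * (x i (w i) ^+ 2 * (`|Wi i w - z| <= `|x i (w i)|)%R%:R)))).
      apply: Ex_le => // w; rewrite WE normrM.
      have := gtaylor (Wi i w) (x i (w i)).
      rewrite -(real_normK (num_real (x i (w i)))) => h.
      apply: le_trans (ler_wpM2l (normr_ge0 _) h) _.
      by rewrite le_eqVlt; apply/orP; left; apply/eqP; ring.
    rewrite ExD ExZ; have := weight i (fun v => `|x i v| ^+ 3) (fun v => exprn_ge0 _ (normr_ge0 _)).
    have := near i (fun v => x i v ^+ 2) (fun v => sqr_ge0 _).
    have -> : E1 p i (fun v => x i v ^+ 2 * (2 * `|x i v| + 4 * d)) = 2 * b3 i + 4 * d * s2 i.
      rewrite /b3 /s2 -!E1Z -E1D; apply: eq_E1 => v.
      by rewrite -(real_normK (num_real (x i v))); ring.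
    by rewrite -/(b3 i); lra.
  apply: le_trans (ler_normB _ _) _.
  rewrite normrM (ger0_norm (s20 i)).
  have h : s2 i * `|Ex p (fun w => g (W w) - g (Wi i w))| <= s2 i * (10 * a1 i + 4 * d).
    by rewrite ler_wpM2l.
  have := E1_sqr_norm_le i (x i) pp; rewrite -/(s2 i) -/(a1 i) -/(b3 i).
  have e : s2 i * (10 * a1 i + 4 * d) = 10 * (s2 i * a1 i) + 4 * d * s2 i by ring.
  rewrite e in h.
  lra.
apply: le_trans (ler_sum _ (fun i _ => tb i)) _.
rewrite big_split/= -!big_distrr/= x2 mulr1.
rewrite -/b3 in x3.
have -> : \sum_i b3 i = \sum_i E1 p i (fun v => `|x i v| ^+ 3) by [].
lra.
Qed.

End BE.

(** * Exponentially weighted tails and tilting *)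

Section abel.
Context {R : realType}.
Implicit Types (H Q Psi Gam : R -> R) (t u D : R).

(** When [Q] is the upper tail function of a law, this says that [H u] is the
integral of [v |-> expR (- (t * v))] over [[u, +oo[], up to a constant.  Stating
it through increments covers the discrete and the Gaussian law at once. *)
Definition tilted_pair t H Q := forall u v, u <= v ->
  expR (- (t * v)) * (Q u - Q v) <= H u - H v <= expR (- (t * u)) * (Q u - Q v).

Definition vanishes H := forall e, 0 < e -> exists u, forall v, u <= v -> `|H v| <= e.

Lemma sum_telescope (f : nat -> R) N : \sum_(j < N) (f j - f j.+1) = f 0%N - f N.
Proof.
elim: N => [|N IH]; first by rewrite big_ord0 subrr.
by rewrite big_ord_recr/= IH; ring.
Qed.

(** Summation by parts, the weights [e] being nonincreasing and [D] bounded. *)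
Lemma abel_bound (e D : nat -> R) (d : R) N : 0 <= d ->
  (forall j, 0 <= e j.+1 <= e j) -> (forall j, `|D j| <= d) ->
  `|\sum_(j < N) e j * (D j - D j.+1)| <= 2 * d * e 0%N.
Proof.
move=> d0 e_dec Dd.
have e_ge0 j : 0 <= e j by have /andP[h1 h2] := e_dec j; exact: le_trans h1 h2.
have key : `|\sum_(j < N) e j * (D j - D j.+1) + e N * D N| <= d * (2 * e 0%N - e N).
  elim: N => [|N IH].
    rewrite big_ord0 add0r normrM ger0_norm//.
    rewrite (_ : 2 * e 0%N - e 0%N = e 0%N); last by ring.
    by rewrite mulrC ler_wpM2r.
  rewrite big_ord_recr/=.
  set S := \sum_(_ < _) _ in IH *.
  have -> : S + e N * (D N - D N.+1) + e N.+1 * D N.+1 =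
    (S + e N * D N) - (e N - e N.+1) * D N.+1 by ring.
  apply: le_trans (ler_normB _ _) _.
  have /andP[h1 h2] := e_dec N.
  rewrite normrM (ger0_norm (x := e N - _)) ?subr_ge0//.
  have : (e N - e N.+1) * `|D N.+1| <= (e N - e N.+1) * d.
    by rewrite ler_wpM2l ?subr_ge0.
  have -> : d * (2 * e 0%N - e N.+1) = d * (2 * e 0%N - e N) + (e N - e N.+1) * d by ring.
  lra.
have h : `|e N * D N| <= e N * d by rewrite normrM ger0_norm// ler_wpM2l.
set S := \sum_(_ < _) _ in key *.
have -> : S = (S + e N * D N) - e N * D N by ring.
apply: le_trans (ler_normB _ _) _.
have -> : 2 * d * e 0%N = d * (2 * e 0%N - e N) + e N * d by ring.
exact: lerD.
Qed.

Lemma tilted_pair_grid t H Q u (d : R) N : 0 <= d -> tilted_pair t H Q ->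
  expR (- (t * d)) * (\sum_(j < N) expR (- (t * (u + j%:R * d))) *
      (Q (u + j%:R * d) - Q (u + j.+1%:R * d)))
  <= H u - H (u + N%:R * d)
  <= \sum_(j < N) expR (- (t * (u + j%:R * d))) *
      (Q (u + j%:R * d) - Q (u + j.+1%:R * d)).
Proof.
move=> d0 tp; elim: N => [|N /andP[IH1 IH2]].
  by rewrite !big_ord0 mulr0 mul0r addr0 subrr lexx.
rewrite !big_ord_recr/= mulrDr.
have uv : u + N%:R * d <= u + N.+1%:R * d by rewrite lerD2l ler_wpM2r// ler_nat.
have /andP[h1 h2] := tp _ _ uv.
have e : expR (- (t * (u + N.+1%:R * d))) = expR (- (t * d)) * expR (- (t * (u + N%:R * d))).
  by rewrite -expRD; congr expR; rewrite -natr1; ring.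
rewrite e -mulrA in h1.
by apply/andP; split; lra.
Qed.

(** On a fine grid [u + j d] up to a remote point, [H u] and [Psi u] are
approximated by Riemann sums whose difference is bounded by summation by
parts ([abel_bound]). *)
Lemma abel_compare t H Q Psi Gam (D u : R) : 0 <= t ->
  tilted_pair t H Q -> tilted_pair t Psi Gam ->
  vanishes H -> vanishes Psi ->
  (forall v, 0 <= Q v <= 1) -> (forall v, 0 <= Gam v <= 1) ->
  (forall v, `|Q v - Gam v| <= D) ->
  (forall v v', v <= v' -> Q v' <= Q v) -> (forall v v', v <= v' -> Gam v' <= Gam v) ->
  `|H u - Psi u| <= 2 * D * expR (- (t * u)).
Proof.
move=> t0 tH tP vH vP Q01 G01 QG Qd Gd; apply/ler_addgt0Pr => e e0.
pose E0 := expR (- (t * u)); have E00 : 0 < E0 by exact: expR_gt0.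
(* This mesh makes the error of each Riemann sum at most t d E0 <= e / 3. *)
pose d := e / (3 * (E0 * (1 + t))).
have d0 : 0 < d by rewrite divr_gt0// !mulr_gt0//; lra.
have td : t * d * E0 <= e / 3.
  rewrite /d; apply: (@le_trans _ _ ((1 + t) * (e / (3 * (E0 * (1 + t)))) * E0)).
    by rewrite !ler_wpM2r ?ltW//; lra.
  by rewrite le_eqVlt; apply/orP; left; apply/eqP; field; rewrite !gt_eqF//; lra.
have e3 : 0 < e / 3 by lra.
have [uH hH] := vH _ e3; have [uP hP] := vP _ e3.
pose N := Num.bound `|(Num.max uH uP - u) / d|.
have : Num.max uH uP <= u + N%:R * d.
  have : (Num.max uH uP - u) / d < N%:R.
    by apply: le_lt_trans (ler_norm _) _; exact: archi_boundP (normr_ge0 _).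
  rewrite ltr_pdivrMr//; lra.
rewrite ge_max => /andP[/hH HN /hP PN].
have D0 : 0 <= D by apply: le_trans (QG 0); exact: normr_ge0.
have /andP[H1 H2] := tilted_pair_grid u N (ltW d0) tH.
have /andP[P1 P2] := tilted_pair_grid u N (ltW d0) tP.
set A := \sum_(j < N) _ in H1 H2; set B := \sum_(j < N) _ in P1 P2.
have uj j : u + j%:R * d <= u + j.+1%:R * d.
  by rewrite lerD2l ler_wpM2r ?ler_nat// ltW.
have AB : `|A - B| <= 2 * D * E0.
  rewrite /A /B -sumrB.
  pose ej j := expR (- (t * (u + j%:R * d))).
  pose Dj j := Q (u + j%:R * d) - Gam (u + j%:R * d).
  have -> : E0 = ej 0%N by rewrite /ej mul0r addr0.
  rewrite (eq_bigr (fun j : 'I_N => ej j * (Dj j - Dj j.+1))); last first.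
    by move=> j _; rewrite /Dj /ej; ring.
  apply: abel_bound => // k; last exact: QG.
  by rewrite expR_ge0 ler_expR lerN2 ler_wpM2l.
have cap (F : R -> R) : (forall v, 0 <= F v <= 1) -> (forall v v', v <= v' -> F v' <= F v) ->
  0 <= \sum_(j < N) expR (- (t * (u + j%:R * d))) *
      (F (u + j%:R * d) - F (u + j.+1%:R * d)) <= E0.
  move=> F01 Fd; apply/andP; split.
    by apply: sumr_ge0 => j _; rewrite mulr_ge0 ?expR_ge0// subr_ge0 Fd.
  apply: (@le_trans _ _ (\sum_(j < N) E0 * (F (u + j%:R * d) - F (u + j.+1%:R * d)))).
    apply: ler_sum => j _; rewrite ler_wpM2r ?subr_ge0 ?Fd// ler_expR lerN2 ler_wpM2l//.
    by rewrite lerDl mulr_ge0// ltW.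
  rewrite -big_distrr/= ler_piMr ?(ltW E00)//.
  have -> : \sum_(j < N) (F (u + j%:R * d) - F (u + j.+1%:R * d)) = F u - F (u + N%:R * d).
    rewrite (sum_telescope (fun j : nat => F (u + j%:R * d))).
    by rewrite mul0r addr0.
  have /andP[_ a1] := F01 u; have /andP[b0 _] := F01 (u + N%:R * d).
  by move: b0; set Fb := F (_ + _) => b0; lra.
have /andP[A0 A1] := cap _ Q01 Qd; have /andP[B0 B1] := cap _ G01 Gd.
rewrite -/A in A0 A1; rewrite -/B in B0 B1.
have r1 : 1 - t * d <= expR (- (t * d)) by have := expR_ge1Dx (- (t * d)); lra.
have r2 : expR (- (t * d)) <= 1 by rewrite expR_le1 oppr_le0 mulr_ge0// ltW.
have rho (X : R) : 0 <= X <= E0 -> X - e / 3 <= expR (- (t * d)) * X.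
  move=> /andP[X0 X1].
  have : (1 - t * d) * X <= expR (- (t * d)) * X by rewrite ler_wpM2r.
  have : t * d * X <= t * d * E0 by rewrite ler_wpM2l// mulr_ge0// ltW.
  lra.
have := rho A; rewrite A0 A1 => /(_ isT) rA.
have := rho B; rewrite B0 B1 => /(_ isT) rB.
move: HN PN AB; rewrite !ler_norml -/E0 => /andP[? ?] /andP[? ?] /andP[? ?].
by apply/andP; split; lra.
Qed.

End abel.

Section gauss_pair.
Context {R : realType}.
Implicit Types (t m s u : R).

Lemma le0_is_derive_le (f df : R -> R) (a b : R) : a <= b ->
  (forall x, a <= x <= b -> is_derive x 1 f (df x)) ->
  (forall x, a <= x <= b -> df x <= 0) -> f b <= f a.
Proof.
move=> ab fD df0; rewrite -lerN2.
apply: (@ge0_is_derive_le _ (\- f) (fun x => - df x) a b ab).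
  by move=> x /fD dfx; apply: is_derive_eq.
by move=> x /df0; rewrite oppr_ge0.
Qed.

(** The integral of [v |-> expR (- (t * v))] over [[u, +oo[] against the normal
law of mean [m] and standard deviation [s], after completing the square. *)
Definition gauss_tilt t m s u : R :=
  expR (- (t * m) + t ^+ 2 * s ^+ 2 / 2) * gtail ((u - m) / s + t * s).

Lemma is_derive_gtail_affine (s c u : R) :
  is_derive u 1 (fun v => gtail (v * s + c)) (- gpdf (u * s + c) * s).
Proof.
have d1 := is_derive_gtail (u * s + c).
have d2 : is_derive u 1 (fun v => v * s + c) s.
  by apply: is_derive_eq; rewrite scaler0 /GRing.scale /= !addr0 add0r mulr1.
exact: (@is_derive1_comp _ gtail (fun v => v * s + c) u _ _ d1 d2).
Qed.

Lemma gpdf_tilt t m s u : s != 0 ->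
  expR (- (t * m) + t ^+ 2 * s ^+ 2 / 2) * gpdf ((u - m) / s + t * s) =
  expR (- (t * u)) * gpdf ((u - m) / s).
Proof.
move=> s0; rewrite !gpdfE !(mulrCA _ gpeak) -!expRD; congr (_ * expR _).
by field.
Qed.

(** For a constant c, [c * gtail ((u - m) / s) - gauss_tilt t m s u] has
a derivative of the sign of [expR (- (t * u)) - c] ([gpdf_tilt]); take for c the
weight at either end. *)
Lemma gauss_tilted_pair t m s : 0 <= t -> 0 < s ->
  tilted_pair t (gauss_tilt t m s) (fun u => gtail ((u - m) / s)).
Proof.
move=> t0 s0 u v uv.
have sn0 : s != 0 by rewrite gt_eqF.
have sv0 : 0 <= s^-1 by rewrite invr_ge0 ltW.
have dG (c x : R) : is_derive x 1 (fun u => c * gtail ((u - m) / s) - gauss_tilt t m s u)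
   ((expR (- (t * x)) - c) * (gpdf ((x - m) / s) / s)).
  have d1 := is_derive_gtail_affine (s^-1) (- m / s) x.
  have d2 := is_derive_gtail_affine (s^-1) (- m / s + t * s) x.
  rewrite (_ : (fun u => _) = (fun u => c * gtail (u * s^-1 + - m / s) -
    expR (- (t * m) + t ^+ 2 * s ^+ 2 / 2) * gtail (u * s^-1 + (- m / s + t * s)))); last first.
    by apply/funext => y; rewrite /gauss_tilt mulrBl mulNr addrA.
  apply: is_derive_eq; rewrite /GRing.scale /=.
  have := gpdf_tilt t m x sn0; rewrite mulrBl mulNr addrA => h.
  rewrite !mulNr in h *.
  move: h; set E := expR (_ + _); set g1 := gpdf (_ + _ + _); set g0 := gpdf _ => h.
  have -> : c * - (g0 / s) - E * - (g1 / s) = (E * g1) / s - c * (g0 / s) by ring.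
  by rewrite h; ring.
have up : expR (- (t * u)) * gtail ((v - m) / s) - gauss_tilt t m s v <=
    expR (- (t * u)) * gtail ((u - m) / s) - gauss_tilt t m s u.
  set c := expR (- (t * u)).
  apply: (@le0_is_derive_le (fun u => c * gtail ((u - m) / s) - gauss_tilt t m s u)
    (fun x => (expR (- (t * x)) - c) * (gpdf ((x - m) / s) / s)) u v uv).
  move=> x /andP[ux _]; rewrite mulr_le0_ge0 ?divr_ge0 ?(ltW s0) ?(ltW (gpdf_gt0 _))//.
  by rewrite subr_le0 ler_expR lerN2 ler_wpM2l.
have dn : expR (- (t * v)) * gtail ((u - m) / s) - gauss_tilt t m s u <=
    expR (- (t * v)) * gtail ((v - m) / s) - gauss_tilt t m s v.
  set c := expR (- (t * v)).
  apply: (@ge0_is_derive_le _ (fun u => c * gtail ((u - m) / s) - gauss_tilt t m s u)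
    (fun x => (expR (- (t * x)) - c) * (gpdf ((x - m) / s) / s)) u v uv).
  move=> x /andP[_ xv]; rewrite mulr_ge0 ?divr_ge0 ?(ltW s0) ?(ltW (gpdf_gt0 _))//.
  by rewrite subr_ge0 ler_expR lerN2 ler_wpM2l.
move: up dn; set gu := gtail _; set gv := gtail _; set hu := gauss_tilt _ _ _ u.
set hv := gauss_tilt _ _ _ v => up dn.
by apply/andP; split; lra.
Qed.

Lemma gauss_tilt_vanishes t m s : 0 < s -> vanishes (gauss_tilt t m s).
Proof.
move=> s0 e e0; rewrite /gauss_tilt; set K := expR _.
have K0 : 0 < K by exact: expR_gt0.
have eK : 0 < e / K by rewrite divr_gt0.
have [z _ ze] := gtail_small 0 eK.
exists ((z - t * s) * s + m) => v zv.
have zv' : z <= (v - m) / s + t * s by rewrite -lerBlDr ler_pdivlMr// lerBrDr.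
have /andP[T0 _] := gtail_bounds ((v - m) / s + t * s).
rewrite ger0_norm ?mulr_ge0 ?(ltW K0)//.
have := gtail_nonincr zv'.
rewrite ltr_pdivlMr// in ze => h.
apply: le_trans (ltW ze); rewrite mulrC.
exact: ler_wpM2r (ltW K0) _ _ h.
Qed.

End gauss_pair.

Section tilt.
Context {R : realType} {I V : finType}.
Implicit Types (p q : I -> V -> R) (y : I -> V -> R) (w : {ffun I -> V}).

Definition mgf p y t i : R := E1 p i (fun v => expR (t * y i v)).
(** The conjugate (Cramer, Esscher) law. *)
Definition tilt p y t i v : R := p i v * expR (t * y i v) / mgf p y t i.

Lemma mgf_gt0 p y t i : is_prob p -> 0 < mgf p y t i.
Proof.
move=> [p0 p1].
have : exists v, 0 < p i v.
  apply/existsP; apply: contraT; rewrite negb_exists => /forallP h.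
  have := p1 i; rewrite big1 => [/eqP|v _]; first by rewrite eq_sym oner_eq0.
  by apply/eqP; rewrite eq_le p0 andbT leNgt.
move=> [v v0]; rewrite /mgf /E1 (bigD1 v)//= ltr_wpDr ?mulr_gt0 ?expR_gt0//.
by apply: sumr_ge0 => u _; rewrite mulr_ge0 ?expR_ge0.
Qed.

Lemma tilt_prob p y t : is_prob p -> is_prob (tilt p y t).
Proof.
move=> pp; have M0 i := mgf_gt0 y t i pp; have [p0 _] := pp; split.
  by move=> i v; rewrite /tilt divr_ge0 ?mulr_ge0 ?expR_ge0// ltW.
by move=> i; rewrite /tilt -big_distrl/= mulfV// gt_eqF//; exact: M0.
Qed.

Lemma E1_tilt p y t i g :
  E1 (tilt p y t) i g = E1 p i (fun v => g v * expR (t * y i v)) / mgf p y t i.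
Proof. by rewrite /E1 /tilt big_distrl/=; apply: eq_bigr => v _; ring. Qed.

Lemma wgt_tilt p y t w : is_prob p ->
  wgt p w = (\prod_i mgf p y t i) * (wgt (tilt p y t) w * expR (- (t * sumv y w))).
Proof.
move=> pp.
rewrite /sumv big_distrr/= -sumrN expR_sum /wgt -!big_split/=; apply: eq_bigr => i _.
rewrite /tilt expRN; field.
by rewrite expR_eq0 gt_eqF// mgf_gt0.
Qed.

Lemma Ex_tilt p y t (F : {ffun I -> V} -> R) : is_prob p ->
  Ex p F = (\prod_i mgf p y t i) * Ex (tilt p y t) (fun w => expR (- (t * sumv y w)) * F w).
Proof.
move=> pp; rewrite /Ex big_distrr/=; apply: eq_bigr => w _.
by rewrite (wgt_tilt y t w pp) !mulrA.
Qed.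

(** [abel_compare] applied to the discrete law [q] and to the normal law of mean [m]
and standard deviation [s], which are [D]-close in Kolmogorov distance. *)
Lemma tilted_tail q y (t m s D u0 : R) : is_prob q -> 0 <= t -> 0 < s ->
  (forall u, `|Ex q (fun w => (sumv y w < u)%R%:R) - Phi ((u - m) / s)| <= D) ->
  `|Ex q (fun w => expR (- (t * sumv y w)) * (u0 <= sumv y w)%R%:R)
      - gauss_tilt t m s u0| <= 2 * D * expR (- (t * u0)).
Proof.
move=> qp t0 s0 hD.
pose H u := Ex q (fun w => expR (- (t * sumv y w)) * (u <= sumv y w)%R%:R).
pose Q u := Ex q (fun w => (u <= sumv y w)%R%:R).
have sv0 : 0 <= s^-1 by rewrite invr_ge0 ltW.
apply: (@abel_compare _ t H Q (gauss_tilt t m s) (fun u => gtail ((u - m) / s))) => //.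
- move=> u v uv; rewrite /H /Q -!ExB -!ExZ; apply/andP; split; apply: Ex_le => // w.
    have [vS|Sv] := leP v (sumv y w).
      by rewrite (le_trans uv vS) !subrr mulr0.
    have [uS|Su] := leP u (sumv y w); last by rewrite !mulr0 !subr0 mulr0.
    by rewrite mulr0 !subr0 !mulr1 ler_expR lerN2 ler_wpM2l// ltW.
  have [vS|Sv] := leP v (sumv y w).
    by rewrite (le_trans uv vS) !subrr mulr0.
  have [uS|Su] := leP u (sumv y w); last by rewrite !mulr0 !subr0 mulr0.
  by rewrite mulr0 !subr0 !mulr1 ler_expR lerN2 ler_wpM2l.
- exact: gauss_tilted_pair.
- move=> e e0; exists (1 + \sum_w `|sumv y w|) => v hv.
  rewrite (_ : H v = 0) ?normr0 ?ltW// /H -[RHS](Ex_cst 0 qp); apply: eq_Ex => w.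
  suff -> : (v <= sumv y w) = false by rewrite mulr0.
  apply/negbTE; rewrite -ltNge; apply: lt_le_trans hv.
  rewrite (bigD1 w)//=.
  have : 0 <= \sum_(i | i != w) `|sumv y i| by apply: sumr_ge0.
  have := ler_norm (sumv y w); lra.
- exact: gauss_tilt_vanishes.
- move=> v; rewrite /Q; apply/andP; split.
    by apply: Ex_ge0 => // w; exact: ler0n.
  by rewrite -[leRHS](Ex_cst 1 qp); apply: Ex_le => // w; case: (v <= _).
- by move=> v; exact: gtail_bounds.
- move=> v; rewrite /Q.
  have -> : Ex q (fun w => (v <= sumv y w)%R%:R) = 1 - Ex q (fun w => (sumv y w < v)%R%:R).
    transitivity (Ex q (fun w => 1 - (sumv y w < v)%R%:R)); last by rewrite ExB Ex_cst.
    apply: eq_Ex => w.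
    by rewrite ltNge; case: (v <= _); rewrite ?subr0 ?subrr.
  rewrite /gtail (_ : _ - _ - _ = Phi ((v - m) / s) -
    Ex q (fun w => (sumv y w < v)%R%:R)); last by ring.
  by rewrite distrC.
- move=> v v' vv; apply: Ex_le => // w.
  by have [h|] := leP v' (sumv y w); rewrite ?(le_trans vv h)//; case: (v <= _).
- by move=> v v' vv; apply: gtail_nonincr; rewrite ler_wpM2r// lerB.
Qed.

End tilt.

(** * Remainders of the exponential *)

Section exp_taylor.
Context {R : realType}.
Implicit Types (t K : R).

Lemma mvt_bound0 (f df : R -> R) t K : (forall u : R, is_derive u 1 f (df u)) ->
  f 0 = 0 -> (forall u, `|u| <= `|t| -> `|df u| <= K) -> `|f t| <= K * `|t|.
Proof.
move=> fD f0 dfK.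
have cf : continuous f.
  move=> u; apply/differentiable_continuous/derivable1_diffP.
  by have [] := fD u.
have [t0|t0] := leP 0 t.
  have [c] := @MVT_segment R f df 0 t t0 (fun u _ => fD u) (continuous_subspaceT cf).
  rewrite in_itv/= => /andP[c0 ct]; rewrite f0 !subr0 => ->.
  by rewrite normrM ler_wpM2r// dfK// !ger0_norm.
have [c] := @MVT_segment R f df t 0 (ltW t0) (fun u _ => fD u) (continuous_subspaceT cf).
rewrite in_itv/= => /andP[tc c0]; rewrite f0 !sub0r => fE.
rewrite -normrN fE normrM normrN ler_wpM2r// dfK// !ler0_norm ?lerN2//.
exact: ltW.
Qed.

Lemma expR_taylor1 t : `|expR t - 1| <= `|t| * expR `|t|.
Proof.
rewrite mulrC; apply: (@mvt_bound0 (fun u => expR u - 1) expR).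
- by move=> u; apply: is_derive_eq; rewrite subr0.
- by rewrite expR0 subrr.
- move=> u ut; rewrite ger0_norm ?expR_ge0// ler_expR.
  by apply: le_trans ut; exact: ler_norm.
Qed.

Lemma expR_taylor2 t : `|expR t - 1 - t| <= `|t| ^+ 2 * expR `|t|.
Proof.
rewrite exprS expr1 -mulrA mulrC.
apply: (@mvt_bound0 (fun u => expR u - 1 - u) (fun u => expR u - 1)).
- by move=> u; apply: is_derive_eq; rewrite subr0.
- by rewrite expR0 !subrr.
- move=> u ut; apply: le_trans (expR_taylor1 u) _.
  by apply: ler_pM; rewrite ?expR_ge0// ler_expR.
Qed.

Lemma expR_taylor3 t : `|expR t - 1 - t - t ^+ 2 / 2| <= `|t| ^+ 3 * expR `|t|.
Proof.
rewrite [`|t| ^+ 3]exprS -mulrA [leRHS]mulrC.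
apply: (@mvt_bound0 (fun u => expR u - 1 - u - u ^+ 2 / 2) (fun u => expR u - 1 - u)).
- move=> u; apply: is_derive_eq; rewrite !subr0 scaler0 /GRing.scale /=.
  by field.
- by rewrite expR0 expr0n/= mul0r !subrr.
- move=> u ut; apply: le_trans (expR_taylor2 u) _.
  by apply: ler_pM; rewrite ?expR_ge0 ?exprn_ge0// ?ler_expR// ler_pXn2r// nnegrE.
Qed.

(** The lower half of log (1 + t) = t + O(t^2), in a form that multiplies well
over a product of moment generating functions. *)
Lemma expR_ge_sub_sqr t : `|t| <= 2^-1 -> expR (t - 2 * t ^+ 2) <= 1 + t.
Proof.
rewrite ler_norml => /andP[t1 t2].
have t20 := sqr_ge0 t.
have h := expR_ge1Dx (- (t - 2 * t ^+ 2)).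
have pos : 0 < 1 + - (t - 2 * t ^+ 2) by lra.
rewrite -[leLHS]invrK -expRN.
apply: (@le_trans _ _ (1 + - (t - 2 * t ^+ 2))^-1).
  by rewrite lef_pV2 ?posrE ?expR_gt0.
rewrite -[leLHS]mul1r ler_pdivrMr//.
rewrite -subr_ge0 (_ : _ - _ = t ^+ 2 * (1 + 2 * t)); last by ring.
rewrite mulr_ge0//; lra.
Qed.

End exp_taylor.

(** * Expansion of the tilted moments *)

(** Between [x] and [x'] the hazard rate is at most [2 + x + r]. *)
Lemma gtail_perturb (R : realType) (x x' r : R) : 0 <= x -> `|x' - x| <= r ->
  gtail x' <= gtail x * expR ((2 + x + r) * r) /\
  gtail x <= gtail x' * expR ((2 + x + r) * r).
Proof.
move=> x0 xr; have r0 : 0 <= r := le_trans (normr_ge0 _) xr.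
have /andP[T0 _] := gtail_bounds x; have /andP[T0' _] := gtail_bounds x'.
move: xr; rewrite ler_norml => /andP[xr1 xr2].
have E1 : 1 <= expR ((2 + x + r) * r).
  by rewrite -[leLHS]expR0 ler_expR mulr_ge0//; lra.
have [xx|/ltW xx] := leP x x'.
  split.
    by apply: le_trans (gtail_nonincr xx) _; rewrite ler_peMr.
  apply: le_trans (gtail_ratio (L := 2 + x + r) xx _ _) _; try lra.
  by rewrite ler_wpM2l// ler_expR ler_wpM2l; lra.
split.
  apply: le_trans (gtail_ratio (L := 2 + x + r) xx _ _) _; try lra.
  by rewrite ler_wpM2l// ler_expR ler_wpM2l; lra.
by apply: le_trans (gtail_nonincr xx) _; rewrite ler_peMr.
Qed.

(** The summands [y i] have the moments that a sum of [n] terms normalised to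
variance 1 should have, with [e] in the role of 1 / sqrt n.  The small parameter
is [h = (1 + x) * e], while [E = (1 + x ^+ 3) * e] is the relative error aimed at.
[M i] is the moment generating function of [y i] at [x]; [N1 i] and [N2 i] are the
unnormalised first and second moments after tilting. *)
Section core.
Context {R : realType} {I V : finType}.
Context (p : I -> V -> R) (y : I -> V -> R) (x e A : R).
Context (pp : is_prob p).
Let n : R := #|I|%:R.
Context (ne : n * e ^+ 2 = 1).
Context (hmom3 : forall i, E1 p i (fun v => `|y i v| ^+ 3 * expR (x * `|y i v|)) <= A * e ^+ 3).
Context (hmom2 : forall i, E1 p i (fun v => y i v ^+ 2) <= A * e ^+ 2).
Context (hmean : forall i, `|E1 p i (y i)| <= A * e ^+ 3).
Context (hvar : `|\sum_i E1 p i (fun v => y i v ^+ 2) - 1| <= A * e ^+ 2).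
Context (hx3 : x ^+ 3 * e <= A).
Let h : R := (1 + x) * e.
Context (hsmall : 100 * A ^+ 2 * h <= 1).

Let mu i := E1 p i (y i).
Let v2 i := E1 p i (fun v => y i v ^+ 2).
Let M i := mgf p y x i.
Let tau i := M i - 1.
Let q := tilt p y x.
Let N1 i := E1 p i (fun v => y i v * expR (x * y i v)).
Let N2 i := E1 p i (fun v => y i v ^+ 2 * expR (x * y i v)).

Context (hA1 : 1 <= A) (hx0 : 0 <= x) (he0 : 0 < e).

Lemma tilt_parameters : [/\ 1 <= A, 0 <= x & 0 < e]. Proof. by []. Qed.

(** With [c] a multiple of [e ^+ 2], the factor [n] is absorbed by
[n * e ^+ 2 = 1]. *)
Lemma sum_le_card (f : I -> R) c : (forall i, `|f i| <= c) -> `|\sum_i f i| <= n * c.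
Proof.
move=> fc; apply: le_trans (ler_norm_sum _ _ _) _.
apply: (@le_trans _ _ (\sum_(i : I) c)); first exact: ler_sum.
by rewrite sumr_const mulr_natl.
Qed.

Lemma le_A_sqr : A <= A ^+ 2.
Proof. have [A1 x0 e0] := tilt_parameters; rewrite expr2 ler_peMr//; lra. Qed.

Lemma h_bounds : [/\ e <= h, x * e <= h, 0 < h & h <= 100^-1 /\ A * h <= 100^-1].
Proof.
have [A1 x0 e0] := tilt_parameters.
have A2 := le_A_sqr.
have eh : e <= h by rewrite /h ler_peMl//; lra.
have h0 : 0 < h by exact: lt_le_trans eh.
have h1 : A * h <= A ^+ 2 * h by rewrite ler_wpM2r// ltW.
have h2 : h <= A * h by rewrite ler_peMl// ltW.
split=> //; first by rewrite /h; lra.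
have : A ^+ 2 * h <= 100^-1 by move: hsmall; lra.
by split; lra.
Qed.

Lemma mgf_taylor i : `|tau i - x * mu i - x ^+ 2 / 2 * v2 i| <= x ^+ 3 * (A * e ^+ 3).
Proof.
have [A1 x0 e0] := tilt_parameters.
have -> : tau i - x * mu i - x ^+ 2 / 2 * v2 i =
    E1 p i (fun v => expR (x * y i v) - 1 - x * y i v - (x * y i v) ^+ 2 / 2).
  rewrite !E1B E1_cst// E1Z; congr (_ - _); rewrite /v2 -E1Z.
  by apply: eq_E1 => v; ring.
apply: le_trans (E1_norm _ _ pp) _.
apply: (@le_trans _ _ (E1 p i (fun v => x ^+ 3 * (`|y i v| ^+ 3 * expR (x * `|y i v|))))).
  apply: E1_le => // v; apply: le_trans (expR_taylor3 _) _.
  by rewrite normrM (ger0_norm x0) exprMn [leRHS]mulrA lexx.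
by rewrite E1Z ler_wpM2l// exprn_ge0.
Qed.

Lemma tilted_numer1_taylor i : `|N1 i - mu i - x * v2 i| <= x ^+ 2 * (A * e ^+ 3).
Proof.
have [A1 x0 e0] := tilt_parameters.
have -> : N1 i - mu i - x * v2 i =
    E1 p i (fun v => y i v * (expR (x * y i v) - 1 - x * y i v)).
  rewrite /v2 -E1Z -!E1B; apply: eq_E1 => v; ring.
apply: le_trans (E1_norm _ _ pp) _.
apply: (@le_trans _ _ (E1 p i (fun v => x ^+ 2 * (`|y i v| ^+ 3 * expR (x * `|y i v|))))).
  apply: E1_le => // v; rewrite (normrM (y i v)).
  apply: le_trans (ler_wpM2l (normr_ge0 _) (expR_taylor2 _)) _.
  rewrite normrM (ger0_norm x0) exprMn.
  by rewrite le_eqVlt; apply/orP; left; apply/eqP; ring.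
by rewrite E1Z ler_wpM2l// exprn_ge0.
Qed.

Lemma tilted_numer2_taylor i : `|N2 i - v2 i| <= x * (A * e ^+ 3).
Proof.
have [A1 x0 e0] := tilt_parameters.
have -> : N2 i - v2 i =
    E1 p i (fun v => y i v ^+ 2 * (expR (x * y i v) - 1)).
  rewrite /v2 -!E1B; apply: eq_E1 => v; ring.
apply: le_trans (E1_norm _ _ pp) _.
apply: (@le_trans _ _ (E1 p i (fun v => x * (`|y i v| ^+ 3 * expR (x * `|y i v|))))).
  apply: E1_le => // v; rewrite (normrM (y i v ^+ 2)).
  apply: le_trans (ler_wpM2l (normr_ge0 _) (expR_taylor1 _)) _.
  rewrite (normrM x) (ger0_norm x0) normrX.
  by rewrite le_eqVlt; apply/orP; left; apply/eqP; ring.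
by rewrite E1Z ler_wpM2l.
Qed.

Lemma v2_bounds i : 0 <= v2 i <= A * e ^+ 2.
Proof.
by rewrite hmom2 andbT; apply: E1_ge0 => // v; exact: sqr_ge0. Qed.

Lemma mgf_sub1_bound i : `|tau i| <= 3 * A * h ^+ 2.
Proof.
have [A1 x0 e0] := tilt_parameters.
have [eh xeh h0 [h1 _]] := h_bounds.
have xe0 : 0 <= x * e by rewrite mulr_ge0// ltW.
have e2 : (x * e) ^+ 2 <= h ^+ 2 by rewrite ler_pXn2r// nnegrE// ltW.
have hh : h ^+ 3 <= h ^+ 2 by rewrite exprS ler_piMl ?sqr_ge0//; lra.
have e3 : (x * e) ^+ 3 <= h ^+ 2.
  by apply: (le_trans _ hh); rewrite ler_pXn2r// nnegrE// ltW.
have e4 : x * e ^+ 3 <= h ^+ 2.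
  apply: (le_trans _ hh); rewrite (_ : x * e ^+ 3 = (x * e) * e ^+ 2); last by ring.
  rewrite (exprS h 2); apply: ler_pM => //; first exact: sqr_ge0.
  by rewrite ler_pXn2r// nnegrE ltW.
have /andP[v0 vb] := v2_bounds i.
have A0 : 0 <= A by lra.
have b1 : `|x * mu i| <= A * h ^+ 2.
  rewrite normrM (ger0_norm x0); apply: le_trans (ler_wpM2l x0 (hmean i)) _.
  by rewrite mulrCA ler_wpM2l.
have b2 : `|x ^+ 2 / 2 * v2 i| <= A * h ^+ 2.
  rewrite ger0_norm ?mulr_ge0 ?invr_ge0 ?exprn_ge0//.
  have : x ^+ 2 / 2 * v2 i <= x ^+ 2 / 2 * (A * e ^+ 2).
    by rewrite ler_wpM2l// divr_ge0// sqr_ge0.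
  have : A * (x * e) ^+ 2 <= A * h ^+ 2 by rewrite ler_wpM2l.
  have : 0 <= A * (x * e) ^+ 2 by rewrite mulr_ge0// sqr_ge0.
  have -> : x ^+ 2 / 2 * (A * e ^+ 2) = (A * (x * e) ^+ 2) / 2 by ring.
  lra.
have b3 : x ^+ 3 * (A * e ^+ 3) <= A * h ^+ 2.
  by rewrite mulrCA -exprMn ler_wpM2l.
have := mgf_taylor i; set u := _ - _ - _ => ub.
have -> : tau i = u + x * mu i + x ^+ 2 / 2 * v2 i by rewrite /u; ring.
apply: le_trans (ler_normD _ _) _.
have := ler_normD u (x * mu i); lra.
Qed.

Lemma mgf_bounds i : [/\ 0 < M i, `|tau i| <= 2^-1 & (M i)^-1 <= 2].
Proof.
have [A1 x0 e0] := tilt_parameters.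
have [eh xeh h0 [h1 Ah]] := h_bounds.
have t2 : `|tau i| <= 2^-1.
  apply: le_trans (mgf_sub1_bound i) _.
  have : A * h * h <= 100^-1 * 1 by apply: ler_pM => //; rewrite ?mulr_ge0 ?(ltW h0)//; lra.
  by rewrite expr2 mulrA -(mulrA 3) -mulrA; lra.
have M0 := mgf_gt0 y x i pp; split=> //.
rewrite -[leRHS]invrK lef_pV2 ?posrE ?invr_gt0//.
by move: t2; rewrite ler_norml /tau => /andP[]; lra.
Qed.


Let mi i := E1 q i (y i).

Lemma tilted_meanE i : mi i = N1 i / M i. Proof. exact: E1_tilt. Qed.

Lemma tilted_numer1_bound i : `|N1 i| <= 3 * (A * (e * h)).
Proof.
have [A1 x0 e0] := tilt_parameters.
have [eh xeh h0 [h1 Ah]] := h_bounds.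
have xe0 : 0 <= x * e by rewrite mulr_ge0// ltW.
have A0 : 0 <= A by lra.
have /andP[v0 vb] := v2_bounds i.
have b1 : `|mu i| <= A * (e * h).
  apply: le_trans (hmean i) _; rewrite ler_wpM2l// exprS ler_wpM2l ?(ltW e0)//.
  by rewrite expr2; apply: (le_trans _ eh); rewrite ler_piMl ?(ltW e0)//; lra.
have b2 : `|x * v2 i| <= A * (e * h).
  rewrite ger0_norm ?mulr_ge0//; apply: le_trans (ler_wpM2l x0 vb) _.
  rewrite (_ : x * (A * e ^+ 2) = A * (e * (x * e))); last by ring.
  by rewrite ler_wpM2l// ler_wpM2l// ltW.
have b3 : x ^+ 2 * (A * e ^+ 3) <= A * (e * h).
  rewrite (_ : x ^+ 2 * (A * e ^+ 3) = A * (e * ((x * e) * (x * e)))); last by ring.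
  rewrite ler_wpM2l// ler_wpM2l ?(ltW e0)//.
  by apply: (le_trans _ xeh); rewrite ler_piMl//; lra.
have := tilted_numer1_taylor i; set u := _ - _ - _ => ub.
have -> : N1 i = u + mu i + x * v2 i by rewrite /u; ring.
apply: le_trans (ler_normD _ _) _.
have := ler_normD u (mu i); lra.
Qed.

(** As [M i = 1 + O(h ^+ 2)], normalising costs a relative error [O(h ^+ 2)]. *)
Lemma div_mgf_dev (N c : R) i : `|N| <= c -> `|N / M i - N| <= 6 * (A * h ^+ 2) * c.
Proof.
have [A1 x0 e0] := tilt_parameters.
move=> Nc; have [M0 _ Mi] := mgf_bounds i.
have -> : N / M i - N = - (N * tau i * (M i)^-1).
  by rewrite /tau; field; rewrite gt_eqF.
rewrite normrN (normrM (N * _)) (normrM N) (ger0_norm (x := (M i)^-1)) ?invr_ge0 ?(ltW M0)//.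
have -> : 6 * (A * h ^+ 2) * c = c * (3 * A * h ^+ 2) * 2 by ring.
apply: ler_pM => //; rewrite ?mulr_ge0// ?invr_ge0 ?(ltW M0)//.
by apply: ler_pM => //; exact: mgf_sub1_bound.
Qed.

Lemma tilted_mean_bound i : `|mi i| <= 6 * (A * (e * h)).
Proof.
have [A1 x0 e0] := tilt_parameters.
have [M0 _ Mi] := mgf_bounds i.
rewrite tilted_meanE normrM (ger0_norm (x := (M i)^-1)) ?invr_ge0 ?(ltW M0)//.
have -> : 6 * (A * (e * h)) = 3 * (A * (e * h)) * 2 by ring.
apply: ler_pM => //; rewrite ?invr_ge0 ?(ltW M0)//; exact: tilted_numer1_bound.
Qed.

Lemma tilted_numer2_bounds i : 0 <= N2 i <= 2 * (A * e ^+ 2).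
Proof.
have [A1 x0 e0] := tilt_parameters.
have [eh xeh h0 [h1 Ah]] := h_bounds.
apply/andP; split.
  by apply: E1_ge0 => // v; rewrite mulr_ge0 ?sqr_ge0 ?expR_ge0.
have /andP[v0 vb] := v2_bounds i.
have := tilted_numer2_taylor i; rewrite ler_norml => /andP[_].
have : x * (A * e ^+ 3) <= A * e ^+ 2.
  rewrite (_ : x * (A * e ^+ 3) = (x * e) * (A * e ^+ 2)); last by ring.
  rewrite ler_piMl ?mulr_ge0 ?sqr_ge0//; lra.
lra.
Qed.

Let E := (1 + x ^+ 3) * e.
Let m := \sum_i mi i.
Let s2 := \sum_i E1 q i (fun v => (y i v - mi i) ^+ 2).

Lemma cube_le_error : (1 + x) ^+ 3 * e <= 4 * E.
Proof.
have [A1 x0 e0] := tilt_parameters.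
rewrite /E mulrA ler_wpM2r ?(ltW e0)// -subr_ge0.
rewrite (_ : _ - _ = 3 * ((1 + x) * (1 - x) ^+ 2)); last by ring.
by rewrite mulr_ge0// mulr_ge0 ?sqr_ge0//; lra.
Qed.

(** To first order the tilted mean of [y i] is [mu i + x * v2 i]; the [mu i] are
negligible and the [v2 i] sum to about 1. *)
Lemma tilted_mean_dev : `|m - x| <= 2 * (A ^+ 2 * ((1 + x) ^+ 2 * e)).
Proof.
have [A1 x0 e0] := tilt_parameters; have A2 := le_A_sqr.
have [eh xeh h0 [h1 Ah]] := h_bounds.
have b1 : `|\sum_i (mi i - N1 i)| <= A ^+ 2 * ((1 + x) ^+ 2 * e).
  apply: le_trans (sum_le_card (c := 18 * A ^+ 2 * (e * h ^+ 3)) _) _.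
    move=> i; rewrite tilted_meanE; apply: le_trans (div_mgf_dev _ (tilted_numer1_bound i)) _.
    by rewrite le_eqVlt; apply/orP; left; apply/eqP; ring.
  rewrite (_ : n * (18 * A ^+ 2 * (e * h ^+ 3)) =
     (n * e ^+ 2) * (18 * h) * (A ^+ 2 * ((1 + x) ^+ 2 * e))); last by rewrite /h; ring.
  rewrite ne mul1r ler_piMl ?mulr_ge0 ?sqr_ge0 ?(ltW e0)//; lra.
have b2 : `|\sum_i (N1 i - mu i - x * v2 i)| <= A * (x ^+ 2 * e).
  apply: le_trans (sum_le_card tilted_numer1_taylor) _.
  rewrite (_ : n * _ = (n * e ^+ 2) * (A * (x ^+ 2 * e))); last by ring.
    by rewrite ne mul1r.
have b3 : `|\sum_i mu i| <= A * e.
  apply: le_trans (sum_le_card hmean) _.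
  rewrite (_ : n * _ = (n * e ^+ 2) * (A * e)); last by ring.
    by rewrite ne mul1r.
have b4 : `|x * (\sum_i v2 i - 1)| <= A * (x * e).
  rewrite normrM (ger0_norm x0); apply: le_trans (ler_wpM2l x0 hvar) _.
  rewrite (_ : x * (A * e ^+ 2) = A * (x * e) * e); last by ring.
  by rewrite ler_piMr ?mulr_ge0 ?(ltW e0)//; lra.
have -> : m - x = \sum_i (mi i - N1 i) + \sum_i (N1 i - mu i - x * v2 i)
   + \sum_i mu i + x * (\sum_i v2 i - 1).
  by rewrite !sumrB -mulr_sumr /m; ring.
have bb : A * e + A * (x * e) + A * (x ^+ 2 * e) <= A ^+ 2 * ((1 + x) ^+ 2 * e).
  rewrite (_ : _ + _ + _ = A * ((1 + x + x ^+ 2) * e)); last by ring.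
  apply: ler_pM => //; rewrite ?mulr_ge0 ?addr_ge0 ?sqr_ge0 ?(ltW e0)//; try lra.
  by rewrite ler_wpM2r ?(ltW e0)// -subr_ge0 (_ : _ - _ = x)//; ring.
apply: le_trans (ler_normD _ _) _; apply: le_trans (lerD (ler_normD _ _) b4) _.
apply: le_trans (lerD (lerD (ler_normD _ _) b3) (lexx _)) _.
lra.
Qed.

Lemma tilted_varE : s2 = \sum_i (N2 i / M i - mi i ^+ 2).
Proof.
apply: eq_bigr => i _.
have qp : is_prob q by exact: tilt_prob.
have -> : N2 i / M i = E1 q i (fun v => y i v ^+ 2) by rewrite E1_tilt.
have -> : E1 q i (fun v => (y i v - mi i) ^+ 2) =
    E1 q i (fun v => y i v ^+ 2 + ((- (2 * mi i)) * y i v + mi i ^+ 2)).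
  by apply: eq_E1 => v; ring.
by rewrite !E1D E1Z E1_cst// -/(mi i); ring.
Qed.

Lemma tilted_var_dev : `|s2 - 1| <= 3 * (A ^+ 2 * h).
Proof.
have [A1 x0 e0] := tilt_parameters; have A2 := le_A_sqr.
have [eh xeh h0 [h1 Ah]] := h_bounds.
have A20 : 0 <= A ^+ 2 by exact: sqr_ge0.
have b1 : `|\sum_i (N2 i / M i - N2 i)| <= 12 * (A ^+ 2 * h ^+ 2).
  apply: le_trans (sum_le_card (c := 12 * (A ^+ 2 * h ^+ 2) * e ^+ 2) _) _.
    move=> i; have /andP[n0 nb] := tilted_numer2_bounds i.
    have nn : `|N2 i| <= 2 * (A * e ^+ 2) by rewrite ger0_norm.
    apply: le_trans (div_mgf_dev i nn) _.
    by rewrite le_eqVlt; apply/orP; left; apply/eqP; ring.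
  by rewrite mulrCA ne mulr1.
have b2 : `|\sum_i (N2 i - v2 i)| <= A * h.
  apply: le_trans (sum_le_card tilted_numer2_taylor) _.
  rewrite (_ : n * _ = (n * e ^+ 2) * (A * (x * e))); last by ring.
  by rewrite ne mul1r ler_wpM2l//; lra.
have b3 : A * e ^+ 2 <= A * h.
  rewrite ler_wpM2l//; first by lra.
  by apply: (le_trans _ eh); rewrite expr2 ler_piMl ?(ltW e0)//; lra.
have b4 : `|\sum_i mi i ^+ 2| <= 36 * (A ^+ 2 * h ^+ 2).
  apply: le_trans (sum_le_card (c := 36 * (A ^+ 2 * h ^+ 2) * e ^+ 2) _) _.
    move=> i; rewrite normrX.
    rewrite (_ : 36 * _ * _ = (6 * (A * (e * h))) ^+ 2); last by ring.
    by rewrite ler_pXn2r ?nnegrE ?tilted_mean_bound// !mulr_ge0 ?(ltW e0) ?(ltW h0)//; lra.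
  by rewrite mulrCA ne mulr1.
have hh : A ^+ 2 * h ^+ 2 <= 100^-1 * (A ^+ 2 * h).
  rewrite (_ : A ^+ 2 * h ^+ 2 = h * (A ^+ 2 * h)); last by ring.
  by rewrite ler_wpM2r// mulr_ge0// ltW.
have A2h : A * h <= A ^+ 2 * h by rewrite ler_wpM2r// ltW.
have -> : s2 - 1 = \sum_i (N2 i / M i - N2 i) + \sum_i (N2 i - v2 i)
   + (\sum_i v2 i - 1) - \sum_i mi i ^+ 2.
  by rewrite tilted_varE !sumrB; ring.
apply: le_trans (ler_normB _ _) _; apply: le_trans (lerD (ler_normD _ _) b4) _.
apply: le_trans (lerD (lerD (ler_normD _ _) hvar) (lexx _)) _.
have := mulr_ge0 A20 (ltW h0); lra.
Qed.

(** From |a - b|^3 <= 4 |a|^3 + 4 |b|^3, with the tilted third moment of [y i]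
at most [2 * (A * e ^+ 3)] and its tilted mean at most [6 * (A * (e * h))], cubed. *)
Lemma tilted_third_bound :
  \sum_i E1 q i (fun v => `|y i v - mi i| ^+ 3) <= 872 * (A ^+ 3 * e).
Proof.
have [A1 x0 e0] := tilt_parameters.
have [eh xeh h0 [h1 Ah]] := h_bounds.
have qp : is_prob q by exact: tilt_prob.
have A3 : A <= A ^+ 3 by rewrite exprS ler_peMr; [|lra|apply: exprn_ege1].
apply: (@le_trans _ _ (\sum_(i : I) 872 * (A ^+ 3 * e) * e ^+ 2)); last first.
  by rewrite sumr_const -[leLHS]mulr_natl -/n mulrCA ne mulr1.
apply: ler_sum => i _.
have [M0 _ Mi] := mgf_bounds i.
have cub (a b : R) : `|a - b| ^+ 3 <= 4 * `|a| ^+ 3 + 4 * `|b| ^+ 3.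
  apply: (@le_trans _ _ ((`|a| + `|b|) ^+ 3)).
    by rewrite ler_pXn2r ?nnegrE ?addr_ge0// ler_normB.
  have := normr_ge0 a; have := normr_ge0 b; move: `|a| `|b| => c d d0 c0.
  rewrite -subr_ge0 (_ : _ - _ = 3 * ((c + d) * (c - d) ^+ 2)); last by ring.
  by rewrite mulr_ge0// mulr_ge0 ?sqr_ge0// addr_ge0.
apply: (@le_trans _ _ (E1 q i (fun v => 4 * `|y i v| ^+ 3 + 4 * `|mi i| ^+ 3))).
  by apply: E1_le => // v; exact: cub.
rewrite E1D E1Z E1_cst//.
have b1 : E1 q i (fun v => `|y i v| ^+ 3) <= 2 * (A * e ^+ 3).
  rewrite E1_tilt mulrC.
  apply: ler_pM => //; rewrite ?invr_ge0 ?(ltW M0)//.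
    by apply: E1_ge0 => // v; rewrite mulr_ge0 ?exprn_ge0 ?expR_ge0.
  apply: le_trans (hmom3 i); apply: E1_le => // v.
  rewrite ler_wpM2l ?exprn_ge0// ler_expR ler_wpM2l//; exact: ler_norm.
have b2 : `|mi i| ^+ 3 <= 216 * (A ^+ 3 * e ^+ 3).
  apply: (@le_trans _ _ ((6 * (A * (e * h))) ^+ 3)).
    rewrite ler_pXn2r ?nnegrE ?tilted_mean_bound// !mulr_ge0 ?(ltW e0) ?(ltW h0)//; lra.
  rewrite (_ : (6 * _) ^+ 3 = h ^+ 3 * (216 * (A ^+ 3 * e ^+ 3))); last by ring.
  have A0 : 0 <= A by lra.
  rewrite ler_piMl; [by []| |]; last by rewrite exprn_ile1 ?(ltW h0)//; lra.
  by rewrite mulr_ge0 ?ler0n// mulr_ge0// exprn_ge0// ltW.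
have b3 : A * e ^+ 3 <= A ^+ 3 * e ^+ 3 by rewrite ler_wpM2r// exprn_ge0// ltW.
rewrite (_ : 872 * _ * _ = 872 * (A ^+ 3 * e ^+ 3)); last by ring.
lra.
Qed.

(** Each factor [M i = 1 + tau i] lies between [expR (tau i - 2 * tau i ^+ 2)] and
[expR (tau i)]; the [tau i] sum to [x ^+ 2 / 2 + O(A ^+ 2 * E)] and their squares
to [O(A ^+ 2 * E)]. *)
Lemma mgf_prod_bounds :
  expR (x ^+ 2 / 2 - 11 * (A ^+ 2 * E)) <= \prod_i M i <= expR (x ^+ 2 / 2 + 11 * (A ^+ 2 * E)).
Proof.
have [A1 x0 e0] := tilt_parameters; have A2 := le_A_sqr.
have [eh xeh h0 [h1 Ah]] := h_bounds.
have E0 : 0 < E by rewrite mulr_gt0// ltr_pwDl// exprn_ge0.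
have x3 : 0 <= x ^+ 3 by exact: exprn_ge0.
have AE : A * E <= A ^+ 2 * E by rewrite ler_wpM2r// ltW.
have st : `|\sum_i tau i - x ^+ 2 / 2| <= 3 * (A ^+ 2 * E).
  have b1 : `|\sum_i (tau i - x * mu i - x ^+ 2 / 2 * v2 i)| <= A * (x ^+ 3 * e).
    apply: le_trans (sum_le_card mgf_taylor) _.
    rewrite (_ : n * _ = (n * e ^+ 2) * (A * (x ^+ 3 * e))); last by ring.
    by rewrite ne mul1r.
  have b2 : `|x * \sum_i mu i| <= A * (x * e).
    rewrite normrM (ger0_norm x0).
    apply: le_trans (ler_wpM2l x0 (sum_le_card hmean)) _.
    rewrite (_ : x * (n * (A * e ^+ 3)) = (n * e ^+ 2) * (A * (x * e))); last by ring.
    by rewrite ne mul1r.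
  have b3 : `|x ^+ 2 / 2 * (\sum_i v2 i - 1)| <= A * (x ^+ 2 * e).
    rewrite normrM ger0_norm ?divr_ge0 ?sqr_ge0//.
    have xx : 0 <= x ^+ 2 / 2 by rewrite divr_ge0 ?sqr_ge0.
    apply: le_trans (ler_wpM2l xx hvar) _.
    rewrite (_ : x ^+ 2 / 2 * (A * e ^+ 2) = (e / 2) * (A * (x ^+ 2 * e))); last by ring.
    rewrite ler_piMl ?mulr_ge0 ?sqr_ge0 ?(ltW e0)//; lra.
  have -> : \sum_i tau i - x ^+ 2 / 2 = \sum_i (tau i - x * mu i - x ^+ 2 / 2 * v2 i)
     + x * \sum_i mu i + x ^+ 2 / 2 * (\sum_i v2 i - 1).
    by rewrite !sumrB -!mulr_sumr; ring.
  have b4 : A * (x * e) <= A * E.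
    rewrite ler_wpM2l// ?/E ?ler_wpM2r ?(ltW e0)//; first by lra.
    have [x1|/ltW x1] := leP x 1; first by lra.
    have : x <= x ^+ 3 by rewrite exprS ler_peMr// exprn_ege1.
    lra.
  have b5 : A * (x ^+ 2 * e) <= A * E.
    rewrite ler_wpM2l// ?/E ?ler_wpM2r ?(ltW e0)//; first by lra.
    have [x1|/ltW x1] := leP x 1.
      have : x ^+ 2 <= 1 by rewrite exprn_ile1.
      lra.
    have : x ^+ 2 <= x ^+ 3 by rewrite (exprS x 2) ler_peMl// sqr_ge0.
    lra.
  have b6 : A * (x ^+ 3 * e) <= A * E.
    rewrite ler_wpM2l// ?/E ?ler_wpM2r ?(ltW e0)//; lra.
  apply: le_trans (ler_normD _ _) _; apply: le_trans (lerD (ler_normD _ _) b3) _.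
  lra.
have st2 : \sum_i tau i ^+ 2 <= 4 * (A ^+ 2 * E).
  apply: le_trans (ler_norm _) _.
  apply: le_trans (sum_le_card (c := 9 * A ^+ 2 * h ^+ 4) _) _.
    move=> i; rewrite normrX (_ : 9 * _ * _ = (3 * A * h ^+ 2) ^+ 2); last by ring.
    by rewrite ler_pXn2r ?nnegrE ?mgf_sub1_bound// !mulr_ge0 ?sqr_ge0//; lra.
  rewrite (_ : n * _ = (n * e ^+ 2) * (9 * h) * (A ^+ 2 * ((1 + x) ^+ 3 * e))); last first.
    by rewrite /h; ring.
  rewrite ne mul1r.
  have c := cube_le_error.
  have : A ^+ 2 * ((1 + x) ^+ 3 * e) <= A ^+ 2 * (4 * E) by rewrite ler_wpM2l ?sqr_ge0.
  have : 0 <= A ^+ 2 * ((1 + x) ^+ 3 * e).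
    by rewrite !mulr_ge0 ?sqr_ge0 ?exprn_ge0 ?(ltW e0)//; lra.
  have : (9 * h) * (A ^+ 2 * ((1 + x) ^+ 3 * e)) <= 1 * (A ^+ 2 * ((1 + x) ^+ 3 * e)).
    rewrite ler_wpM2r//; last by lra.
    by rewrite !mulr_ge0 ?sqr_ge0 ?exprn_ge0 ?(ltW e0)//; lra.
  lra.
move: st; rewrite ler_norml => /andP[st0 st1].
apply/andP; split.
  apply: (@le_trans _ _ (expR (\sum_i (tau i - 2 * tau i ^+ 2)))).
    by rewrite ler_expR sumrB -mulr_sumr; lra.
  rewrite expR_sum; apply: ler_prod => i _; rewrite expR_ge0/=.
  have [_ t2 _] := mgf_bounds i.
  by apply: le_trans (expR_ge_sub_sqr t2) _; rewrite /tau addrC subrK.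
apply: (@le_trans _ _ (expR (\sum_i tau i))); last first.
  by rewrite ler_expR; have := mulr_ge0 (sqr_ge0 A) (ltW E0); lra.
rewrite expR_sum; apply: ler_prod => i _; have [M0 _ _] := mgf_bounds i.
rewrite (ltW M0)/=; apply: le_trans (expR_ge1Dx _).
by rewrite /tau addrC subrK.
Qed.

End core.

(** * Relative error in a finite product space *)

(** Two factors are estimated.  [M * expR (- (x * m) + x ^+ 2 * s ^+ 2 / 2)] is 1 up to
a factor with an exponent at most 25 = 11 + 14 units of [A ^+ 2 * E], since the
quadratic terms in the exponents nearly cancel.  The argument [(u0 - m) / s + x * s] of [gtail] differs from [x] by at most
[r = 9 * (A ^+ 2 * ((1 + x) ^+ 2 * e))], which by [gtail_perturb] costs an exponent
[(2 + x + r) * r], at most 108 of these units. *)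
Lemma gauss_tilt_close (R : realType) (x e A m s u0 M : R) :
  100 * A ^+ 2 * ((1 + x) * e) <= 1 -> 1 <= A -> 0 <= x -> 0 < e -> 0 < s ->
  `|m - x| <= 2 * (A ^+ 2 * ((1 + x) ^+ 2 * e)) ->
  `|s ^+ 2 - 1| <= 3 * (A ^+ 2 * ((1 + x) * e)) ->
  `|u0 - x| <= A * e ->
  let E := (1 + x ^+ 3) * e in
  expR (x ^+ 2 / 2 - 11 * (A ^+ 2 * E)) <= M <= expR (x ^+ 2 / 2 + 11 * (A ^+ 2 * E)) ->
  gtail x <= M * gauss_tilt x m s u0 * expR (133 * (A ^+ 2 * E)) /\
  M * gauss_tilt x m s u0 <= gtail x * expR (133 * (A ^+ 2 * E)).
Proof.
move=> hs A1 x0 e0 s0 hm hs2 hu E /andP[M1 M2].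
have [eh xeh h0 [h1 Ah]] := h_bounds hs A1 x0 e0.
have cub := cube_le_error A1 x0 e0; rewrite -/E in cub.
have A20 : 1 <= A ^+ 2 by rewrite exprn_ege1.
set G := A ^+ 2 * ((1 + x) ^+ 2 * e) in hm.
set H := (1 + x) * e in hs hs2 eh xeh h0 h1 Ah.
set K := A ^+ 2 * ((1 + x) ^+ 3 * e).
have KE : K <= 4 * (A ^+ 2 * E).
  have : K <= A ^+ 2 * (4 * E) by rewrite /K ler_wpM2l//; lra.
  lra.
have G0 : 0 <= G by rewrite /G !mulr_ge0 ?exprn_ge0 ?(ltW e0)//; lra.
have KG : K = (1 + x) * G by rewrite /K /G; ring.
have AH0 : 0 <= A ^+ 2 * H by rewrite mulr_ge0 ?(ltW h0)//; lra.
have GH : G = (1 + x) * (A ^+ 2 * H) by rewrite /G /H; ring.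
have AH1 : A ^+ 2 * H <= 100^-1 by lra.
have AeG : A * e <= G.
  apply: (@le_trans _ _ (A ^+ 2 * H)).
    apply: ler_pM => //; rewrite ?(ltW e0)//; first by lra.
    by rewrite expr2 ler_peMr//; lra.
  by rewrite GH ler_peMl//; lra.
have xAH : x * (A ^+ 2 * H) <= G by rewrite GH ler_wpM2r//; lra.
have s1 : `|s - 1| <= 3 * (A ^+ 2 * H).
  apply: le_trans hs2; rewrite (_ : s ^+ 2 - 1 = (s - 1) * (s + 1)); last by ring.
  by rewrite normrM ler_peMr// ger0_norm; lra.
have s12 : 2^-1 <= s by move: s1; rewrite ler_norml => /andP[]; lra.
have si : s^-1 <= 2 by rewrite -[leRHS]invrK lef_pV2 ?posrE ?invr_gt0//.
set r := 9 * G.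
have xr : `|(u0 - m) / s + x * s - x| <= r.
  have -> : (u0 - m) / s + x * s - x = ((u0 - x) - (m - x)) / s + x * (s - 1).
    by field; rewrite gt_eqF.
  apply: le_trans (ler_normD _ _) _.
  rewrite (normrM x) (ger0_norm x0) normrM (ger0_norm (x := s^-1)) ?invr_ge0 ?(ltW s0)//.
  have b1 : `|u0 - x - (m - x)| * s^-1 <= (A * e + 2 * G) * 2.
    apply: ler_pM => //; rewrite ?invr_ge0 ?(ltW s0)//.
    by apply: le_trans (ler_normB _ _) _; exact: lerD.
  have b2 : x * `|s - 1| <= x * (3 * (A ^+ 2 * H)) by rewrite ler_wpM2l.
  rewrite /r; lra.
have Lr : (2 + x + r) * r <= 27 * K.
  have r1 : r <= 1 + x.
    rewrite /r GH; have : (1 + x) * (A ^+ 2 * H) <= (1 + x) * 100^-1 by rewrite ler_wpM2l//; lra.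
    lra.
  have -> : 27 * K = 3 * (1 + x) * r by rewrite KG /r; ring.
  have r0 : 0 <= r by rewrite /r mulr_ge0 ?ler0n.
  by rewrite ler_wpM2r//; move: r1 x0; clear; lra.
have [T1 T2] := gtail_perturb x0 xr.
set x' := (u0 - m) / s + x * s in xr T1 T2.
set a := - (x * m) + x ^+ 2 * s ^+ 2 / 2.
have aE : `|a + x ^+ 2 / 2| <= 14 * (A ^+ 2 * E).
  have -> : a + x ^+ 2 / 2 = - (x * (m - x)) + x ^+ 2 / 2 * (s ^+ 2 - 1) by rewrite /a; field.
  apply: le_trans (ler_normD _ _) _; rewrite normrN (normrM x) (ger0_norm x0).
  rewrite (normrM (x ^+ 2 / 2)) (ger0_norm (x := x ^+ 2 / 2)) ?divr_ge0 ?sqr_ge0//.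
  have b1 : x * `|m - x| <= 2 * K.
    apply: le_trans (ler_wpM2l x0 hm) _; rewrite KG.
    have : x * G <= (1 + x) * G by rewrite ler_wpM2r//; lra.
    lra.
  have b2 : x ^+ 2 / 2 * `|s ^+ 2 - 1| <= 3 / 2 * K.
    have xx : 0 <= x ^+ 2 / 2 by rewrite divr_ge0 ?sqr_ge0.
    apply: le_trans (ler_wpM2l xx hs2) _.
    rewrite (_ : _ * (3 * _) = 3 / 2 * (x * (x * (A ^+ 2 * H)))); last by ring.
    rewrite ler_wpM2l; [by []|lra|].
    have : x * (x * (A ^+ 2 * H)) <= x * G by rewrite ler_wpM2l.
    have : x * G <= (1 + x) * G by rewrite ler_wpM2r//; lra.
    by rewrite KG; lra.
  lra.
have K0 : 0 <= K by rewrite KG mulr_ge0// addr_ge0.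
have AE : 0 <= A ^+ 2 * E by move: K0 KE; clear; lra.
have M0 : 0 < M by apply: lt_le_trans M1; exact: expR_gt0.
have Ma : expR (- (25 * (A ^+ 2 * E))) <= M * expR a <= expR (25 * (A ^+ 2 * E)).
  move: aE; rewrite ler_norml => /andP[a1 a2]; apply/andP; split.
    apply: (@le_trans _ _ (expR (x ^+ 2 / 2 - 11 * (A ^+ 2 * E)) * expR a)).
      by rewrite -expRD ler_expR; move: a1; clear; lra.
    by rewrite ler_wpM2r ?expR_ge0.
  apply: (@le_trans _ _ (expR (x ^+ 2 / 2 + 11 * (A ^+ 2 * E)) * expR a)).
    by rewrite ler_wpM2r ?expR_ge0.
  by rewrite -expRD ler_expR; move: a2; clear; lra.
have /andP[Ma1 Ma2] := Ma.
have Lr' : expR ((2 + x + r) * r) <= expR (108 * (A ^+ 2 * E)) by rewrite ler_expR; move: Lr KE; clear; lra.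
have gt0 := @gtail_gt0 R.
rewrite /gauss_tilt -/a -/x'; split.
  apply: (le_trans T2).
  rewrite (_ : M * _ * _ = gtail x' * (M * expR a * expR (133 * (A ^+ 2 * E)))); last by ring.
  rewrite ler_wpM2l ?(ltW (gt0 _))//; apply: (le_trans Lr').
  apply: (@le_trans _ _ (expR (- (25 * (A ^+ 2 * E))) * expR (133 * (A ^+ 2 * E)))).
    by rewrite -expRD ler_expR; clear; lra.
  by rewrite ler_wpM2r ?expR_ge0.
rewrite mulrA.
apply: (@le_trans _ _ (expR (25 * (A ^+ 2 * E)) * (gtail x * expR (108 * (A ^+ 2 * E))))).
  apply: ler_pM => //; rewrite ?mulr_ge0 ?expR_ge0 ?(ltW M0) ?(ltW (gt0 _))//.
  apply: (le_trans T1); rewrite ler_wpM2l ?(ltW (gt0 _))//.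
by rewrite mulrCA -expRD ler_wpM2l ?(ltW (gt0 _))// ler_expR; clear; lra.
Qed.

(** The centered summands divided by [s] satisfy [berry_esseen]. *)
Lemma berry_esseen_affine (R : realType) (I V : finType) (q y : I -> V -> R) (s b u : R) :
  is_prob q -> 0 < s -> 0 < b ->
  s ^+ 2 = \sum_i E1 q i (fun v => (y i v - E1 q i (y i)) ^+ 2) ->
  \sum_i E1 q i (fun v => `|y i v - E1 q i (y i)| ^+ 3) <= s ^+ 3 * b ->
  `|Ex q (fun w => (sumv y w < u)%R%:R) - Phi ((u - \sum_i E1 q i (y i)) / s)| <= 46 * b.
Proof.
move=> qp s0 b0 s2 s3; set m := \sum_i E1 q i (y i).
pose x i v := s^-1 * (y i v - E1 q i (y i)).
have sn0 : s != 0 by rewrite gt_eqF.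
have xs w : sumv x w = (sumv y w - m) / s.
  by rewrite /sumv /x -mulr_sumr sumrB mulrC.
have -> : Ex q (fun w => (sumv y w < u)%R%:R) =
    Ex q (fun w => (sumv x w < (u - m) / s)%R%:R).
  by apply: eq_Ex => w; rewrite xs ltr_pM2r ?invr_gt0// ltrD2r.
apply: berry_esseen => //.
- by move=> i; rewrite E1Z E1B E1_cst// subrr mulr0.
- transitivity ((s ^+ 2)^-1 * \sum_i E1 q i (fun v => (y i v - E1 q i (y i)) ^+ 2)).
    rewrite mulr_sumr; apply: eq_bigr => i _; rewrite -E1Z; apply: eq_E1 => v.
    by rewrite /x exprMn exprVn.
  by rewrite -s2 mulVf// expf_neq0.
- have -> : \sum_i E1 q i (fun v => `|x i v| ^+ 3) =
    (s ^+ 3)^-1 * \sum_i E1 q i (fun v => `|y i v - E1 q i (y i)| ^+ 3).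
    rewrite mulr_sumr; apply: eq_bigr => i _; rewrite -E1Z; apply: eq_E1 => v.
    by rewrite /x (normrM s^-1) exprMn gtr0_norm ?invr_gt0// exprVn.
  by rewrite ler_pdivrMl ?exprn_gt0.
Qed.

Lemma expR_close (R : realType) (a b t : R) : 0 <= t -> 0 <= a ->
  a <= b * expR t -> b <= a * expR t -> `|b - a| <= a * (t * expR t).
Proof.
move=> t0 a0 h1 h2.
have e1 : 1 <= expR t by rewrite -[leLHS]expR0 ler_expR.
have e2 : expR t - 1 <= t * expR t.
  by have := expR_taylor1 t; rewrite !ger0_norm ?subr_ge0.
have e3 : a * (expR t - 1) <= a * (t * expR t) by rewrite ler_wpM2l.
have e4 : 1 - t <= expR (- t) by exact: expR_ge1Dx.
have h3 : a * expR (- t) <= b.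
  by rewrite expRN ler_pdivrMr ?expR_gt0.
have e5 : a * (1 - t) <= a * expR (- t) by rewrite ler_wpM2l.
have e6 : t <= t * expR t by rewrite ler_peMr.
have e7 : a * t <= a * (t * expR t) by rewrite ler_wpM2l.
rewrite ler_norml; apply/andP; split; lra.
Qed.

Lemma berry_esseen_half (R : realType) (I V : finType) (q y : I -> V -> R) (s b u : R) :
  is_prob q -> 0 < b -> 2^-1 <= s ->
  s ^+ 2 = \sum_i E1 q i (fun v => (y i v - E1 q i (y i)) ^+ 2) ->
  \sum_i E1 q i (fun v => `|y i v - E1 q i (y i)| ^+ 3) <= b ->
  `|Ex q (fun w => (sumv y w < u)%R%:R) - Phi ((u - \sum_i E1 q i (y i)) / s)|
    <= 46 * (8 * b).
Proof.
move=> qp b0 s12 sS ht.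
have s0 : 0 < s by apply: lt_le_trans s12; rewrite invr_gt0 ltr0n.
apply: berry_esseen_affine => //; first by rewrite mulr_gt0.
apply: (le_trans ht).
have s8 : 8^-1 <= s ^+ 3.
  rewrite (_ : 8^-1 = 2^-1 ^+ 3); last by rewrite exprVn; congr (_^-1); ring.
  by rewrite ler_pXn2r// nnegrE ltW.
apply: (@le_trans _ _ (8^-1 * (8 * b))); first by rewrite mulKf.
by rewrite ler_wpM2r// mulr_ge0// ltW.
Qed.

(** [M * expR (- (x * u0))] is of the order of [expR (- (x ^+ 2 / 2))], which exceeds
[gtail x] by a factor [O(1 + x)] at most; the factor [e] makes up for it. *)
Lemma error_term_bound (R : realType) (A x e u0 M : R) :
  1 <= A -> 0 <= x -> 0 < e -> x * e <= 100^-1 ->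
  (1 + x ^+ 3) * e <= 2 * A -> `|u0 - x| <= A * e ->
  M <= expR (x ^+ 2 / 2 + 11 * (A ^+ 2 * ((1 + x ^+ 3) * e))) ->
  M * expR (- (x * u0)) * e <=
    6 * expR (24 * A ^+ 3) * ((1 + x ^+ 3) * e) * gtail x.
Proof.
move=> A1 x0 e0 xe; set E := (1 + x ^+ 3) * e => E2 hu hM.
have A2 : 1 <= A ^+ 2 by rewrite exprn_ege1.
have A2E : A ^+ 2 * E <= 2 * A ^+ 3.
  by rewrite (_ : 2 * A ^+ 3 = A ^+ 2 * (2 * A)) ?ler_wpM2l//; [lra|ring].
have xE : (1 + x) * e <= 2 * E.
  rewrite /E mulrA ler_wpM2r ?(ltW e0)//.
  have [x1|/ltW x1] := leP x 1.
    by have := exprn_ge0 3 x0; lra.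
  have : x <= x ^+ 3 by rewrite exprS ler_peMr// exprn_ege1.
  lra.
have b3 : M * expR (- (x * u0)) <= expR (24 * A ^+ 3) * (3 * ((1 + x) * gtail x)).
  apply: (@le_trans _ _ (expR (24 * A ^+ 3) * expR (- (x ^+ 2 / 2)))); last first.
    by rewrite ler_wpM2l ?expR_ge0// gtail_ge_expR.
  apply: (@le_trans _ _ (expR (x ^+ 2 / 2 + 11 * (A ^+ 2 * E)) * expR (- (x * u0)))).
    by rewrite ler_wpM2r ?expR_ge0.
  rewrite -!expRD ler_expR.
  have xu : x * (x - u0) <= x * (A * e).
    by rewrite ler_wpM2l//; apply: le_trans hu; rewrite distrC; exact: ler_norm.
  have xA : x * (A * e) <= A ^+ 3.
    rewrite (_ : x * (A * e) = A * (x * e)); last by ring.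
    by rewrite (exprS A 2); apply: ler_pM; rewrite ?mulr_ge0 ?(ltW e0)//; lra.
  have A3 : 1 <= A ^+ 3 by rewrite exprn_ege1.
  lra.
apply: le_trans (ler_wpM2r (ltW e0) b3) _.
rewrite (_ : expR (24 * A ^+ 3) * _ * e = 3 * expR (24 * A ^+ 3) * gtail x * ((1 + x) * e));
  last by ring.
rewrite (_ : 6 * _ * _ * _ = 3 * expR (24 * A ^+ 3) * gtail x * (2 * E)); last by ring.
by rewrite ler_wpM2l// !mulr_ge0 ?expR_ge0// ltW ?gtail_gt0.
Qed.

(** Only the existence of a constant that is uniform in the data matters later
on. *)
Lemma tilted_third_bound_ex (R : realType) : exists2 B : R, 0 < B &
  forall (I V : finType) (p y : I -> V -> R) (x e A : R),
  is_prob p -> #|I|%:R * e ^+ 2 = 1 ->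
  (forall i, E1 p i (fun v => `|y i v| ^+ 3 * expR (x * `|y i v|)) <= A * e ^+ 3) ->
  (forall i, E1 p i (fun v => y i v ^+ 2) <= A * e ^+ 2) ->
  (forall i, `|E1 p i (y i)| <= A * e ^+ 3) ->
  100 * A ^+ 2 * ((1 + x) * e) <= 1 -> 1 <= A -> 0 <= x -> 0 < e ->
  \sum_i E1 (tilt p y x) i (fun v => `|y i v - E1 (tilt p y x) i (y i)| ^+ 3)
    <= B * (A ^+ 3 * e).
Proof.
exists 872; first by rewrite ltr0n.
move=> I V p y x e A pp ne h3 h2 h1 hs A1 x0 e0.
exact (tilted_third_bound pp ne h3 h2 h1 hs A1 x0 e0).
Qed.

(** By [Ex_tilt] the probability is [M] times a weighted tail under the tilted law.
Berry-Esseen for that law and [tilted_tail] replace the weighted tail by its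
Gaussian counterpart, at a cost estimated in [error_term_bound]; then
[gauss_tilt_close] applies.  The point [u0] need not be [x], which leaves room for
the error made by rounding. *)
Theorem tilted_estimate (R : realType) (A : R) : 1 <= A -> exists C : R, 0 < C /\
  forall (I V : finType) (p y : I -> V -> R) (x e u0 : R),
  is_prob p -> #|I|%:R * e ^+ 2 = 1 ->
  (forall i, E1 p i (fun v => `|y i v| ^+ 3 * expR (x * `|y i v|)) <= A * e ^+ 3) ->
  (forall i, E1 p i (fun v => y i v ^+ 2) <= A * e ^+ 2) ->
  (forall i, `|E1 p i (y i)| <= A * e ^+ 3) ->
  `|\sum_i E1 p i (fun v => y i v ^+ 2) - 1| <= A * e ^+ 2 ->
  x ^+ 3 * e <= A -> 100 * A ^+ 2 * ((1 + x) * e) <= 1 -> 0 <= x -> 0 < e ->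
  `|u0 - x| <= A * e ->
  `|Ex p (fun w => (u0 <= sumv y w)%R%:R) - gtail x| <= C * ((1 + x ^+ 3) * e) * gtail x.
Proof.
move=> A1; have A0 : 0 < A by exact: lt_le_trans A1.
have [B B0 hB] := tilted_third_bound_ex R.
pose W := 46 * (8 * B).
have W0 : 0 < W by rewrite /W mulr_gt0// mulr_gt0.
pose c1 : R := 12 * (W * (A ^+ 3 * expR (24 * A ^+ 3))).
pose c2 : R := 133 * (A ^+ 2 * expR (266 * A ^+ 3)).
have A2 : 1 <= A ^+ 2 by rewrite exprn_ege1.
have A3 : 1 <= A ^+ 3 by rewrite exprn_ege1.
exists (c1 + c2); split.
  have X0 k : 0 < expR (k * A ^+ 3) by exact: expR_gt0.
  apply: addr_gt0; apply: mulr_gt0; [by rewrite ltr0n| |by rewrite ltr0n|].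
    exact: mulr_gt0 W0 (mulr_gt0 (exprn_gt0 3 A0) (X0 _)).
  exact: mulr_gt0 (exprn_gt0 2 A0) (X0 _).
move=> I V p y x e u0 pp ne h3 h2 h1 hv hx3 hs x0 e0 hu.
have hm := tilted_mean_dev pp ne h3 h2 h1 hv hs A1 x0 e0.
have hs2 := tilted_var_dev pp ne h3 h2 h1 hv hs A1 x0 e0.
have ht := hB _ _ _ _ _ _ _ pp ne h3 h2 h1 hs A1 x0 e0.
have hM := mgf_prod_bounds pp ne h3 h2 h1 hv hs A1 x0 e0.
have [eh xeh h0 [hle Ah]] := h_bounds hs A1 x0 e0.
have e1 : e <= 1 by move: eh hle; clear; lra.
have xe : x * e <= 100^-1 := le_trans xeh hle.
have A2H : 3 * (A ^+ 2 * ((1 + x) * e)) <= 3 * 100^-1 by move: hs; clear; lra.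
move: hm hs2 ht hM; cbv beta; clear h3 h2 h1 hv ne eh xeh h0 hle Ah.
set q := tilt p y x; set m := \sum_i E1 q i (y i).
set S2 := \sum_i E1 q i (fun v => (y i v - E1 q i (y i)) ^+ 2).
set M := \prod_i _; set E := (1 + x ^+ 3) * e.
move=> hm hs2 ht hM.
have qp : is_prob q by exact: tilt_prob.
have S2b : 4^-1 <= S2.
  by move: (le_trans hs2 A2H); rewrite ler_norml => /andP[+ _]; clear; lra.
pose s := Num.sqrt S2.
have S20 : 0 <= S2 by apply: le_trans S2b; rewrite invr_ge0 ler0n.
have sS : s ^+ 2 = S2 by rewrite sqr_sqrtr.
have s12 : 2^-1 <= s.
  rewrite -(ler_pXn2r (n := 2))// ?nnegrE ?sqrtr_ge0 ?invr_ge0//.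
  by rewrite sS; apply: le_trans S2b; rewrite exprVn expr2 -natrM.
have s0 : 0 < s by apply: lt_le_trans s12; rewrite invr_gt0 ltr0n.
have b0 : 0 < B * (A ^+ 3 * e) := mulr_gt0 B0 (mulr_gt0 (exprn_gt0 3 A0) e0).
have hBE u : `|Ex q (fun w => (sumv y w < u)%R%:R) - Phi ((u - m) / s)| <= W * (A ^+ 3 * e).
  have -> : W * (A ^+ 3 * e) = 46 * (8 * (B * (A ^+ 3 * e))) by rewrite /W -!mulrA.
  exact: berry_esseen_half.
have tail := tilted_tail u0 qp x0 s0 hBE.
rewrite -sS in hs2.
have [G1 G2] := gauss_tilt_close hs A1 x0 e0 s0 hm hs2 hu hM.
have Ptilt : Ex p (fun w => (u0 <= sumv y w)%R%:R) =
  M * Ex q (fun w => expR (- (x * sumv y w)) * (u0 <= sumv y w)%R%:R) by exact: Ex_tilt.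
move: Ptilt tail G1 G2; rewrite -/m.
set P := Ex p _; set H := Ex q _; set g := gauss_tilt _ _ _ _ => Ptilt tail G1 G2.
have /andP[M1 M2] := hM.
have T0 := gtail_gt0 x.
have x30 : 0 <= x ^+ 3 by exact: exprn_ge0.
have E0 : 0 < E by rewrite mulr_gt0// ltr_pwDl.
have E2 : E <= 2 * A by move: e1 hx3 A1; rewrite /E; clear; lra.
have M0 : 0 < M by apply: lt_le_trans M1; exact: expR_gt0.
clearbody P H g M q m s S2.
have b1 : `|M * g - gtail x| <= c2 * E * gtail x.
  have t0 : 0 <= 133 * (A ^+ 2 * E).
    by rewrite mulr_ge0 ?ler0n// mulr_ge0 ?sqr_ge0// ltW.
  apply: le_trans (expR_close t0 (ltW T0) G1 G2) _.
  rewrite mulrC ler_wpM2r ?(ltW T0)//.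
  rewrite (_ : c2 * E = 133 * (A ^+ 2 * E) * expR (266 * A ^+ 3)); last by rewrite /c2; ring.
  rewrite ler_wpM2l// ler_expR.
  have : A ^+ 2 * E <= A ^+ 2 * (2 * A) by rewrite ler_wpM2l ?sqr_ge0.
  rewrite (exprS A 2) mulrC (mulrCA _ 2) (mulrC _ A); clear; lra.
have b2 : `|M * H - M * g| <= c1 * E * gtail x.
  rewrite -mulrBr normrM (ger0_norm (ltW M0)).
  apply: le_trans (ler_wpM2l (ltW M0) tail) _.
  rewrite (_ : M * _ = 2 * (W * A ^+ 3) * (M * expR (- (x * u0)) * e)); last by ring.
  rewrite (_ : c1 * E * gtail x =
    2 * (W * A ^+ 3) * (6 * expR (24 * A ^+ 3) * E * gtail x)); last by rewrite /c1; ring.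
  have WA : 0 <= W * A ^+ 3 := ltW (mulr_gt0 W0 (exprn_gt0 3 A0)).
  rewrite ler_wpM2l//; first by rewrite mulr_ge0 ?ler0n.
  exact (error_term_bound A1 x0 e0 xe E2 hu M2).
rewrite Ptilt (_ : M * H - gtail x = (M * H - M * g) + (M * g - gtail x)); last by ring.
apply: le_trans (ler_normD _ _) _.
by rewrite mulrDl mulrDl; exact: lerD.
Qed.

(** * From a probability space to a finite product *)

Section coded.
Context {R : realType} {d : measure_display} {T : measurableType d}
  (P : probability T R) {V : finType}.
Implicit Types (C : T -> V) (g : V -> R).

Lemma coded_sum C g t : g (C t) = \sum_v g v * \1_(C @^-1` [set v]) t.
Proof.
rewrite (bigD1 (C t))//= indicE mem_set// mulr1 big1 ?addr0// => v vC.
by rewrite indicE memNset ?mulr0//= => /esym/eqP; rewrite (negbTE vC).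
Qed.

Lemma coded_integral C g : (forall v, measurable (C @^-1` [set v])) ->
  P.-integrable setT (EFin \o (g \o C)) /\
  (\int[P]_t g (C t))%R = \sum_v fine (P (C @^-1` [set v])) * g v.
Proof.
move=> mC.
pose h v t : R := g v * \1_(C @^-1` [set v]) t.
have ii v : P.-integrable setT (EFin \o h v).
  rewrite (_ : EFin \o _ = (fun t => (g v)%:E * (\1_(C @^-1` [set v]) t)%:E)%E).
    by apply: integrableZl => //; exact: integrable_indic.
  by apply/funext => t /=; rewrite EFinM.
have e : EFin \o (g \o C) = (fun t => \sum_(v : V) (EFin \o h v) t)%E.
  by apply/funext => t /=; rewrite coded_sum sumEFin.
split; first by rewrite e; apply: integrable_sum.
rewrite /Rintegral.
have -> : (\int[P]_t (g (C t))%:E = \int[P]_t (\sum_(v : V) (EFin \o h v) t))%E.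
  by apply: eq_integral => t _; rewrite -(congr1 (fun f => f t) e).
rewrite integral_sum//.
rewrite (eq_bigr (fun v => (fine (P (C @^-1` [set v])) * g v)%:E)).
  by rewrite sumEFin.
move=> v _; rewrite /h /=; under eq_integral do rewrite EFinM.
rewrite integralZl//; last exact: integrable_indic.
by rewrite integral_indic// setIT mulrC EFinM fineK// fin_num_measure.
Qed.

End coded.

Section product_law.
Context {R : realType} {d : measure_display} {T : measurableType d}
  (P : probability T R) {n : nat} (X : 'I_n -> {RV P >-> R}) {V : finType}
  (c : R -> V).

Definition code_law (i : 'I_n) (v : V) : R := fine (P (X i @^-1` (c @^-1` [set v]))).

Context (mc : forall v, measurable (c @^-1` [set v])).

Let mXc i v : measurable (X i @^-1` (c @^-1` [set v])).
Proof. by rewrite -[X in measurable X]setTI; apply: measurable_funP. Qed.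

Lemma code_law_prob : is_prob code_law.
Proof.
split=> [i v|i]; first by rewrite fine_ge0.
have [_] := coded_integral P (fun=> 1) (mXc i).
under [X in _ = X -> _]eq_bigr do rewrite mulr1.
move=> <-; rewrite Rintegral_cst// mul1r.
exact: (congr1 fine (probability_setT P)).
Qed.

Lemma code_law_E1 i g : E1 code_law i g = (\int[P]_t g (c (X i t)))%R.
Proof. by have [_ ->] := coded_integral P g (mXc i). Qed.

Lemma code_joint (w : {ffun 'I_n -> V}) : [set t | [ffun i => c (X i t)] = w] =
  \bigcap_(i in [set` [set: 'I_n]%SET]) X i @^-1` (c @^-1` [set w i]).
Proof.
apply/seteqP; split => t /=.
  by move=> <- i _ /=; rewrite ffunE.
by move=> h; apply/ffunP => i; rewrite ffunE; apply: h; rewrite /= inE.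
Qed.

Lemma code_joint_measurable (w : {ffun 'I_n -> V}) :
  measurable [set t | [ffun i => c (X i t)] = w].
Proof.
by rewrite code_joint; apply: fin_bigcap_measurable => // i _; exact: mXc.
Qed.

Lemma code_event_measurable (F : {ffun 'I_n -> V} -> bool) :
  measurable [set t | F [ffun i => c (X i t)]].
Proof.
rewrite (_ : [set t | _] =
  \bigcup_(w in [set w | F w]) [set t | [ffun i => c (X i t)] = w]); last first.
  apply/seteqP; split => t /=; first by move=> h; exists [ffun i => c (X i t)].
  by move=> [w Fw /= ->].
by apply: fin_bigcup_measurable => // w _; exact: code_joint_measurable.
Qed.

(** The event depends on the codes only, hence is a finite disjoint union of
events that prescribe all the codes; independence gives each of these the product
of the marginal probabilities. *)
Lemma code_law_Ex (F : {ffun 'I_n -> V} -> bool) : mutually_independent X ->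
  fine (P [set t | F [ffun i => c (X i t)]]) = Ex code_law (fun w => (F w)%:R).
Proof.
move=> indX.
pose C t : {ffun 'I_n -> V} := [ffun i => c (X i t)].
have mC w : measurable (C @^-1` [set w]) := code_joint_measurable w.
have [_] := coded_integral P (fun w => (F w)%:R) mC.
have -> : (\int[P]_t (F (C t))%:R)%R = fine (P [set t | F (C t)]).
  have -> : (\int[P]_t (F (C t))%:R)%R = (\int[P]_t \1_[set t | F (C t)] t)%R.
    apply: eq_Rintegral => t _; rewrite indicE.
    case: (boolP (F (C t))) => h; first by rewrite mem_set.
    by rewrite memNset//=; apply/negP.
  by rewrite /Rintegral integral_indic ?setIT//; exact: code_event_measurable.
move=> ->; apply: eq_bigr => w _; congr (_ * _).
have -> : C @^-1` [set w] =
  \bigcap_(i in [set` [set: 'I_n]%SET]) X i @^-1` (c @^-1` [set w i]) := code_joint w.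
rewrite indX//.
rewrite (eq_bigl xpredT); last by move=> i; rewrite inE.
rewrite (eq_bigr (fun i => (code_law i (w i))%:E)); last first.
  by move=> i _; rewrite fineK// fin_num_measure.
by rewrite -(big_morph EFin (@EFinM _) (erefl 1%E)).
Qed.

End product_law.

(** * Truncation and rounding of reals *)

Section quantizer.
Context {R : realType}.
Implicit Types (N : nat) (a e y : R).

(** A real within the cutoff [a] is coded by the index of the cell of mesh [e] that
contains its absolute value, together with its sign; all other reals share the
code of 0.  Rounding towards 0 ensures that no absolute moment increases
([qval_le]). *)
Definition qcode N a e y : 'I_N.+1 * bool :=
  if `|y| <= a then (inord (Num.truncn (`|y| / e)), y < 0) else (ord0, false).

Definition qval N e (v : 'I_N.+1 * bool) : R :=
  (if v.2 then -1 else 1) * ((v.1 : nat)%:R * e).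

Lemma qcode_index N a e y : 0 < e -> a < N.+1%:R * e -> `|y| <= a ->
  (inord (Num.truncn (`|y| / e)) : 'I_N.+1) = Num.truncn (`|y| / e) :> nat.
Proof.
move=> e0 aN ya; rewrite inordK// ltnS truncn_le_nat.
by rewrite ltr_pdivrMr//; apply: le_lt_trans aN.
Qed.

Lemma qval_norm N e (v : 'I_N.+1 * bool) : 0 < e -> `|qval e v| = (v.1 : nat)%:R * e.
Proof.
move=> e0; rewrite /qval normrM; case: (v.2); rewrite ?normrN normr1 mul1r ger0_norm//;
by rewrite mulr_ge0// ltW.
Qed.

Lemma qval_out N a e y : a < `|y| -> qval e (qcode N a e y) = 0.
Proof. by move=> ay; rewrite /qcode leNgt ay /qval/= mul0r mulr0. Qed.

Lemma qval_le N a e y : 0 < e -> a < N.+1%:R * e ->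
  `|qval e (qcode N a e y)| <= `|y|.
Proof.
move=> e0 aN; have [ya|ay] := leP `|y| a; last by rewrite qval_out// normr0.
rewrite qval_norm// /qcode ya/= (qcode_index e0 aN ya) -ler_pdivlMr//.
by rewrite truncn_le divr_ge0// ltW.
Qed.

Lemma qval_close N a e y : 0 < e -> a < N.+1%:R * e -> `|y| <= a ->
  `|qval e (qcode N a e y) - y| <= e.
Proof.
move=> e0 aN ya; rewrite /qval /qcode ya/= (qcode_index e0 aN ya).
have z0 : 0 <= `|y| / e by rewrite divr_ge0// ltW.
have /andP[t1 t2] := truncn_itv z0.
set k := (Num.truncn _)%:R in t1 *.
rewrite -natr1 -/k in t2.
rewrite ler_pdivlMr// in t1; rewrite ltr_pdivrMr// mulrDl mul1r in t2.
have [y0|y0] := ltP y 0.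
  rewrite ltr0_norm// in t1 t2.
  by rewrite ler_norml; apply/andP; split; lra.
rewrite ger0_norm// in t1 t2.
by rewrite ler_norml; apply/andP; split; lra.
Qed.

Lemma qcode_measurable N a e (v : 'I_N.+1 * bool) : 0 < e -> a < N.+1%:R * e ->
  measurable (qcode N a e @^-1` [set v]).
Proof.
move=> e0 aN.
have mn (A : set R) : measurable A -> measurable (Num.norm @^-1` A : set R).
  have mf : measurable_fun setT (Num.norm : R -> R) by exact: measurable_realfun.normr_measurable.
  by move=> mA; rewrite -[X in measurable X]setTI; exact: mf.
(* A: within the cutoff; K: the cell; S: the sign; O: the reals beyond the cutoff. *)
pose A : set R := Num.norm @^-1` `]-oo, a].
pose K : set R := Num.norm @^-1` `[(v.1 : nat)%:R * e, (v.1.+1)%:R * e[.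
pose S : set R := if v.2 then `]-oo, 0[%classic else `[0, +oo[%classic.
pose O : set R := if v == (ord0, false) then ~` A else set0.
have mA : measurable A by apply: mn.
have mK : measurable K by apply: mn.
have mS : measurable S by rewrite /S; case: (v.2).
have mO : measurable O by rewrite /O; case: ifP => // _; exact: measurableC.
have -> : qcode N a e @^-1` [set v] = (A `&` (K `&` S)) `|` O.
  apply/seteqP; split => y /=.
    rewrite /qcode; case: (leP `|y| a) => ya.
      move=> vE; left; rewrite /A /K /S -vE /= !in_itv/= ya (qcode_index e0 aN ya).
      split => //; split.
        have z0 : 0 <= `|y| / e by rewrite divr_ge0// ltW.
        by have := truncn_itv z0; rewrite ler_pdivlMr// ltr_pdivrMr.
      by case: ltP => y0; rewrite /= in_itv/= ?y0.
    move=> vE; right; rewrite /O -vE eqxx /A /= in_itv/=.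
    by apply/negP; rewrite -ltNge.
  move=> [[]|].
    rewrite /A /= in_itv/= => ya [] ; rewrite /K /= in_itv/= => kb.
    rewrite /S /qcode ya => sb.
    have z0 : 0 <= `|y| / e by rewrite divr_ge0// ltW.
    have kE : Num.truncn (`|y| / e) = v.1 :> nat.
      by apply/eqP; rewrite truncn_eq// ler_pdivlMr// ltr_pdivrMr.
    case: v sb kE {kb K S O mK mS mO} => k b /= sb ->; congr (_, _); first exact: inord_val.
    by case: b sb; rewrite /= in_itv/=; [move=> -> | rewrite andbT leNgt => /negbTE].
  rewrite /O; case: eqP => // -> /=; rewrite /A /= in_itv/= /qcode => h.
  by case: ifP h.
by apply: measurableU => //; apply: measurableI => //; exact: measurableI.
Qed.

End quantizer.

(** The eighth power of [1 + u <= 32 * expR (u / 32)].  With [u = sqrt |f|] this covers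
the moments of [f] up to the fourth, and leaves most of [expR u] for tilting. *)
Lemma expR_moment (R : realType) : exists2 m : R, 1 <= m &
  forall u, 0 <= u -> (1 + u) ^+ 8 <= m * expR (u / 4).
Proof.
exists (32 ^+ 8); first by rewrite exprn_ege1// ler1n.
move=> u u0; have h : 1 + u <= 32 * expR (u / 32).
  by have := expR_ge1Dx (u / 32); lra.
have -> : expR (u / 4) = expR (u / 32) ^+ 8.
  by rewrite -expRM_natl; congr expR; field.
by rewrite -exprMn ler_pXn2r// nnegrE ?mulr_ge0 ?expR_ge0// addr_ge0.
Qed.

(** * Moments of a truncated and rounded variable *)

Section moments.
Context {R : realType} {d : measure_display} {T : measurableType d}
  (P : probability T R).
Implicit Types (f g r : T -> R).

Definition sqrt_exp f t : R := expR (Num.sqrt `|f t|).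

Lemma sqrt_exp_measurable f : measurable_fun setT f -> measurable_fun setT (sqrt_exp f).
Proof.
move=> mf; apply: measurableT_comp => //; apply: measurableT_comp => //.
  by apply: continuous_measurable_fun; exact: sqrt_continuous.
by apply: measurableT_comp => //; exact: measurable_realfun.normr_measurable.
Qed.

Lemma dominated_moment f g (k c2 : R) : measurable_fun setT f -> measurable_fun setT g ->
  0 <= k -> (\int[P]_t (sqrt_exp f t)%:E <= c2%:E)%E ->
  (forall t, `|g t| <= k * sqrt_exp f t) ->
  P.-integrable setT (EFin \o g) /\ `|(\int[P]_t g t)%R| <= k * c2.
Proof.
move=> mf mg k0 hc gk.
have me := sqrt_exp_measurable mf.
have e0 t : 0 <= sqrt_exp f t by exact: expR_ge0.
have ie : P.-integrable setT (EFin \o sqrt_exp f).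
  apply/integrableP; split; first exact/measurable_EFinP.
  under eq_integral do rewrite /= ger0_norm//.
  by apply: le_lt_trans hc _; rewrite ltry.
have ike : P.-integrable setT (EFin \o (fun t => k * sqrt_exp f t)).
  rewrite (_ : EFin \o _ = (fun t => k%:E * (sqrt_exp f t)%:E)%E).
    exact: integrableZl.
  by apply/funext => t /=; rewrite EFinM.
have ig : P.-integrable setT (EFin \o g).
  apply: le_integrable ike => //; first exact/measurable_EFinP.
  move=> t _ /=; rewrite lee_fin; apply: le_trans (gk t) _.
  exact: ler_norm.
split=> //; apply: le_trans (le_normr_Rintegral _ ig) _ => //.
apply: (@le_trans _ _ (\int[P]_t (k * sqrt_exp f t))%R).
  apply: le_Rintegral => //.
  rewrite (_ : EFin \o _ = (abse \o (EFin \o g))); last by apply/funext.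
  exact: integrable_abse.
rewrite RintegralZl// ler_wpM2l// /Rintegral -lee_fin fineK//.
rewrite ge0_fin_numE; first by apply: le_lt_trans hc _; rewrite ltry.
by apply: integral_ge0 => t _; rewrite lee_fin.
Qed.

Lemma integrable_EFinD f g : P.-integrable setT (EFin \o f) ->
  P.-integrable setT (EFin \o g) -> P.-integrable setT (EFin \o (fun t => f t + g t)).
Proof.
move=> intf intg.
rewrite (_ : EFin \o _ = ((EFin \o f) \+ (EFin \o g))%E); last by apply/funext.
exact: integrableD.
Qed.

Lemma pow_le_sqrt_exp (m u : R) (j : nat) :
  (forall u, 0 <= u -> (1 + u) ^+ 8 <= m * expR (u / 4)) -> 0 <= u -> (j <= 8)%N ->
  u ^+ j <= m * expR (u / 4).
Proof.
move=> hm u0 j8; apply: le_trans (hm u u0).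
have u1 : 1 <= 1 + u by lra.
apply: (@le_trans _ _ ((1 + u) ^+ j)); last by rewrite ler_weXn2l.
by rewrite lerXn2r ?nnegrE//; lra.
Qed.

(** Markov's inequality for [sqrt_exp f]. *)
Lemma tail_moment f (a c2 : R) : measurable_fun setT f -> 0 <= a ->
  (\int[P]_t (sqrt_exp f t)%:E <= c2%:E)%E ->
  fine (P [set t | a < `|f t|]) <= expR (- Num.sqrt a) * c2.
Proof.
move=> mf a0 hc.
have mA : measurable [set t | a < `|f t|].
  rewrite (_ : [set _ | _] = (Num.norm \o f) @^-1` `]a, +oo[).
    rewrite -[X in measurable X]setTI.
    by apply: (measurableT_comp (@measurable_realfun.normr_measurable R setT) mf).
  by apply/seteqP; split => t /=; rewrite in_itv/= andbT.
have [|||_] := @dominated_moment f (\1_[set t | a < `|f t|]) (expR (- Num.sqrt a)) c2 mf _ _ hc.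
- exact: measurable_indic.
- exact: expR_ge0.
- move=> t; rewrite indicE ger0_norm// /sqrt_exp -expRD.
  case: (boolP (a < `|f t|)) => h; last by rewrite memNset ?expR_ge0//=; exact/negP.
  rewrite mem_set//= -[leLHS]expR0 ler_expR addrC subr_ge0.
  by rewrite ler_wsqrtr// ltW.
apply: le_trans; rewrite /Rintegral integral_indic// setIT.
exact: ler_norm.
Qed.

(** [r] is [f] truncated at the level [a] and rounded with mesh [e].  The condition
on [lam] says that tilting by [lam] uses at most three quarters of the exponent
[sqrt |f|]. *)
Section rounded.
Context (f r : T -> R) (a e c2 m lam : R).
Context (mf : measurable_fun setT f) (mr : measurable_fun setT r).
Context (a0 : 0 < a) (e0 : 0 < e) (m1 : 1 <= m) (lam0 : 0 <= lam).
Context (hm : forall u, 0 <= u -> (1 + u) ^+ 8 <= m * expR (u / 4)).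
Context (hc : (\int[P]_t (sqrt_exp f t)%:E <= c2%:E)%E).
Context (rle : forall t, `|r t| <= `|f t|)
  (rclose : forall t, `|f t| <= a -> `|r t - f t| <= e)
  (rout : forall t, a < `|f t| -> r t = 0)
  (hlam : lam * Num.sqrt a <= 3 / 4).

Let u t := Num.sqrt `|f t|.
Let u0 t : 0 <= u t. Proof. exact: sqrtr_ge0. Qed.
Let u2 t : `|f t| = u t ^+ 2. Proof. by rewrite sqr_sqrtr. Qed.
Let m0 : 0 <= m. Proof. exact: le_trans m1. Qed.

Let pow_le j t : (j <= 8)%N -> u t ^+ j <= m * sqrt_exp f t.
Proof.
move=> j8; apply: le_trans (pow_le_sqrt_exp hm (u0 t) j8) _.
by rewrite ler_wpM2l// ler_expR; have := u0 t; rewrite /u; lra.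
Qed.

(** Within the cutoff, [lam * |r| <= 3 / 4 * sqrt |f|]; the remaining quarter of the
exponent absorbs [|f|^3]. *)
Lemma rounded_moment3 :
  `|(\int[P]_t (`|r t| ^+ 3 * expR (lam * `|r t|)))%R| <= m * c2.
Proof.
apply: (@dominated_moment f _ m c2 mf _ m0 hc _).2.
  have mn : measurable_fun setT (fun t => `|r t|).
    exact: (measurableT_comp (@measurable_realfun.normr_measurable R setT) mr).
  apply: measurable_funM; first exact: measurable_funX.
  apply: measurableT_comp => //; exact: measurable_funM.
move=> t; rewrite ger0_norm ?mulr_ge0 ?exprn_ge0 ?expR_ge0//.
have [fa|af] := leP `|f t| a; last first.
  by rewrite rout// normr0 expr0n/= mul0r mulr_ge0// expR_ge0.
have lr : lam * `|r t| <= 3 / 4 * u t.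
  apply: (@le_trans _ _ (lam * (u t * u t))).
    by rewrite ler_wpM2l// -expr2 -u2.
  rewrite mulrA ler_wpM2r//; apply: le_trans hlam.
  by rewrite ler_wpM2l// ler_wsqrtr.
apply: (@le_trans _ _ (u t ^+ 6 * expR (3 / 4 * u t))).
  apply: ler_pM; rewrite ?exprn_ge0 ?expR_ge0 ?ler_expR//.
  have -> : u t ^+ 6 = `|f t| ^+ 3 by rewrite u2 -exprM.
  by rewrite lerXn2r ?nnegrE.
apply: (@le_trans _ _ (m * expR (u t / 4) * expR (3 / 4 * u t))).
  by rewrite ler_wpM2r ?expR_ge0//; exact: pow_le_sqrt_exp.
rewrite -mulrA -expRD /sqrt_exp -/(u t) (_ : u t / 4 + 3 / 4 * u t = u t)//.
by field.
Qed.

Lemma rounded_moment2 : (\int[P]_t (r t ^+ 2))%R <= m * c2.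
Proof.
apply: le_trans (ler_norm _) _.
apply: (@dominated_moment f _ m c2 mf _ m0 hc _).2; first exact: measurable_funX.
move=> t; rewrite normrX; apply: le_trans (@pow_le 4 t isT).
rewrite (_ : u t ^+ 4 = `|f t| ^+ 2); last by rewrite u2 -exprM.
by rewrite lerXn2r ?nnegrE.
Qed.

Let out_le k t : a < `|f t| -> `|f t| ^+ k <= `|f t| ^+ k.+2 / a ^+ 2.
Proof.
move=> af; rewrite ler_pdivlMr ?exprn_gt0// -[k.+2]addn2 exprD ler_wpM2l ?exprn_ge0//.
by rewrite lerXn2r ?nnegrE ?(ltW a0) ?(ltW af).
Qed.

(** As [f] is centered, the mean of [r] is that of [r - f], which is at most [e]
within the cutoff and at most [|f|^3 / a^2] beyond it. *)
Lemma rounded_mean : (\int[P]_t f t)%R = 0 ->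
  `|(\int[P]_t r t)%R| <= e + (a ^+ 2)^-1 * (m * c2).
Proof.
move=> f0.
have intf : P.-integrable setT (EFin \o f).
  apply: (@dominated_moment f f m c2 mf mf m0 hc _).1.
  by move=> t; rewrite u2; exact: pow_le.
have intr : P.-integrable setT (EFin \o r).
  apply: (@dominated_moment f r m c2 mf mr m0 hc _).1.
  by move=> t; apply: le_trans (rle t) _; rewrite u2; exact: pow_le.
have ih : P.-integrable setT (EFin \o (fun t => `|f t| ^+ 3)) /\
   `|(\int[P]_t (`|f t| ^+ 3))%R| <= m * c2.
  apply: (@dominated_moment f _ m c2 mf _ m0 hc _).
    apply: measurable_funX.
    exact: (measurableT_comp (@measurable_realfun.normr_measurable R setT) mf).
  by move=> t; rewrite ger0_norm ?exprn_ge0// u2 -exprM; exact: pow_le.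
have -> : (\int[P]_t r t)%R = (\int[P]_t (r t - f t))%R by rewrite RintegralB// f0 subr0.
have id : P.-integrable setT (EFin \o (fun t => r t - f t)).
  rewrite (_ : EFin \o _ = (EFin \o r) \- (EFin \o f))%E; last by apply/funext.
  exact: integrableB.
apply: le_trans (le_normr_Rintegral _ id) _ => //.
have ie : P.-integrable setT (EFin \o (fun=> e)) by exact: finite_measure_integrable_cst.
have ig : P.-integrable setT (EFin \o (fun t => (a ^+ 2)^-1 * `|f t| ^+ 3)).
  rewrite (_ : EFin \o _ = (fun t => ((a ^+ 2)^-1)%:E * (`|f t| ^+ 3)%:E)%E).
    exact: integrableZl ih.1.
  by apply/funext => t /=; rewrite EFinM.
apply: (@le_trans _ _ (\int[P]_t (e + (a ^+ 2)^-1 * `|f t| ^+ 3))%R).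
  apply: le_Rintegral => //.
  - rewrite (_ : EFin \o _ = (abse \o (EFin \o (fun t => r t - f t)))); last by apply/funext.
    exact: integrable_abse.
  - exact: integrable_EFinD.
  move=> t _; have g0 : 0 <= (a ^+ 2)^-1 * `|f t| ^+ 3.
    by rewrite mulr_ge0 ?invr_ge0 ?exprn_ge0// ltW.
  have [fa|af] := leP `|f t| a; first by have := rclose fa; lra.
  rewrite rout// sub0r normrN.
  by have := @out_le 1 t af; have := e0; rewrite expr1 [_ / _]mulrC; lra.
rewrite RintegralD// Rintegral_cst// RintegralZl//; last exact: ih.1.
rewrite (_ : fine (P setT) = 1); last exact: (congr1 fine (probability_setT P)).
rewrite mulr1 lerD2l ler_wpM2l ?invr_ge0 ?exprn_ge0 ?(ltW a0)//.
exact: le_trans (ler_norm _) ih.2.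
Qed.

Lemma rounded_var :
  `|(\int[P]_t (r t ^+ 2))%R - (\int[P]_t (f t ^+ 2))%R| <= (2 * e + (a ^+ 2)^-1) * (m * c2).
Proof.
have intf : P.-integrable setT (EFin \o (fun t => f t ^+ 2)).
  apply: (@dominated_moment f _ m c2 mf _ m0 hc _).1; first exact: measurable_funX.
  by move=> t; rewrite normrX u2 -exprM; exact: pow_le.
have intr : P.-integrable setT (EFin \o (fun t => r t ^+ 2)).
  apply: (@dominated_moment f _ m c2 mf _ m0 hc _).1; first exact: measurable_funX.
  move=> t; rewrite normrX; apply: le_trans (@pow_le 4 t isT).
  rewrite (_ : u t ^+ 4 = `|f t| ^+ 2); last by rewrite u2 -exprM.
  by rewrite lerXn2r ?nnegrE.
rewrite -RintegralB// mulrA.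
apply: (@dominated_moment f _ ((2 * e + (a ^+ 2)^-1) * m) c2 mf _ _ hc _).2.
- by apply: measurable_funB; exact: measurable_funX.
- by rewrite mulr_ge0// addr_ge0 ?invr_ge0 ?exprn_ge0 ?mulr_ge0 ?(ltW e0) ?(ltW a0).
move=> t; have E0 : 0 <= sqrt_exp f t by exact: expR_ge0.
have i0 : 0 <= (a ^+ 2)^-1 by rewrite invr_ge0 exprn_ge0 ?ltW.
have b1 : 2 * e * `|f t| <= 2 * e * (m * sqrt_exp f t).
  by rewrite ler_wpM2l ?mulr_ge0 ?(ltW e0)// u2; exact: pow_le.
have b2 : (a ^+ 2)^-1 * `|f t| ^+ 4 <= (a ^+ 2)^-1 * (m * sqrt_exp f t).
  by rewrite ler_wpM2l// u2 -exprM; exact: pow_le.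
have p1 : 0 <= 2 * e * `|f t| by rewrite !mulr_ge0 ?(ltW e0).
have p2 : 0 <= (a ^+ 2)^-1 * `|f t| ^+ 4 by rewrite mulr_ge0 ?exprn_ge0.
apply: (@le_trans _ _ (2 * e * `|f t| + (a ^+ 2)^-1 * `|f t| ^+ 4)).
  have [fa|af] := leP `|f t| a.
    rewrite (_ : r t ^+ 2 - f t ^+ 2 = (r t - f t) * (r t + f t)); last by ring.
    rewrite normrM.
    have h1 : `|r t + f t| <= 2 * `|f t|.
      by apply: le_trans (ler_normD _ _) _; have := rle t; lra.
    have : `|r t - f t| * `|r t + f t| <= e * (2 * `|f t|) by apply: ler_pM => //; exact: rclose.
    lra.
  rewrite rout// expr0n/= sub0r normrN normrX.
  by have := @out_le 2 t af; rewrite [_ / _]mulrC; lra.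
lra.
Qed.

End rounded.

End moments.

(** * Scaling of the random variables *)

Section events.
Context {R : realType} {d : measure_display} {T : measurableType d}
  (P : probability T R).

Lemma fine_measureU (A B : set T) : measurable A -> measurable B ->
  fine (P (A `|` B)) <= fine (P A) + fine (P B).
Proof.
move=> mA mB; rewrite -lee_fin EFinD !fineK ?fin_num_measure//; last exact: measurableU.
exact: measureU2.
Qed.

Lemma fine_measure_le (A B : set T) : measurable A -> measurable B ->
  A `<=` B -> fine (P A) <= fine (P B).
Proof.
by move=> mA mB AB; rewrite fine_le ?fin_num_measure// le_measure ?inE.
Qed.

Lemma union_bound (n : nat) (F : 'I_n -> set T) (b : R) :
  (forall i, measurable (F i)) -> (forall i, fine (P (F i)) <= b) ->
  measurable [set t | exists i, F i t] /\ fine (P [set t | exists i, F i t]) <= n%:R * b.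
Proof.
elim: n F => [|n IH] F mF Fb.
  rewrite (_ : [set t | _] = set0); last by apply/seteqP; split => // t [[]].
  by rewrite measure0 mul0r.
have [m1 b1] := IH (fun i => F (lift ord0 i)) (fun i => mF _) (fun i => Fb _).
have e : [set t | exists i, F i t] = F ord0 `|` [set t | exists i, F (lift ord0 i) t].
  apply/seteqP; split => t /=.
    move=> [i]; case: (unliftP ord0 i) => [j ->|->] h; last by left.
    by right; exists j.
  by move=> [h|[j h]]; [exists ord0|exists (lift ord0 j)].
rewrite e; split; first exact: measurableU.
apply: le_trans (fine_measureU (mF _) m1) _.
by rewrite -nat1r mulrDl mul1r; exact: lerD.
Qed.

End events.

Section setting.
Context {R : realType} {d : measure_display} {T : measurableType d}
  {P : probability T R} {n : nat} (X : 'I_n -> {RV P >-> R}).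
Context (c1 c2 t0 : R).
Context (c10 : 0 < c1) (t00 : 0 < t0) (hX : moderate_deviation_hyp X c1 c2 t0).

(** This scaling turns the constant [t0] of the moment condition into 1. *)
Definition scaled_rv i t : R := t0 ^+ 2 * X i t.

Lemma scaled_measurable i : measurable_fun setT (scaled_rv i).
Proof.
apply: measurable_funM; first exact: measurable_cst.
exact: measurable_funP.
Qed.

Lemma scaled_sqrt_exp i : (\int[P]_t (sqrt_exp (scaled_rv i) t)%:E <= c2%:E)%E.
Proof.
have [_ _ _ /(_ i)] := hX; rewrite unlock; apply: le_trans.
rewrite le_eqVlt; apply/orP; left; apply/eqP; apply: eq_integral => t _.
rewrite /sqrt_exp /scaled_rv normrM ger0_norm ?sqr_ge0//.
by rewrite sqrtrM ?sqr_ge0// sqrtr_sqr (gtr0_norm t00).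
Qed.

Lemma scaled_integrable i (k : nat) : (k <= 4)%N ->
  P.-integrable setT (EFin \o (fun t => scaled_rv i t ^+ k)).
Proof.
move=> k4; have [m m1 hm] := expR_moment R.
have m0 : 0 <= m by apply: le_trans m1.
apply: (dominated_moment (c2 := c2) (k := m) (scaled_measurable i) _ m0 (scaled_sqrt_exp i) _).1.
  by apply: measurable_funX; exact: scaled_measurable.
move=> t; rewrite normrX.
have -> : `|scaled_rv i t| ^+ k = Num.sqrt `|scaled_rv i t| ^+ (2 * k).
  by rewrite exprM sqr_sqrtr.
apply: le_trans (pow_le_sqrt_exp hm (sqrtr_ge0 _) _) _; first by rewrite (leq_mul2l 2 k 4).
rewrite ler_wpM2l// ler_expR ler_pdivrMr// ler_peMr ?sqrtr_ge0//.
by rewrite ler1n.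
Qed.

Lemma X_scaled i t : X i t = (t0 ^+ 2)^-1 * scaled_rv i t.
Proof. by rewrite /scaled_rv mulKf// expf_neq0// gt_eqF. Qed.

Lemma scaled_mean i : (\int[P]_t scaled_rv i t)%R = 0.
Proof.
have [_ /(_ i) + _ _] := hX; rewrite unlock => h.
have i1 := @scaled_integrable i 1 isT.
have iX : P.-integrable setT (EFin \o X i).
  rewrite (_ : EFin \o _ = (fun t => ((t0 ^+ 2)^-1)%:E * (scaled_rv i t ^+ 1)%:E)%E).
    exact: integrableZl.
  by apply/funext => t /=; rewrite -EFinM expr1 -X_scaled.
rewrite /scaled_rv RintegralZl// /Rintegral.
by rewrite (_ : (\int[P]_x (X i x)%:E = 0)%E) ?mulr0.
Qed.

Definition scaled_var i : R := (\int[P]_t (scaled_rv i t ^+ 2))%R.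

Lemma sum_sq_momentsE :
  sum_sq_moments X = ((t0 ^+ 4)^-1 * \sum_i scaled_var i)%:E.
Proof.
rewrite /sum_sq_moments mulr_sumr -sumEFin; apply: eq_bigr => i _.
rewrite unlock.
have i2 := @scaled_integrable i 2 isT.
transitivity (\int[P]_t (((t0 ^+ 4)^-1)%:E * (scaled_rv i t ^+ 2)%:E))%E.
  apply: eq_integral => t _; rewrite -EFinM; congr EFin.
  rewrite {1}X_scaled; field.
  by rewrite gt_eqF.
rewrite integralZl// EFinM /scaled_var /Rintegral fineK//.
exact: integrable_fin_num.
Qed.

Definition scaled_norm : R := t0 ^+ 2 * B_norm X.

Lemma scaled_norm_sqr : scaled_norm ^+ 2 = \sum_i scaled_var i.
Proof.
have v0 i : 0 <= scaled_var i.
  by apply: Rintegral_ge0 => t _; exact: sqr_ge0.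
rewrite /scaled_norm /B_norm sum_sq_momentsE/= exprMn sqr_sqrtr; last first.
  by rewrite mulr_ge0 ?invr_ge0 ?exprn_ge0 ?(ltW t00)// sumr_ge0.
by rewrite -exprM mulrA mulfV ?mul1r// expf_neq0// gt_eqF.
Qed.

Lemma scaled_norm_ge : (c1 * t0 ^+ 2) * Num.sqrt n%:R <= scaled_norm.
Proof.
have [_ _ + _] := hX; rewrite sum_sq_momentsE lee_fin => h.
have t20 : 0 < t0 ^+ 2 by rewrite exprn_gt0.
rewrite /scaled_norm (mulrC c1) -mulrA ler_wpM2l ?(ltW t20)//.
rewrite /B_norm sum_sq_momentsE/=; apply: le_trans (ler_wsqrtr h).
by rewrite sqrtrM ?sqr_ge0// sqrtr_sqr (gtr0_norm c10).
Qed.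

End setting.

(** * Truncation and rounding of the sum *)

(** Here [q] stands for n^(1/6), so that [e = 1 / sqrt n], and [kap ^+ 3 = c1 * t0 ^+ 2]
makes [x <= kap * q] the range of the theorem.  The variables are truncated at
[a = s ^+ 2] and rounded with mesh [e ^+ 2 = 1 / n]; [y i] is the contribution of a
code of the [i]-th variable to the normalised sum. *)
Section discretisation.
Context {R : realType} {d : measure_display} {T : measurableType d}
  {P : probability T R} {n : nat} (X : 'I_n -> {RV P >-> R}).
Context (c1 c2 t0 kap q m A x : R).
Context (n0 : (0 < n)%N) (c10 : 0 < c1) (t00 : 0 < t0) (hX : moderate_deviation_hyp X c1 c2 t0).
Context (kap0 : 0 < kap) (kap3 : kap ^+ 3 = c1 * t0 ^+ 2) (q1 : 1 <= q) (q6 : q ^+ 6 = n%:R).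
Context (m1 : 1 <= m) (hm : forall u, 0 <= u -> (1 + u) ^+ 8 <= m * expR (u / 4)).
Context (x0 : 0 <= x) (xq : x <= kap * q).
Let e : R := (q ^+ 3)^-1.
Let s : R := 3 / 4 * kap ^+ 2 * q ^+ 2.
Let a : R := s ^+ 2.
Let D : R := ((3 / 4 * kap ^+ 2) ^+ 4)^-1.
Let B := scaled_norm X t0.
Let N := Num.bound (a / e ^+ 2).
Let c (z : R) := qcode N a (e ^+ 2) (t0 ^+ 2 * z).
Let f i t := scaled_rv X t0 i t.
Let r i t := qval (e ^+ 2) (c (X i t)).
Let p := code_law X c.
Let y (i : 'I_n) (v : 'I_N.+1 * bool) := B^-1 * qval (e ^+ 2) v.

Lemma q_gt0 : 0 < q. Proof. exact: lt_le_trans q1. Qed.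
Lemma e_gt0 : 0 < e. Proof. by rewrite invr_gt0 exprn_gt0// q_gt0. Qed.
Lemma s_gt0 : 0 < s.
Proof. by rewrite !mulr_gt0 ?invr_gt0 ?exprn_gt0 ?q_gt0. Qed.
Lemma a_gt0 : 0 < a. Proof. by rewrite exprn_gt0// s_gt0. Qed.

Lemma mesh_card : n%:R * e ^+ 2 = 1.
Proof.
rewrite -q6 /e exprVn -exprM mulfV// expf_neq0// gt_eqF//; exact: q_gt0.
Qed.

Lemma cutoff_lt : a < N.+1%:R * e ^+ 2.
Proof.
have e20 : 0 < e ^+ 2 by rewrite exprn_gt0// e_gt0.
rewrite -ltr_pdivrMr//; apply: lt_le_trans (archi_boundP _) _.
  by rewrite divr_ge0 ?(ltW a_gt0) ?(ltW e20).
by rewrite ler_nat.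
Qed.

(** The hypothesis [B_n ^+ 2 >= c1 ^+ 2 * n] in terms of [kap] and [e]. *)
Lemma norm_mesh_ge : kap ^+ 3 <= B * e.
Proof.
have q0 := q_gt0; have q30 : 0 < q ^+ 3 by rewrite exprn_gt0.
rewrite ler_pdivlMr// kap3.
have -> : q ^+ 3 = Num.sqrt n%:R.
  by rewrite -q6 (exprM q 3 2) sqrtr_sqr ger0_norm// ltW.
exact: (scaled_norm_ge c10 t00 hX).
Qed.

Lemma norm_gt0 : 0 < B.
Proof.
have := norm_mesh_ge; have k3 : 0 < kap ^+ 3 by rewrite exprn_gt0.
by move=> /(lt_le_trans k3); rewrite pmulr_lgt0// e_gt0.
Qed.

Lemma norm_inv_le : B^-1 <= (kap ^+ 3)^-1 * e.
Proof.
have k3 : 0 < kap ^+ 3 by rewrite exprn_gt0.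
by rewrite ler_pdivlMl// ler_pdivrMr ?norm_gt0// mulrC norm_mesh_ge.
Qed.

Lemma norm_inv_pow_le k : B^-1 ^+ k <= ((kap ^+ 3)^-1 * e) ^+ k.
Proof.
have b0 : 0 <= B^-1 by rewrite invr_ge0 ltW// norm_gt0.
by rewrite lerXn2r ?nnegrE ?norm_inv_le// (le_trans b0 norm_inv_le).
Qed.

(** [a ^+ 2] is of order [q ^+ 8], whereas [q ^+ 6 = n] would be enough to make the
truncation error [O(1 / n)]. *)
Lemma cutoff_inv_le : (a ^+ 2)^-1 <= D * e ^+ 2.
Proof.
have q0 := q_gt0; have e20 : 0 < e ^+ 2 by rewrite exprn_gt0// e_gt0.
have D0 : 0 < D by rewrite invr_gt0 exprn_gt0// !mulr_gt0 ?invr_gt0 ?exprn_gt0.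
have -> : (a ^+ 2)^-1 = D * (q ^+ 8)^-1.
  rewrite /D /a /s -invfM; congr (_^-1); ring.
rewrite ler_pM2l// /e exprVn -exprM lef_pV2 ?posrE ?exprn_gt0//.
by rewrite ler_weXn2l.
Qed.

(** Since [B] is at least [kap ^+ 3 * q ^+ 3], the tilt [x / B] is at most
[1 / (kap ^+ 2 * q ^+ 2)]; the level [s] was chosen for this. *)
Lemma lam_bound : x / B * Num.sqrt a <= 3 / 4.
Proof.
have q0 := q_gt0; have B0 := norm_gt0; have k3 : 0 < kap ^+ 3 by rewrite exprn_gt0.
rewrite sqrtr_sqr (gtr0_norm s_gt0) mulrAC ler_pdivrMr//.
apply: (@le_trans _ _ (3 / 4 * (kap ^+ 3 * q ^+ 3))).
  rewrite (_ : 3 / 4 * _ = kap * q * s); last by rewrite /s; ring.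
  by rewrite ler_wpM2r// ltW// s_gt0.
rewrite ler_wpM2l ?divr_ge0// -ler_pdivlMr ?exprn_gt0//.
exact: norm_mesh_ge.
Qed.

Lemma code_measurable v : measurable (c @^-1` [set v]).
Proof.
have e20 : 0 < e ^+ 2 by rewrite exprn_gt0// e_gt0.
rewrite (_ : c @^-1` [set v] = ( *%R (t0 ^+ 2)) @^-1` (qcode N a (e ^+ 2) @^-1` [set v]))//.
have mt : measurable_fun setT ( *%R (t0 ^+ 2) : R -> R) by exact: mulrl_measurable.
rewrite -[X in measurable X]setTI; apply: mt => //.
exact: qcode_measurable e20 cutoff_lt.
Qed.

Let mXc i v : measurable ((c \o X i) @^-1` [set v]).
Proof.
have h : measurable (X i @^-1` (c @^-1` [set v])).
  by rewrite -[X in measurable X]setTI; apply: measurable_funP => //; exact: code_measurable.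
exact: h.
Qed.

Lemma rounded_measurable i : measurable_fun setT (r i).
Proof.
have [/integrableP[+ _] _] := coded_integral P (fun v => qval (e ^+ 2) v) (mXc i).
by move=> /measurable_EFinP.
Qed.

Lemma rounded_le i t : `|r i t| <= `|f i t|.
Proof. by apply: qval_le; [rewrite exprn_gt0// e_gt0|exact: cutoff_lt]. Qed.

Lemma rounded_close i t : `|f i t| <= a -> `|r i t - f i t| <= e ^+ 2.
Proof. by apply: qval_close; [rewrite exprn_gt0// e_gt0|exact: cutoff_lt]. Qed.

Lemma rounded_out i t : a < `|f i t| -> r i t = 0.
Proof. exact: qval_out. Qed.

Lemma rounded_law_prob : is_prob p. Proof. exact: (code_law_prob X code_measurable). Qed.

Lemma rounded_law_E1 i g : E1 p i g = (\int[P]_t g (c (X i t)))%R.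
Proof. exact: (code_law_E1 X code_measurable). Qed.

Let e20 : 0 < e ^+ 2. Proof. by rewrite exprn_gt0// e_gt0. Qed.
Let lam0 : 0 <= x / B. Proof. by rewrite divr_ge0// ltW// norm_gt0. Qed.
Let mf i := scaled_measurable X t0 i.
Let hc i := scaled_sqrt_exp t00 hX i.

Lemma y_moment3 i : m * c2 * (kap ^+ 9)^-1 <= A ->
  E1 p i (fun v => `|y i v| ^+ 3 * expR (x * `|y i v|)) <= A * e ^+ 3.
Proof.
move=> hA; have B0 := norm_gt0; have e0 := e_gt0.
have h := rounded_moment3 (mf i) (rounded_measurable i) m1 lam0 hm (hc i)
   (rounded_le i) (@rounded_out i) lam_bound.
have -> : E1 p i (fun v => `|y i v| ^+ 3 * expR (x * `|y i v|)) =
   B^-1 ^+ 3 * E1 p i (fun v => `|qval (e ^+ 2) v| ^+ 3 * expR (x / B * `|qval (e ^+ 2) v|)).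
  rewrite -E1Z; apply: eq_E1 => v.
  by rewrite /y normrM (gtr0_norm (x := B^-1)) ?invr_gt0// exprMn !mulrA.
rewrite rounded_law_E1.
have {h} := le_trans (ler_norm _) h.
set J := (X in X <= _) => h.
have mc0 : 0 <= m * c2 by apply: le_trans h; apply: Rintegral_ge0 => t _; rewrite mulr_ge0 ?expR_ge0 ?exprn_ge0.
apply: (@le_trans _ _ (((kap ^+ 3)^-1 * e) ^+ 3 * (m * c2))).
  apply: ler_pM => //; rewrite ?exprn_ge0 ?invr_ge0 ?(ltW B0)//.
    by apply: Rintegral_ge0 => t _; rewrite mulr_ge0 ?expR_ge0 ?exprn_ge0.
  exact: norm_inv_pow_le.
rewrite (_ : ((kap ^+ 3)^-1 * e) ^+ 3 * (m * c2) = m * c2 * (kap ^+ 9)^-1 * e ^+ 3).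
  by rewrite ler_wpM2r// exprn_ge0// ltW.
by rewrite exprMn exprVn -exprM mulrC mulrA.
Qed.

Lemma moment_bound_ge0 : 0 <= m * c2.
Proof.
have := rounded_moment2 (mf (Ordinal n0)) (rounded_measurable (Ordinal n0)) m1 hm (hc (Ordinal n0))
  (rounded_le (Ordinal n0)).
by apply: le_trans; apply: Rintegral_ge0 => t _; exact: sqr_ge0.
Qed.

Lemma rounded_sqr i : E1 p i (fun v => y i v ^+ 2) = B^-1 ^+ 2 * (\int[P]_t (r i t ^+ 2))%R.
Proof.
have -> : (\int[P]_t (r i t ^+ 2))%R = E1 p i (fun v => qval (e ^+ 2) v ^+ 2).
  by rewrite rounded_law_E1.
by rewrite -E1Z; apply: eq_E1 => v; rewrite /y exprMn.
Qed.

Lemma y_moment2 i : m * c2 * (kap ^+ 6)^-1 <= A ->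
  E1 p i (fun v => y i v ^+ 2) <= A * e ^+ 2.
Proof.
move=> hA; have B0 := norm_gt0; have e0 := e_gt0; rewrite rounded_sqr.
have h := rounded_moment2 (mf i) (rounded_measurable i) m1 hm (hc i) (rounded_le i).
apply: (@le_trans _ _ (((kap ^+ 3)^-1 * e) ^+ 2 * (m * c2))).
  apply: ler_pM => //; rewrite ?exprn_ge0 ?invr_ge0 ?(ltW B0)//.
    by apply: Rintegral_ge0 => t _; exact: sqr_ge0.
  exact: norm_inv_pow_le.
rewrite (_ : ((kap ^+ 3)^-1 * e) ^+ 2 * (m * c2) = m * c2 * (kap ^+ 6)^-1 * e ^+ 2).
  by rewrite ler_wpM2r// exprn_ge0// ltW.
by rewrite exprMn exprVn -exprM mulrC mulrA.
Qed.

Lemma y_mean i : (kap ^+ 3)^-1 * (1 + D * (m * c2)) <= A ->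
  `|E1 p i (y i)| <= A * e ^+ 3.
Proof.
move=> hA; have B0 := norm_gt0; have e0 := e_gt0.
have h := rounded_mean (mf i) (rounded_measurable i) a_gt0 e20 m1 hm (hc i) (rounded_le i) (@rounded_close i)
  (@rounded_out i) (scaled_mean t00 hX i).
rewrite E1Z rounded_law_E1 normrM (gtr0_norm (x := B^-1)) ?invr_gt0//.
have h2 : (a ^+ 2)^-1 * (m * c2) <= D * e ^+ 2 * (m * c2).
  by rewrite ler_wpM2r ?moment_bound_ge0// cutoff_inv_le.
apply: (@le_trans _ _ (((kap ^+ 3)^-1 * e) * (e ^+ 2 + D * e ^+ 2 * (m * c2)))).
  apply: ler_pM => //; first by rewrite invr_ge0 ltW.
    exact: norm_inv_le.
  by apply: (le_trans h); rewrite lerD2l.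
rewrite (_ : (kap ^+ 3)^-1 * e * (e ^+ 2 + D * e ^+ 2 * (m * c2)) = (kap ^+ 3)^-1 * (1 + D * (m * c2)) * e ^+ 3); last by ring.
by rewrite ler_wpM2r// exprn_ge0// ltW.
Qed.

Lemma y_var : (kap ^+ 6)^-1 * ((2 + D) * (m * c2)) <= A ->
  `|\sum_i E1 p i (fun v => y i v ^+ 2) - 1| <= A * e ^+ 2.
Proof.
move=> hA; have B0 := norm_gt0; have e0 := e_gt0.
have BV : 1 = B^-1 ^+ 2 * \sum_i scaled_var X t0 i.
  rewrite -(scaled_norm_sqr t00 hX) -/B -exprMn mulVf ?expr1n//.
  by rewrite gt_eqF.
rewrite {1}BV mulr_sumr -sumrB.
have key i : `|E1 p i (fun v => y i v ^+ 2) - B^-1 ^+ 2 * scaled_var X t0 i|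
    <= ((kap ^+ 3)^-1 * e) ^+ 2 * ((2 + D) * e ^+ 2 * (m * c2)).
  rewrite rounded_sqr -mulrBr normrM ger0_norm ?exprn_ge0 ?invr_ge0 ?(ltW B0)//.
  have h := rounded_var (mf i) (rounded_measurable i) a_gt0 e20 m1 hm (hc i) (rounded_le i) (@rounded_close i) (@rounded_out i).
  apply: ler_pM => //; rewrite ?exprn_ge0 ?invr_ge0 ?(ltW B0)//.
    exact: norm_inv_pow_le.
  apply: (le_trans h); rewrite ler_wpM2r ?moment_bound_ge0// [leRHS]mulrDl lerD2l.
  exact: cutoff_inv_le.
apply: le_trans (ler_norm_sum _ _ _) _.
apply: le_trans (ler_sum _ (fun i _ => key i)) _.
rewrite sumr_const card_ord -[leLHS]mulr_natl.
rewrite (_ : n%:R * (((kap ^+ 3)^-1 * e) ^+ 2 * ((2 + D) * e ^+ 2 * (m * c2))) = (n%:R * e ^+ 2) * ((kap ^+ 6)^-1 * ((2 + D) * (m * c2)) * e ^+ 2)).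
  by rewrite mesh_card mul1r ler_wpM2r// ltW.
by rewrite exprMn exprVn -exprM; ring.
Qed.

Let bad := [set t | exists i, a < `|f i t|].
Let S t : R := partial_sum X t / B_norm X.

Lemma bad_prob : measurable bad /\ fine (P bad) <= n%:R * (expR (- s) * c2).
Proof.
apply: (union_bound (F := fun i => [set t | a < `|f i t|])) => i.
  rewrite (_ : [set _ | _] = (Num.norm \o f i) @^-1` `]a, +oo[).
    rewrite -[X in measurable X]setTI.
    by apply: (measurableT_comp (@normr_measurable R setT) (mf i)).
  by apply/seteqP; split => t /=; rewrite in_itv/= andbT.
rewrite (_ : s = Num.sqrt a); last by rewrite sqrtr_sqr gtr0_norm// s_gt0.
exact: tail_moment (mf i) (ltW a_gt0) (hc i).
Qed.

(** If nothing is truncated, [n] rounding errors at most [1 / n] move the sum by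
at most 1. *)
Lemma sumv_close t : ~ bad t -> `|sumv y [ffun i => c (X i t)] - S t| <= B^-1.
Proof.
move=> nb; have B0 := norm_gt0.
have fa i : `|f i t| <= a.
  by rewrite leNgt; apply/negP => h; apply: nb; exists i.
have -> : S t = B^-1 * \sum_i f i t.
  rewrite /S /partial_sum /B /scaled_norm /f /scaled_rv -mulr_sumr.
  rewrite invfM mulrACA mulVf ?mul1r; first by rewrite mulrC.
  by rewrite expf_neq0// gt_eqF.
have -> : sumv y [ffun i => c (X i t)] = B^-1 * \sum_i r i t.
  by rewrite /sumv /y mulr_sumr; apply: eq_bigr => i _; rewrite ffunE.
rewrite -mulrBr normrM gtr0_norm ?invr_gt0// -[leRHS]mulr1 ler_wpM2l ?invr_ge0 ?(ltW B0)//.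
rewrite -sumrB; apply: le_trans (ler_norm_sum _ _ _) _.
apply: le_trans (ler_sum _ (fun i _ => rounded_close (fa i))) _.
by rewrite sumr_const card_ord -[leLHS]mulr_natl mesh_card.
Qed.

Lemma tail_event_measurable : measurable [set t | x <= S t].
Proof.
rewrite (_ : [set _ | _] = S @^-1` `[x, +oo[).
  rewrite -[X in measurable X]setTI; suff: measurable_fun setT S by exact.
  apply: measurable_funM => //.
  by apply: measurable_sum => i; exact: measurable_funP.
by apply/seteqP; split => t /=; rewrite in_itv/= andbT.
Qed.

(** Off the event [bad] the rounded sum is within [B^-1] of the original one. *)
Lemma tail_sandwich :
  fine (P [set t | x <= S t]) <=
    Ex p (fun w => (x - B^-1 <= sumv y w)%R%:R) + fine (P bad) /\
  Ex p (fun w => (x + B^-1 <= sumv y w)%R%:R) <= fine (P [set t | x <= S t]) + fine (P bad).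
Proof.
have [mb _] := bad_prob; have mS := tail_event_measurable.
have [indX _ _ _] := hX.
have ev u := code_event_measurable X code_measurable (fun w => u <= sumv y w).
have law u := code_law_Ex code_measurable (fun w => u <= sumv y w) indX.
have cl t : ~ bad t -> S t - B^-1 <= sumv y [ffun i => c (X i t)] <= S t + B^-1.
  by move=> /sumv_close; rewrite ler_distl.
rewrite -!law; split.
  apply: le_trans (fine_measureU P (ev _) mb).
  apply: fine_measure_le => //; first exact: measurableU.
  move=> t /= xS; have [b|nb] := pselect (bad t); [by right|left].
  by have /andP[h _] := cl _ nb; lra.
apply: le_trans (fine_measureU P mS mb).
apply: fine_measure_le => //; first exact: measurableU.
move=> t /= xS; have [b|nb] := pselect (bad t); [by right|left].
by have /andP[_ h] := cl _ nb; lra.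
Qed.

(** With [u = kap ^+ 2 * q ^+ 2], [s = u / 2 + u / 4].  The first half of the
exponent gives [expR (- (x ^+ 2 / 2))], comparable to [gtail x]; the rest beats the
powers of [q]. *)
Lemma bad_small :
  fine (P bad) <= 3 * (1 + kap) * (m * c2) * (kap ^+ 10)^-1 * e * gtail x.
Proof.
have [_ h] := bad_prob; apply: (le_trans h).
have q0 := q_gt0; have k0 := kap0; have e0 := e_gt0; have q1' := q1; have xq' := xq; have x0' := x0.
have c20 : 0 <= c2 by rewrite -(pmulr_rge0 _ (lt_le_trans ltr01 m1)) moment_bound_ge0.
have T0 := gtail_gt0 x.
pose u := kap ^+ 2 * q ^+ 2.
have u0 : 0 < u by rewrite mulr_gt0 ?exprn_gt0.
have h1 : q ^+ 10 * expR (- (u / 4)) <= m * (kap ^+ 10)^-1.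
  rewrite expRN ler_pdivrMr ?expR_gt0// mulrAC ler_pdivlMr ?exprn_gt0//.
  have -> : q ^+ 10 * kap ^+ 10 = u ^+ 5 by rewrite /u exprMn -!exprM mulrC.
  apply: (le_trans _ (hm (ltW u0))).
  apply: (@le_trans _ _ ((1 + u) ^+ 5)); first by rewrite lerXn2r ?nnegrE ?(ltW u0) ?lerDr// addr_ge0// ltW.
  by rewrite ler_weXn2l// lerDl ltW.
have h2 : expR (- s) <= expR (- (u / 4)) * (3 * ((1 + kap) * q * gtail x)).
  have -> : - s = - (u / 4) + - (u / 2) by rewrite /s /u; field.
  rewrite expRD ler_wpM2l ?expR_ge0//.
  apply: (@le_trans _ _ (expR (- (x ^+ 2 / 2)))).
    rewrite ler_expR lerN2 ler_wpM2r ?invr_ge0// /u -exprMn lerXn2r ?nnegrE//.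
    exact: (le_trans x0 xq).
  apply: le_trans (gtail_ge_expR x0) _.
  rewrite ler_wpM2l// ler_wpM2r ?(ltW T0)//.
  rewrite mulrDl mul1r; lra.
rewrite -q6.
apply: (@le_trans _ _ (q ^+ 6 * (expR (- (u / 4)) * (3 * ((1 + kap) * q * gtail x)) * c2))).
  by rewrite ler_wpM2l ?exprn_ge0 ?(ltW q0)// ler_wpM2r.
have -> : q ^+ 6 * (expR (- (u / 4)) * (3 * ((1 + kap) * q * gtail x)) * c2) =
  (q ^+ 10 * expR (- (u / 4))) * (3 * (1 + kap) * c2 * e * gtail x).
  by rewrite /e; field; rewrite gt_eqF.
apply: (le_trans (ler_wpM2r _ h1)).
  by rewrite !mulr_ge0 ?(ltW T0) ?(ltW e0)// addr_ge0// ltW.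
rewrite le_eqVlt; apply/orP; left; apply/eqP; ring.
Qed.

(** The hypothesis on [C] is the conclusion of [tilted_estimate] for this [A]: as the
constant must not depend on the probability space, it is fixed beforehand. *)
Lemma tail_close C : 1 <= A ->
  (forall (I V : finType) (p y : I -> V -> R) (x e u0 : R), is_prob p ->
     #|I|%:R * e ^+ 2 = 1 ->
     (forall i, E1 p i (fun v => `|y i v| ^+ 3 * expR (x * `|y i v|)) <= A * e ^+ 3) ->
     (forall i, E1 p i (fun v => y i v ^+ 2) <= A * e ^+ 2) ->
     (forall i, `|E1 p i (y i)| <= A * e ^+ 3) ->
     `|\sum_i E1 p i (fun v => y i v ^+ 2) - 1| <= A * e ^+ 2 ->
     x ^+ 3 * e <= A -> 100 * A ^+ 2 * ((1 + x) * e) <= 1 -> 0 <= x -> 0 < e ->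
     `|u0 - x| <= A * e ->
     `|Ex p (fun w => (u0 <= sumv y w)%R%:R) - gtail x| <= C * ((1 + x ^+ 3) * e) * gtail x) ->
  m * c2 * (kap ^+ 9)^-1 <= A -> m * c2 * (kap ^+ 6)^-1 <= A ->
  (kap ^+ 3)^-1 * (1 + D * (m * c2)) <= A -> (kap ^+ 6)^-1 * ((2 + D) * (m * c2)) <= A ->
  (kap ^+ 3)^-1 <= A -> kap ^+ 3 <= A -> 100 * A ^+ 2 * ((1 + x) * e) <= 1 ->
  `|fine (P [set t | x <= S t]) - gtail x| <=
    C * ((1 + x ^+ 3) * e) * gtail x +
    3 * (1 + kap) * (m * c2) * (kap ^+ 10)^-1 * e * gtail x.
Proof.
move=> A1 est h3 h2 hmu hv hB hk small.
have e0 := e_gt0; have B0 := norm_gt0; have q0 := q_gt0; have hb := bad_small.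
have card : #|'I_n|%:R * e ^+ 2 = 1 by rewrite card_ord mesh_card.
have xe : x ^+ 3 * e <= A.
  apply: (le_trans _ hk); rewrite /e ler_pdivrMr ?exprn_gt0// -exprMn.
  by rewrite lerXn2r ?nnegrE// (le_trans x0 xq).
have BA : B^-1 <= A * e.
  by apply: (le_trans norm_inv_le); rewrite ler_wpM2r// ltW.
have E u : `|u - x| <= A * e ->
    `|Ex p (fun w => (u <= sumv y w)%R%:R) - gtail x| <= C * ((1 + x ^+ 3) * e) * gtail x.
  move=> hu; apply: est rounded_law_prob card _ _ _ _ xe small x0 e0 hu.
  - by move=> i; exact: y_moment3.
  - by move=> i; exact: y_moment2.
  - by move=> i; exact: y_mean.
  - exact: y_var.
have b0 : 0 <= B^-1 by rewrite invr_ge0 ltW.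
have Ep : `|x + B^-1 - x| <= A * e.
  by rewrite (_ : x + B^-1 - x = B^-1) ?ger0_norm//; ring.
have Em : `|x - B^-1 - x| <= A * e.
  by rewrite (_ : x - B^-1 - x = - B^-1) ?normrN ?ger0_norm//; ring.
move/E : Ep => Ep; move/E : Em => Em.
have [Sl Su] := tail_sandwich.
move: Sl Su Ep Em hb; rewrite !ler_norml.
set a1 := Ex _ _; set a2 := Ex _ _; set a3 := fine _; set a4 := fine _.
set a5 := C * _ * _; set a6 := 3 * _ * _ * _ * _ * _.
move: a1 a2 a3 a4 a5 a6 (gtail x) => a1 a2 a3 a4 a5 a6 g.
move=> Sl Su /andP[? ?] /andP[? ?] ?; apply/andP; split; lra.
Qed.

End discretisation.

(** * The uniform bound and its limit form *)

Lemma powR_invnK {R : realType} (a : R) k : 0 <= a -> (a `^ (k.+1%:R^-1)) ^+ k.+1 = a.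
Proof.
by move=> a0; rewrite -powR_mulrn ?powR_ge0// -powRrM mulVf ?powRr1// pnatr_eq0.
Qed.

Lemma ratio_close {R : realType} (p T b : R) : 0 < T -> `|p - T| <= b * T -> `|p / T - 1| <= b.
Proof.
move=> T0 h; rewrite -[1](mulfV (lt0r_neq0 T0)) -mulrBl normrM [`|T^-1|]gtr0_norm ?invr_gt0//.
by rewrite ler_pdivrMr.
Qed.

Lemma ratio_crude {R : realType} (p T T0 : R) : 0 < T0 -> T0 <= T -> T <= 1 -> 0 <= p <= 1 ->
  `|p / T - 1| <= T0^-1.
Proof.
move=> T00 hT T1 /andP[p0 p1]; have Tp : 0 < T by exact: lt_le_trans hT.
apply: (@le_trans _ _ T^-1); last by rewrite lef_pV2 ?posrE.
apply: ratio_close => //; rewrite mulVf ?gt_eqF// ler_norml; apply/andP; split; lra.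
Qed.

(** If [(1 + x) * e] is small, [tail_close] applies.  Otherwise [q ^+ 2 <= Q0] with [Q0]
depending on [c2] and [K] only; then [x] is bounded, so [gtail x] is bounded below,
and [e] is bounded below as well, so that any bounded ratio is [O(e)]. *)
Lemma moderate_deviation_bound {R : realType} (c2 K : R) : 0 < c2 -> 0 < K ->
  exists C : R, forall (d : measure_display) (T : measurableType d) (P : probability T R)
      (n : nat) (X : 'I_n -> {RV P >-> R}) (c1 t0 : R),
    (0 < n)%N -> 0 < c1 -> 0 < t0 -> c1 * t0 ^+ 2 = K ->
    moderate_deviation_hyp X c1 c2 t0 ->
    forall x, 0 <= x <= K `^ (3%:R^-1) * n%:R `^ (6%:R^-1) ->
    `|tail_ratio X x - 1| <= C * ((1 + x ^+ 3) / Num.sqrt n%:R).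
Proof.
move=> c20 K0.
pose kap := K `^ (3%:R^-1).
have k0 : 0 < kap by rewrite powR_gt0.
have k3 : kap ^+ 3 = K by rewrite powR_invnK// ltW.
have [m m1 hm] := expR_moment R.
have M0 : 0 <= m * c2 by rewrite mulr_ge0 ?(ltW c20)// (le_trans ler01 m1).
pose D := ((3 / 4 * kap ^+ 2) ^+ 4)^-1.
have kX i : 0 <= (kap ^+ i)^-1 by rewrite invr_ge0 exprn_ge0// ltW.
have D0 : 0 <= D by rewrite invr_ge0 exprn_ge0// !mulr_ge0 ?invr_ge0 ?exprn_ge0// ltW.
pose a1 := m * c2 * (kap ^+ 9)^-1.
pose a2 := m * c2 * (kap ^+ 6)^-1.
pose a3 := (kap ^+ 3)^-1 * (1 + D * (m * c2)).
pose a4 := (kap ^+ 6)^-1 * ((2 + D) * (m * c2)).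
pose a5 := (kap ^+ 3)^-1.
have a10 : 0 <= a1 by rewrite mulr_ge0.
have a20 : 0 <= a2 by rewrite mulr_ge0.
have a30 : 0 <= a3 by rewrite mulr_ge0// addr_ge0// mulr_ge0.
have a40 : 0 <= a4 by rewrite mulr_ge0// mulr_ge0// addr_ge0.
have a50 : 0 <= a5 := kX 3%N.
have [A [A1 [A2 [A3 [A4 [A5 [A6 A7]]]]]]] : exists A, 1 <= A /\ a1 <= A /\ a2 <= A /\ a3 <= A /\
    a4 <= A /\ a5 <= A /\ kap ^+ 3 <= A.
  exists (1 + K + a1 + a2 + a3 + a4 + a5); rewrite k3.
  by do !split; lra.
have [C0 [C00 est]] := tilted_estimate A1.
pose C1 := 3 * (1 + kap) * (m * c2) * (kap ^+ 10)^-1.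
have k10 : 0 <= 1 + kap by rewrite addr_ge0 ?(ltW k0).
have C10 : 0 <= C1.
  by rewrite /C1 (mulr_ge0 (mulr_ge0 (mulr_ge0 _ k10) M0)).
have B0 : 0 < 100 * A ^+ 2 by rewrite mulr_gt0// exprn_gt0// (lt_le_trans ltr01 A1).
(* The threshold of the small regime, kept opaque. *)
have [B Beq] : exists B, B = 100 * A ^+ 2 by exists (100 * A ^+ 2).
rewrite -Beq in B0.
pose Q0 := B * (1 + kap).
have Q00 : 0 < Q0 by rewrite mulr_gt0// addr_gt0.
pose T0 := gtail (kap * Q0).
have T00 : 0 < T0 by exact: gtail_gt0.
pose C2 := Q0 ^+ 3 / T0.
have C20 : 0 <= C2 by rewrite divr_ge0 ?exprn_ge0 ?(ltW Q00) ?(ltW T00).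
exists (C0 + C1 + C2) => d T P n X c1 t0 n0 c10 t00 hK hX x /andP[x0 xq].
pose q : R := n%:R `^ (6%:R^-1).
rewrite -/kap -/q in xq.
have q6 : q ^+ 6 = n%:R by rewrite powR_invnK.
have n1 : (1 : R) <= n%:R by rewrite ler1n.
have q1 : 1 <= q by rewrite -(powRr0 (n%:R : R)) ler_powR// invr_ge0.
have q0 : 0 < q := lt_le_trans ltr01 q1.
have -> : Num.sqrt n%:R = q ^+ 3.
  by rewrite -q6 (exprM q 3 2) sqrtr_sqr ger0_norm// exprn_ge0// ltW.
have e0 : 0 < (q ^+ 3)^-1 by rewrite invr_gt0 exprn_gt0.
have x30 : 0 <= x ^+ 3 by rewrite exprn_ge0.
have Tx0 := gtail_gt0 x.
have kc : kap ^+ 3 = c1 * t0 ^+ 2 by rewrite hK.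
rewrite /tail_ratio -/(gtail x).
have xe0 : 0 <= x ^+ 3 * (q ^+ 3)^-1 by rewrite mulr_ge0// ltW.
have [small|large] := leP (B * ((1 + x) * (q ^+ 3)^-1)) 1.
  apply: ratio_close => //.
  rewrite Beq in small.
  have h := tail_close n0 c10 t00 hX k0 kc q1 q6 m1 hm x0 xq A1 est A2 A3 A4 A5 A6 A7 small.
  apply: (le_trans h); rewrite -/C1 -mulrDl ler_wpM2r ?(ltW Tx0)//.
  rewrite mulrDl mul1r.
  have := mulr_ge0 C10 xe0; have := mulr_ge0 C20 (ltW e0); have := mulr_ge0 C20 xe0.
  move: (q ^+ 3)^-1 (x ^+ 3) => e z; lra.
have qQ : q ^+ 2 <= Q0.
  have : 1 <= B * ((1 + kap) * q * (q ^+ 3)^-1).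
    apply: (le_trans (ltW large)); rewrite ler_wpM2l ?(ltW B0)// ler_wpM2r ?(ltW e0)//.
    by rewrite mulrDl mul1r lerD.
  rewrite (_ : B * _ = Q0 / q ^+ 2); last by rewrite /Q0; field; rewrite gt_eqF.
  by rewrite ler_pdivlMr ?mul1r// exprn_gt0.
have qQ1 : q <= Q0 by apply: (le_trans _ qQ); rewrite ler_eXnr.
have TT : T0 <= gtail x.
  by apply: gtail_nonincr; apply: (le_trans xq); rewrite ler_wpM2l// ltW.
have /andP[_ T1] := gtail_bounds x.
apply: (le_trans (ratio_crude T00 TT T1 _)).
  rewrite fine_ge0//= -lee_fin fineK ?fin_num_measure//; last exact: tail_event_measurable.
  by rewrite probability_le1//; exact: tail_event_measurable.
apply: (@le_trans _ _ (C2 * (q ^+ 3)^-1)).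
  rewrite /C2 mulrAC -[leLHS]mul1r ler_wpM2r ?invr_ge0 ?(ltW T00)//.
  by rewrite ler_pdivlMr ?exprn_gt0// mul1r lerXn2r ?nnegrE ?(ltW q0) ?(ltW Q00).
rewrite [(1 + _) * _]mulrDl mul1r.
have := mulr_ge0 (ltW C00) (ltW e0); have := mulr_ge0 (ltW C00) xe0.
have := mulr_ge0 C10 (ltW e0).
have := mulr_ge0 C10 xe0; have := mulr_ge0 C20 xe0.
move: (q ^+ 3)^-1 (x ^+ 3) => e z; lra.
Qed.

Lemma root6_inv_cvg0 {R : realType} :
  (fun n : nat => ((n%:R : R) `^ (6%:R^-1))^-1) @ \oo --> (0 : R).
Proof.
apply/cvgr0Pnorm_le => eps eps0.
near=> n.
have n0 : (0 : R) < n%:R.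
  by apply: (@lt_le_trans _ _ 1) => //; near: n; exact: nbhs_infty_ger.
have q0 : 0 < (n%:R : R) `^ (6%:R^-1) by exact: powR_gt0.
rewrite normfV gtr0_norm// invf_ple ?posrE//.
rewrite -(@ler_pXn2r _ 6) ?nnegrE ?invr_ge0 ?(ltW eps0) ?(ltW q0)// powR_invnK ?(ltW n0)//.
near: n; exact: nbhs_infty_ger.
Unshelve. all: by end_near. Qed.

Lemma rate_cvg0 {R : realType} (a : nat -> R) :
  a =o_\oo (fun n : nat => n%:R `^ (6%:R^-1) : R) ->
  (fun n => (1 + a n ^+ 3) / Num.sqrt n%:R) @ \oo --> (0 : R).
Proof.
move=> /eqoP ao.
pose q (n : nat) : R := n%:R `^ (6%:R^-1).
have q_ge0 n : 0 <= q n by exact: powR_ge0.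
have aq : (fun n => a n * (q n)^-1) @ \oo --> (0 : R).
  apply/cvgr0Pnorm_le => eps eps0; have := ao _ eps0; apply: filterS => n h.
  have [q0|q0] := eqVneq (q n) 0; first by rewrite q0 invr0 mulr0 normr0 ltW.
  have qp : 0 < q n by rewrite lt_neqAle eq_sym q0 q_ge0.
  rewrite normrM normfV (gtr0_norm qp) ler_pdivrMr//.
  by move: h; rewrite (gtr0_norm qp).
have cube u : (fun n : nat => u n : R) @ \oo --> (0 : R) ->
    (fun n => u n * (u n * u n)) @ \oo --> (0 : R).
  move=> hu; have h : (fun n => u n * (u n * u n)) @ \oo --> 0 * (0 * 0 : R).
    exact: cvgM hu (cvgM hu hu).
  by move: h; rewrite !mulr0.
have h := cvgD (cube _ root6_inv_cvg0) (cube _ aq).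
rewrite addr0 in h; 
rewrite (_ : (fun n => _) = (fun n => (q n)^-1 * ((q n)^-1 * (q n)^-1)
  + a n * (q n)^-1 * (a n * (q n)^-1 * (a n * (q n)^-1)))); first exact: h.
apply/funext => n.
have -> : Num.sqrt n%:R = q n ^+ 3.
  by rewrite -[in LHS](@powR_invnK R n%:R 5)// (exprM _ 3 2) sqrtr_sqr ger0_norm// exprn_ge0 ?q_ge0.
rewrite /= -/(q n) -exprVn; ring.
Qed.

(** Once [a n <= kap * n^(1/6)], the supremum is at most
[`|C| * ((1 + a n ^+ 3) / Num.sqrt n%:R)]. *)
Lemma tail_ratio_sup_cvg0 {R : realType} (C : R) (d : nat -> measure_display)
    (T : forall n, measurableType (d n)) (P : forall n, probability (T n) R)
    (X : forall n, 'I_n -> {RV (P n) >-> R}) (kap : R) : 0 < kap ->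
  (forall n, (0 < n)%N -> forall x, 0 <= x <= kap * n%:R `^ (6%:R^-1) ->
     `|tail_ratio (X n) x - 1| <= C * ((1 + x ^+ 3) / Num.sqrt n%:R)) ->
  forall a : nat -> R, (forall n, 0 <= a n) ->
  a =o_\oo (fun n : nat => n%:R `^ (6%:R^-1) : R) ->
  (fun n => ereal_sup
     [set (`|tail_ratio (X n) x - 1|)%:E | x in [set x : R | 0 <= x <= a n]])
    @ \oo --> 0%E.
Proof.
move=> kap0 hX a a0 ao.
have rate : (fun n => `|C| * ((1 + a n ^+ 3) / Num.sqrt n%:R)) @ \oo --> (0 : R).
  have hC : (fun _ : nat => `|C|) @ \oo --> `|C| by apply: cvg_cst.
  have h : (fun n => `|C| * ((1 + a n ^+ 3) / Num.sqrt n%:R)) @ \oo --> `|C| * 0.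
    exact: cvgM hC (rate_cvg0 ao).
  by move: h; rewrite mulr0.
apply: (@squeeze_cvge _ _ _ _ (fun=> 0%E) _
  (fun n => (`|C| * ((1 + a n ^+ 3) / Num.sqrt n%:R))%:E)); last first.
- by apply: cvg_EFin => //; near=> n.
- exact: cvg_cst.
have /eqoP ao' := ao.
near=> n; apply/andP; split.
  apply: (@le_trans _ _ (`|tail_ratio (X n) 0 - 1|)%:E); first by rewrite lee_fin.
  by apply: ereal_sup_ubound; exists 0 => //=; rewrite lexx a0.
apply: ge_ereal_sup => _ [x /= /andP[x0 xa] <-]; rewrite lee_fin.
have n0 : (0 < n)%N by near: n; exact: nbhs_infty_gt.
have an : a n <= kap * n%:R `^ (6%:R^-1).
  rewrite -[a n]ger0_norm// -[X in kap * X]ger0_norm ?powR_ge0//.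
  by near: n; exact: ao'.
apply: le_trans (hX n n0 x _) _; first by rewrite x0 (le_trans xa an).
have x30 : 0 <= x ^+ 3 by rewrite exprn_ge0.
apply: (@le_trans _ _ (`|C| * ((1 + x ^+ 3) / Num.sqrt n%:R))).
  by rewrite ler_wpM2r ?ler_norm// divr_ge0 ?sqrtr_ge0// addr_ge0.
rewrite ler_wpM2l// ler_wpM2r ?invr_ge0 ?sqrtr_ge0// lerD2l.
by rewrite lerXn2r ?nnegrE.
Unshelve. all: by end_near. Qed.

Theorem proposition4p6 (R : realType) :
  (exists C : R -> R -> R,
    forall (d : measure_display) (T : measurableType d) (P : probability T R)
      (n : nat) (X : 'I_n -> {RV P >-> R}) (c1 c2 t0 : R),
      (0 < n)%N -> 0 < c1 -> 0 < c2 -> 0 < t0 ->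
      moderate_deviation_hyp X c1 c2 t0 ->
      forall x : R,
        0 <= x <= (c1 * t0 ^+ 2) `^ (3%:R^-1) * n%:R `^ (6%:R^-1) ->
        `|tail_ratio X x - 1| <=
          C c2 (c1 * t0 ^+ 2) * ((1 + x ^+ 3) / Num.sqrt n%:R))
  /\
  (forall (c1 c2 t0 : R), 0 < c1 -> 0 < c2 -> 0 < t0 ->
    forall (d : nat -> measure_display) (T : forall n, measurableType (d n))
      (P : forall n, probability (T n) R)
      (X : forall n, 'I_n -> {RV (P n) >-> R}),
      (forall n, (0 < n)%N -> moderate_deviation_hyp (X n) c1 c2 t0) ->
      forall a : nat -> R,
        (forall n, 0 <= a n) ->
        a =o_\oo (fun n : nat => n%:R `^ (6%:R^-1) : R) ->
        (fun n => ereal_sup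
          [set (`|tail_ratio (X n) x - 1|)%:E | x in [set x : R | 0 <= x <= a n]])
          @ \oo --> 0%E).
Proof.
pose C c2 K : R := if pselect (0 < c2 /\ 0 < K) is left h
  then projT1 (cid (moderate_deviation_bound h.1 h.2)) else 0.
have CP (d : measure_display) (T : measurableType d) (P : probability T R)
      (n : nat) (X : 'I_n -> {RV P >-> R}) (c1 c2 t0 : R) :
    (0 < n)%N -> 0 < c1 -> 0 < c2 -> 0 < t0 -> moderate_deviation_hyp X c1 c2 t0 ->
    forall x : R, 0 <= x <= (c1 * t0 ^+ 2) `^ (3%:R^-1) * n%:R `^ (6%:R^-1) ->
    `|tail_ratio X x - 1| <= C c2 (c1 * t0 ^+ 2) * ((1 + x ^+ 3) / Num.sqrt n%:R).
  move=> n0 c10 c20 t00 hX x xq.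
  rewrite /C; case: pselect => [h|]; last by case; rewrite mulr_gt0// exprn_gt0.
  by case: cid => /= C' hC'; exact: hC' hX _ xq.
split; first by exists C.
move=> c1 c2 t0 c10 c20 t00 d T P X hX.
apply: (@tail_ratio_sup_cvg0 R (C c2 (c1 * t0 ^+ 2)) d T P X
   ((c1 * t0 ^+ 2) `^ (3%:R^-1))).
  by rewrite powR_gt0// mulr_gt0// exprn_gt0.
move=> n n0 x xq; exact: (CP _ _ _ _ _ _ _ _ n0 c10 c20 t00 (hX n n0)).
Qed.
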